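(* Let $(X,\omega)$ be a compact Kähler manifold with a Hamiltonian holomorphic isometric action of a compact torus $\mathbb{T}$, moment map $\mu$ and moment polytope $P=\mu(X)$, let $v:P\to\mathbb{R}_{>0}$ be smooth, and let $E\to X$ be a simple $\mathbb{T}$-equivariant holomorphic vector bundle. Then a $v$-weighted Hermite--Einstein metric on $E$ is unique up to scaling: if $h_0,h_1$ are two such metrics, then $h_1=c\,h_0$ for some constant $c>0$.
   Context: Setting. $(X,\omega)$ is a compact Kähler manifold of complex dimension $n$ on which a compact real torus $\mathbb{T}$ (Lie algebra $\mathfrak{t}$) acts by holomorphic Hamiltonian isometries; $\mu:X\to\mathfrak{t}^*$ is a fixed moment map, with $d\langle\mu,\xi\rangle=\omega(-,\xi)$ for $\xi\in\mathfrak{t}$ (identified with the vector field it generates). $E\to X$ is a holomorphic vector bundle with a fixed lift of the $\mathbb{T}$-action by biholomorphisms, linear on fibres; $E$ is simple if its only global holomorphic endomorphisms are the constant multiples of the identity. For a $\mathbb{T}$-invariant Hermitian metric $h$ on $E$, let $\nabla^h$ be the Chern connection, $F_h$ its curvature, and $\Phi_h\in\Gamma(\mathfrak{t}^*\otimes\mathrm{End}(E))$ the canonical moment map $\langle\Phi_h,\xi\rangle=\nabla^h_\xi-\mathcal{L}^E_\xi$, where $\mathcal{L}^E_\xi s=\frac{d}{dt}|_{t=0}\exp(-t\xi)\cdot s$ and $(g\cdot s)(x)=g(s(g^{-1}x))$. Set $\Lambda_\omega F_h=nF_h\wedge\omega^{n-1}/\omega^n$ and $\Lambda_{\omega,v}(F_h+\Phi_h)=v(\mu)\Lambda_\omega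 F_h+\langle\Phi_h,dv(\mu)\rangle$, where $dv(p)\in\mathfrak{t}^{**}\cong\mathfrak{t}$. A $\mathbb{T}$-invariant metric $h$ is $v$-weighted Hermite--Einstein if $\frac{i}{2\pi}\Lambda_{\omega,v}(F_h+\Phi_h)=c_v\,\mathrm{Id}_E$ for a real constant $c_v$. *)

(* Defs.v *)
From HB Require Import structures.
From mathcomp Require Import all_boot all_order all_algebra all_fingroup.
From mathcomp Require Import complex.
From mathcomp Require Import all_classical all_reals all_analysis.

Set Implicit Arguments.
Unset Strict Implicit.
Unset Printing Implicit Defensive.

Import Order.TTheory GRing.Theory Num.Theory.
Import numFieldNormedType.Exports.

Local Open Scope classical_set_scope.
Local Open Scope complex_scope.
Local Open Scope ring_scope.

(** * Calculus *)

Section Calculus.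
Variable R : realType.

(* For open [D], [Ck V k D f] says that all directional derivatives of [f] of
   order at most [k] exist and are continuous on [D]. *)
Fixpoint Ck (V : normedModType R) (k : nat) (D : set V) (f : V -> R) : Prop :=
  (forall z, D z -> {for z, continuous f}) /\
  (if k is l.+1 then
     forall w : V, (forall z, D z -> derivable f z w) /\
                   Ck l D (fun z => 'D_w f z)
   else True).

Definition smooth (V : normedModType R) (D : set V) (f : V -> R) : Prop :=
  forall k, Ck k D f.

Definition csmooth (V : normedModType R) (D : set V) (f : V -> R[i]) : Prop :=
  smooth D (fun z => complex.Re (f z)) /\ smooth D (fun z => complex.Im (f z)).

Definition cderiv (f : R -> R[i]) (t : R) : R[i] :=
  (derive1 (fun s => complex.Re (f s)) t) +i*
  (derive1 (fun s => complex.Im (f s)) t).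

Definition of_real n (p : 'rV[R]_n * 'rV[R]_n) : 'rV[R[i]]_n :=
  \row_a (p.1 0 a +i* p.2 0 a).

End Calculus.

(** * Complex manifolds *)

(* A holomorphic atlas on [X]; [param i] is the inverse of [chart i] and is
   meaningful on the image of [cdom i] only.  Complex differentiability is
   Frechet differentiability over the field [R[i]]. *)
Record complex_atlas (R : realType) (X : topologicalType) (n : nat) := {
  cidx : Type;
  cdom : cidx -> set X;
  chart : cidx -> X -> 'rV[R[i]^o]_n;
  param : cidx -> 'rV[R[i]^o]_n -> X;
  cdom_cover : forall x, exists i, cdom i x;
  cdom_open : forall i, open (cdom i);
  chart_open : forall i, open (chart i @` cdom i);
  chartK : forall i x, cdom i x -> param i (chart i x) = x;
  chart_continuous : forall i x, cdom i x -> {for x, continuous (chart i)};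
  param_continuous : forall i x, cdom i x ->
    {for chart i x, continuous (param i)};
  transition_holo : forall i j x, cdom i x -> cdom j x ->
    differentiable (fun z => chart j (param i z)) (chart i x)
}.

Section Manifold.
Variables (R : realType) (X : topologicalType) (n : nat).
Variable M : complex_atlas R X n.
Local Notation C := R[i].

Definition holo_on (W : set X) (f : X -> C) : Prop :=
  forall (i : cidx M) x, cdom i x -> W x ->
    differentiable (fun z => f (param i z) : C^o) (chart i x).

Definition smooth_on (W : set X) (f : X -> C) : Prop :=
  forall i : cidx M,
    csmooth [set p | (chart i @` (cdom i `&` W)) (of_real p)]
            (fun p => f (param i (of_real p))).

Definition smooth_row_on r (W : set X) (c : X -> 'rV[C]_r) : Prop :=
  forall a, smooth_on W (fun x => c x 0 a).

(* Smoothness on an open subset [W] of R^k x X. *)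
Definition smooth_on2 k (W : set ('rV[R]_k * X)) (f : 'rV[R]_k -> X -> C) :
    Prop :=
  forall i : cidx M,
    csmooth [set q : 'rV[R]_k * ('rV[R]_n * 'rV[R]_n) |
              exists x, [/\ cdom i x, W (q.1, x) & chart i x = of_real q.2]]
            (fun q => f q.1 (param i (of_real q.2))).

(* A real tangent vector at [x] is given by its coordinates [u] in C^n (seen as
   R^2n) in a chart around [x]; the complex structure is [u |-> 'i%C *: u]. *)
Definition dX (i : cidx M) (f : X -> C) (x : X) (u : 'rV[C]_n) : C :=
  cderiv (fun t => f (param i (chart i x + t%:C *: u))) 0.

Definition dXrow r (i : cidx M) (c : X -> 'rV[C]_r) (x : X) (u : 'rV[C]_n) :
    'rV[C]_r :=
  \row_a dX i (fun y => c y 0 a) x u.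

(* Tangent map of [F], from chart [i] around [x] to chart [j] around [F x]. *)
Definition tangent (i j : cidx M) (F : X -> X) (x : X) (u : 'rV[C]_n) :
    'rV[C]_n :=
  dXrow i (fun y => chart j (F y)) x u.

Record kahler_form := {
  kform : cidx M -> X -> 'rV[C]_n -> 'rV[C]_n -> R;
  kform_linear : forall i x (a : R) u u' w, cdom i x ->
    kform i x (a%:C *: u + u') w = a * kform i x u w + kform i x u' w;
  kform_antisym : forall i x u w, cdom i x -> kform i x u w = - kform i x w u;
  kform_glue : forall i j x u w, cdom i x -> cdom j x ->
    kform j x (tangent i j id x u) (tangent i j id x w) = kform i x u w;
  kform_smooth : forall i u w, smooth_on (cdom i) (fun x => (kform i x u w)%:C);
  kform_J : forall i x u w, cdom i x ->
    kform i x ('i%C *: u) ('i%C *: w) = kform i x u w;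
  kform_pos : forall i x u, cdom i x -> u <> 0 -> 0 < kform i x u ('i%C *: u);
  kform_closed : forall i x u1 u2 u3, cdom i x ->
    dX i (fun y => (kform i y u2 u3)%:C) x u1 +
    dX i (fun y => (kform i y u3 u1)%:C) x u2 +
    dX i (fun y => (kform i y u1 u2)%:C) x u3 = 0
}.

Definition kmetric (om : kahler_form) (i : cidx M) (x : X) (u w : 'rV[C]_n) : R :=
  kform om i x u ('i%C *: w).

End Manifold.

(** * Hamiltonian torus actions *)

Section Torus.
Variable R : realType.
Local Notation C := R[i].

(* The torus (S^1)^k, with Lie algebra R^k and exponential map
   xi |-> (exp(i xi_a))_a; the dual of the Lie algebra is R^k, with the
   standard pairing. *)
Definition torus k : set 'rV[C]_k := [set t | forall a, `|t 0 a| = 1].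
Definition tmul k (s t : 'rV[C]_k) : 'rV[C]_k := \row_a (s 0 a * t 0 a).
Definition texp k (xi : 'rV[R]_k) : 'rV[C]_k :=
  \row_a (cos (xi 0 a) +i* sin (xi 0 a)).
Definition pairing k (p xi : 'rV[R]_k) : R := \sum_a p 0 a * xi 0 a.

Variables (X : topologicalType) (n : nat) (M : complex_atlas R X n).

(* Smoothness on T x X is tested after composition with the local
   diffeomorphism [texp]. *)
Record torus_action (k : nat) := {
  act : 'rV[C]_k -> X -> X;
  act1 : forall x, act (const_mx 1) x = x;
  actM : forall s t x, torus s -> torus t -> act (tmul s t) x = act s (act t x);
  act_continuous : continuous (fun p : 'rV[R]_k * X => act (texp p.1) p.2);
  act_smooth : forall (j : cidx M) a,
    smooth_on2 M [set p | cdom j (act (texp p.1) p.2)]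
               (fun xi x => chart j (act (texp xi) x) 0 a);
  act_holo : forall t (i j : cidx M) x, torus t -> cdom i x ->
    cdom j (act t x) ->
    differentiable (fun z => chart j (act t (param i z))) (chart i x)
}.

Section Hamiltonian.
Variables (om : kahler_form M) (k : nat) (T : torus_action k).

Definition isometric_action : Prop :=
  forall t (i j : cidx M) x u w, torus t -> cdom i x -> cdom j (act T t x) ->
    kmetric om j (act T t x) (tangent i j (act T t) x u)
                             (tangent i j (act T t) x w)
    = kmetric om i x u w.

Definition vecfield (i : cidx M) (xi : 'rV[R]_k) (x : X) : 'rV[C]_n :=
  \row_a cderiv (fun t => chart i (act T (texp (t *: xi)) x) 0 a) 0.

Definition moment_map (mu : X -> 'rV[R]_k) : Prop :=
  [/\ forall a, smooth_on M setT (fun x => (mu x 0 a)%:C),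
      forall t x, torus t -> mu (act T t x) = mu x
    & forall (i : cidx M) x u xi, cdom i x ->
        dX i (fun y => (pairing (mu y) xi)%:C) x u
        = (kform om i x u (vecfield i xi x))%:C].

End Hamiltonian.

Definition moment_polytope k (mu : X -> 'rV[R]_k) : set 'rV[R]_k := range mu.

(* A smooth positive function on the moment polytope [P], i.e. one which is
   smooth on some open neighbourhood of [P]. *)
Definition polytope_weight k (P : set 'rV[R]_k) (v : 'rV[R]_k -> R) : Prop :=
  (exists U : set 'rV[R]_k, [/\ open U, P `<=` U & smooth U v]) /\
  (forall p, P p -> 0 < v p).

Definition dweight k (v : 'rV[R]_k -> R) (p : 'rV[R]_k) : 'rV[R]_k :=
  \row_a 'D_(delta_mx 0 a : 'rV[R]_k) v p.

End Torus.

(** * Equivariant holomorphic vector bundles *)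

Section Bundles.
Variables (R : realType) (X : topologicalType) (n : nat).
Variable M : complex_atlas R X n.
Local Notation C := R[i].

(* [triv j] gives the fibre coordinates, as row vectors, in the [j]-th local
   trivialisation, and [frame j x] is its inverse on the fibre over [x].  The
   vector space structure of the fibres is read in the trivialisations. *)
Record hol_bundle (r : nat) := {
  tot : Type;
  bproj : tot -> X;
  fidx : Type;
  fdom : fidx -> set X;
  triv : fidx -> tot -> 'rV[C]_r;
  frame : fidx -> X -> 'rV[C]_r -> tot;
  fdom_cover : forall x, exists j, fdom j x;
  fdom_open : forall j, open (fdom j);
  bproj_frame : forall j x c, fdom j x -> bproj (frame j x c) = x;
  frameK : forall j x c, fdom j x -> triv j (frame j x c) = c;
  trivK : forall j e, fdom j (bproj e) -> frame j (bproj e) (triv j e) = e;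
  trans_linear : forall j l x, fdom j x -> fdom l x ->
    linear (fun c => triv l (frame j x c));
  trans_holo : forall j l a b,
    holo_on M (fdom j `&` fdom l)
            (fun x => triv l (frame j x (delta_mx 0 a)) 0 b)
}.

Variables (r : nat) (E : hol_bundle r).

(* Matrix, acting on row vectors on the right, of a fibrewise linear map from
   the fibre over [x], in the trivialisation [j], to some fibre in the
   trivialisation [l]. *)
Definition fibmx (j l : fidx E) (f : tot E -> tot E) (x : X) : 'M[C]_r :=
  \matrix_(a, b) triv l (f (frame j x (delta_mx 0 a))) 0 b.

Definition holo_endo (f : tot E -> tot E) : Prop :=
  [/\ forall e, bproj (f e) = bproj e,
      forall (j : fidx E) x, fdom j x ->
        linear (fun c => triv j (f (frame j x c)))
    & forall (j : fidx E) a b, holo_on M (fdom j) (fun x => fibmx j j f x a b)].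

Definition simple_bundle : Prop :=
  forall f, holo_endo f ->
    exists lam : C, forall (j : fidx E) e, fdom j (bproj e) ->
      triv j (f e) = lam *: triv j e.

Record torus_lift (k : nat) (T : torus_action M k) := {
  lact : 'rV[C]_k -> tot E -> tot E;
  lact1 : forall e, lact (const_mx 1) e = e;
  lactM : forall s t e, torus s -> torus t ->
    lact (tmul s t) e = lact s (lact t e);
  bproj_lact : forall t e, torus t -> bproj (lact t e) = act T t (bproj e);
  lact_linear : forall t (j l : fidx E) x, torus t -> fdom j x ->
    fdom l (act T t x) -> linear (fun c => triv l (lact t (frame j x c)));
  lact_holo : forall t (j l : fidx E) a b, torus t ->
    holo_on M [set x | fdom j x /\ fdom l (act T t x)]
            (fun x => fibmx j l (lact t) x a b);
  lact_smooth : forall (j l : fidx E) a b,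
    smooth_on2 M [set p | fdom j p.2 /\ fdom l (act T (texp p.1) p.2)]
               (fun xi x => fibmx j l (lact (texp xi)) x a b)
}.

(* [h e e'] is meaningful for [e], [e'] in the same fibre; it is linear in [e]
   and conjugate-linear in [e']. *)
Definition hermitian_metric (h : tot E -> tot E -> C) : Prop :=
  [/\ forall (j : fidx E) x d, fdom j x ->
        linear (fun c => h (frame j x c) (frame j x d) : C^o),
      forall e e', bproj e = bproj e' -> h e' e = (h e e')^*,
      forall (j : fidx E) x c, fdom j x -> c <> 0 ->
        0 < h (frame j x c) (frame j x c)
    & forall (j : fidx E) (a b : 'I_r), smooth_on M (fdom j)
        (fun x => h (frame j x (delta_mx 0 a)) (frame j x (delta_mx 0 b)))].

Definition invariant_metric k (T : torus_action M k) (L : torus_lift T)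
    (h : tot E -> tot E -> C) : Prop :=
  forall t e e', torus t -> bproj e = bproj e' ->
    h (lact L t e) (lact L t e') = h e e'.

(** * Chern connection, curvature and canonical moment map *)

(* A connection is given by its matrices of 1-forms: [A i j u x] is the value
   at [x] of the connection form in the trivialisation [j] on the vector field
   which is constant equal to [u] in the chart [i]. *)
Definition conn_form : Type := cidx M -> fidx E -> 'rV[C]_n -> X -> 'M[C]_r.

(* Covariant derivative along [u] of the section with coordinates [c]. *)
Definition cov (A : conn_form) (i : cidx M) (j : fidx E) (u : 'rV[C]_n)
    (c : X -> 'rV[C]_r) (x : X) : 'rV[C]_r :=
  dXrow i c x u + c x *m A i j u x.

Definition connection (A : conn_form) : Prop :=
  [/\ forall i j x (a : R) u u', cdom i x -> fdom j x ->
        A i j (a%:C *: u + u') x = a%:C *: A i j u x + A i j u' x,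
      forall i j u a b,
        smooth_on M (cdom i `&` fdom j) (fun x => A i j u x a b)
    & forall i i' j j' x u (W : set X) (c : X -> 'rV[C]_r),
        cdom i x -> cdom i' x -> fdom j x -> fdom j' x ->
        open W -> W x -> smooth_row_on M W c ->
        cov A i' j' (tangent i i' id x u) (fun y => triv j' (frame j y (c y))) x
        = triv j' (frame j x (cov A i j u c x))].

(* The (0,1)-part of the connection is the Cauchy-Riemann operator of [E], and
   the connection is compatible with [h]. *)
Definition chern_connection (h : tot E -> tot E -> C) (A : conn_form) : Prop :=
  [/\ connection A,
      forall i j x u (W : set X) (c : X -> 'rV[C]_r), cdom i x -> fdom j x ->
        open W -> W x -> smooth_row_on M W c ->
        cov A i j u c x + 'i%C *: cov A i j ('i%C *: u) c x
        = dXrow i c x u + 'i%C *: dXrow i c x ('i%C *: u)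
    & forall i j x u (W : set X) (c d : X -> 'rV[C]_r), cdom i x -> fdom j x ->
        open W -> W x -> smooth_row_on M W c -> smooth_row_on M W d ->
        dX i (fun y => h (frame j y (c y)) (frame j y (d y))) x u
        = h (frame j x (cov A i j u c x)) (frame j x (d x))
          + h (frame j x (c x)) (frame j x (cov A i j u d x))].

(* Row [a] is [nabla_u, nabla_w] applied to the [a]-th vector of the frame; the
   constant fields [u], [w] commute. *)
Definition curvature (A : conn_form) (i : cidx M) (j : fidx E)
    (u w : 'rV[C]_n) (x : X) : 'M[C]_r :=
  \matrix_(a < r)
    (cov A i j u (cov A i j w (fun=> delta_mx 0 a)) x
     - cov A i j w (cov A i j u (fun=> delta_mx 0 a)) x).

(* Value of the 2n-form alpha_1 /\ ... /\ alpha_n (alpha_m being 2-forms) on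
   the vectors [b], listed in the order
   lshift 0, rshift 0, lshift 1, rshift 1, ... *)
Definition wedge2 (alpha : 'I_n -> 'rV[C]_n -> 'rV[C]_n -> C)
    (b : 'I_(n + n) -> 'rV[C]_n) : C :=
  (2 ^+ n)^-1 * \sum_(s : 'S_(n + n)) (-1) ^+ s *
    \prod_(m < n) alpha m (b (s (lshift n m))) (b (s (rshift n m))).

Definition real_basis (l : 'I_(n + n)) : 'rV[C]_n :=
  match fintype.split l with
  | inl m => delta_mx 0 m
  | inr m => 'i%C *: delta_mx 0 m
  end.

(* n F /\ omega^(n-1) / omega^n, as a ratio of forms of top degree. *)
Definition contraction (om : kahler_form M) (i : cidx M) (x : X)
    (F : 'rV[C]_n -> 'rV[C]_n -> C) : C :=
  let omC u w := (kform om i x u w)%:C in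
  n%:R * wedge2 (fun m => if val m == 0%N then F else omC) real_basis
  / wedge2 (fun=> omC) real_basis.

Definition contracted_curvature (om : kahler_form M) (A : conn_form)
    (i : cidx M) (j : fidx E) (x : X) : 'M[C]_r :=
  \matrix_(a, b) contraction om i x (fun u w => curvature A i j u w x a b).

Section Weighted.
Variables (k : nat) (T : torus_action M k) (L : torus_lift T).

(* Coordinates of d/dt exp(-t xi) . s at t = 0, s having coordinates [c]. *)
Definition lieE (j : fidx E) (xi : 'rV[R]_k) (c : X -> 'rV[C]_r) (x : X) :
    'rV[C]_r :=
  \row_a cderiv (fun t =>
    let y := act T (texp (t *: xi)) x in
    triv j (lact L (texp (- t *: xi)) (frame j y (c y))) 0 a) 0.

Definition canonical_moment (A : conn_form) (i : cidx M) (j : fidx E)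
    (xi : 'rV[R]_k) (x : X) : 'M[C]_r :=
  \matrix_(a < r) (cov A i j (vecfield T i xi x) (fun=> delta_mx 0 a) x
                   - lieE j xi (fun=> delta_mx 0 a) x).

Definition weighted_contraction (om : kahler_form M) (mu : X -> 'rV[R]_k)
    (v : 'rV[R]_k -> R) (A : conn_form) (i : cidx M) (j : fidx E) (x : X) :
    'M[C]_r :=
  (v (mu x))%:C *: contracted_curvature om A i j x
  + canonical_moment A i j (dweight v (mu x)) x.

Definition weighted_hermite_einstein (om : kahler_form M) (mu : X -> 'rV[R]_k)
    (v : 'rV[R]_k -> R) (h : tot E -> tot E -> C) : Prop :=
  [/\ hermitian_metric h, invariant_metric L h
    & exists2 A, chern_connection h A &
      exists cv : R, forall i j x, cdom i x -> fdom j x ->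
        ('i%C / (2 * pi)%:C) *: weighted_contraction om mu v A i j x
        = (cv%:C)%:M].

End Weighted.

End Bundles.

(* Main.v *)
From HB Require Import structures.
Require Import Defs.
From mathcomp Require Import all_boot all_order all_algebra all_fingroup.
From mathcomp Require Import complex ring lra.
From mathcomp Require Import all_classical all_reals all_analysis.

(** Let h0 and h1 be two weighted Hermite-Einstein metrics, with Gram matrices
    H0 and H1 in a local frame of E.  The matrix K = H1 H0^-1 represents a
    global endomorphism, the one with h1 (s, t) = h0 (K s, t), and f = tr K is
    a positive function on X.  The proof shows that f is constant, that K is
    then holomorphic, and that simplicity therefore makes K a scalar.

    If A0 and A1 are the Chern forms and B = A1 - A0, then
    dK = A1 K - K A0 + H1 B^* H0^-1, where the first two terms are the
    (1,0)-part.  Differentiating once more in the directions of a unitary frame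
    (e_a) of the tangent space gives ([tr_hessian_sum])
      sum_a (D_{e_a}^2 + D_{i e_a}^2) f
        = 2 Re tr (S K) + 4 sum_a tr (B(e_a) H1 B(e_a)^* H0^-1),
    where i S is the difference of the contracted curvatures.  In the difference
    of the two weighted equations the Lie derivatives in the canonical moment
    maps cancel and leave v S = i B(V) - 2 pi (c1 - c0), with V the vector field
    generated by dv(mu).  Since 2 Re tr (i B(V) K) is D_{i V} f, the function f
    satisfies ([weighted_bochner])
      v sum_a (D_{e_a}^2 + D_{i e_a}^2) f
        = D_{i V} f - 4 pi (c1 - c0) f + 4 v sum_a |B(e_a)|^2.

    At a maximum of f the left-hand side is nonpositive and D_{i V} f vanishes,
    so c0 <= c1; exchanging the metrics, c0 = c1.  Now f is a subsolution of an
    elliptic equation without term of order zero, and the strong maximum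
    principle ([strong_maximum]) makes the set Z of maximum points open.  It is
    also closed.  At the points of Z the equation forces B = 0, hence the
    (0,1)-part of dK vanishes there and K, cut off to zero outside Z, is a
    holomorphic endomorphism ([comparison_endo_holo]).  It is nonzero on Z, so
    being a scalar it cannot vanish anywhere: Z = X and K is a positive
    constant.

    Two ingredients are of a different nature.  The contraction
    n F /\ om^(n-1) / om^n is a quotient of alternating sums over permutations,
    and [contraction_kframe] evaluates it as the sum of F (e_a, i e_a).  The
    maximum principle needs bounds that are uniform near each point;
    [kahler_elliptic] provides them, the bound on V coming from the moment map
    equation g (V, V) = - d<mu, dv(mu)>(i V). *)

Set Implicit Arguments.
Unset Strict Implicit.
Unset Printing Implicit Defensive.

Import Order.TTheory GRing.Theory Num.Theory.
Import numFieldNormedType.Exports.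

Local Open Scope classical_set_scope.
Local Open Scope sesquilinear_scope.
Local Open Scope complex_scope.
Local Open Scope ring_scope.

(** * Positive Hermitian matrices and products of two-forms *)

Section HermitianForms.
Variable C : numClosedFieldType.

(** A unitary matrix diagonalises H, and positivity allows to rescale by the
    inverse square roots of the eigenvalues. Applied both to the metrics on
    the fibres of E and to the Kaehler metric. *)
Lemma posdef_orthonormal n (H : 'M[C]_n) :
  H ^t* = H -> (forall c : 'rV_n, c != 0 -> 0 < (c *m H *m c ^t*) 0 0) ->
  exists2 P : 'M[C]_n, P \in unitmx & P *m H *m P ^t* = 1%:M.
Proof.
move=> Hh Hpos.
have Hherm : H \is hermsymmx.
  by apply/is_hermitianmxP; rewrite /= expr0 scale1r -[in LHS]Hh.
have [U_ [d HE]] : exists U : 'M[C]_n, exists d : 'rV[C]_n,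
   U \is unitarymx /\ H = invmx U *m diag_mx d *m U.
  exists (spectralmx H), (spectral_diag H); split; first exact: spectral_unitarymx.
  by apply/orthomx_spectralP/hermitian_normalmx.
case: HE => Uu HE.
have UI := invmx_unitary Uu.
have UU : U_ *m U_ ^t* = 1%:M by apply/unitarymxP.
have UHU : U_ *m H *m U_ ^t* = diag_mx d.
  by rewrite HE UI !mulmxA UU mul1mx -mulmxA UU mulmx1.
have dpos a : 0 < d 0 a.
  have := Hpos (row a U_).
  have /[swap]/[apply] : row a U_ != 0.
    apply/negP => /eqP r0.
    have : (U_ *m U_ ^t*) a a = 0.
      rewrite mxE big1 // => b _.
      by move/rowP: r0 => /(_ b); rewrite !mxE => ->; rewrite mul0r.
    by rewrite UU mxE eqxx => /eqP; rewrite oner_eq0.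
  have -> : (row a U_ *m H *m (row a U_) ^t*) 0 0 = (U_ *m H *m U_ ^t*) a a.
    rewrite -row_mul !mxE; apply: eq_bigr => b _; rewrite !mxE; congr (_ * _).
  by rewrite UHU mxE eqxx mulr1n.
exists (diag_mx (\row_a (sqrtC (d 0 a))^-1) *m U_).
  rewrite unitmx_mul unitmxE det_diag; apply/andP; split; last exact: unitarymx_unit.
  rewrite unitfE; apply/prodf_neq0 => a _.
  by rewrite mxE invr_eq0 sqrtC_eq0 gt_eqF.
set D := diag_mx _; rewrite trmx_mul map_mxM.
have -> : D *m U_ *m H *m (U_ ^t* *m D ^t*) = D *m (U_ *m H *m U_ ^t*) *m D ^t*.
  by rewrite !mulmxA.
rewrite UHU {}/D.
rewrite tr_diag_mx map_diag_mx -mulmxA mulmx_diag mulmx_diag.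
apply/matrixP => a b; rewrite !mxE; case: (eqVneq a b) => [_|]; last by [].
have s0 : 0 <= sqrtC (d 0 a) by rewrite sqrtC_ge0 ltW.
have -> : forall z : C, Num.Num_conj__canonical__GRing_RMorphism C z = z^* by [].
rewrite fmorphV /= conj_Creal ?ger0_real // !mulr1n mulrCA.
by rewrite -invfM -expr2 sqrtCK mulfV // gt_eqF.
Qed.

End HermitianForms.

Section Wedge.
Variable K : fieldType.

(** Up to the factor 2^-n, the value of a product of n two-forms on 2n
    vectors: [Phi m p q] is the value of the m-th form on the vectors p and q.
    *)
Definition mwedge n (Phi : 'I_n -> 'M[K]_(n + n)) : K :=
  \sum_(s : 'S_(n + n)) (-1) ^+ s *
    \prod_(m < n) Phi m (s (lshift n m)) (s (rshift n m)).

(** Forms of top degree are determined by their value on one basis. As for the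
    determinant of a product, expanding over all maps f of the indices leaves
    only the injective ones, since the others yield a determinant with two
    equal rows. *)
Lemma mwedge_congr n (M : 'M[K]_(n + n)) (Phi : 'I_n -> 'M[K]_(n + n)) :
  mwedge (fun m => M *m Phi m *m M^T) = \det M * mwedge Phi.
Proof.
pose W (f : {ffun 'I_(n + n) -> 'I_(n + n)}) :=
  \prod_(m < n) Phi m (f (lshift n m)) (f (rshift n m)).
have prodE (s : 'S_(n + n)) :
    \prod_(m < n) (M *m Phi m *m M^T) (s (lshift n m)) (s (rshift n m)) =
    \sum_(f : {ffun 'I_(n + n) -> 'I_(n + n)}) (\prod_p M (s p) (f p)) * W f.
  pose F p q := M (s p) q.
  transitivity (\prod_(m < n) \sum_(pq : 'I_(n + n) * 'I_(n + n))
     (F (lshift n m) pq.1 * F (rshift n m) pq.2 * Phi m pq.1 pq.2)).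
    apply: eq_bigr => m _; rewrite mxE.
    rewrite (eq_bigr (fun q => \sum_p F (lshift n m) p * F (rshift n m) q * Phi m p q)).
      by rewrite exchange_big pair_big.
    move=> q _; rewrite !mxE big_distrl; apply: eq_bigr => p _ /=.
    by rewrite mulrAC.
  rewrite bigA_distr_bigA /=.
  pose split_f (f : {ffun 'I_(n + n) -> 'I_(n + n)}) : {ffun 'I_n -> 'I_(n + n) * 'I_(n + n)} :=
    [ffun m => (f (lshift n m), f (rshift n m))].
  pose join_f (g : {ffun 'I_n -> 'I_(n + n) * 'I_(n + n)}) : {ffun 'I_(n + n) -> 'I_(n + n)} :=
    [ffun p => match fintype.split p with inl m => (g m).1 | inr m => (g m).2 end].
  rewrite (reindex split_f) /=; last first.
    exists join_f => [f _|g _].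
      apply/ffunP => p; rewrite ffunE -[in RHS](splitK p).
      by case: (fintype.split p) => m /=; rewrite ffunE.
    apply/ffunP => m; rewrite ffunE !ffunE.
    by rewrite (unsplitK (inl m)) (unsplitK (inr m)) -surjective_pairing.
  apply: eq_bigr => f _; rewrite big_split_ord /= /W -!big_split /=.
  by apply: eq_bigr => m _; rewrite ffunE.
pose Q (f : 'I_(n + n) -> 'I_(n + n)) : 'M[K]_(n + n) := \matrix_(p, q) M q (f p).
transitivity (\sum_(f : {ffun 'I_(n + n) -> 'I_(n + n)}) \det (Q f) * W f).
  rewrite /mwedge; under eq_bigr do rewrite prodE big_distrr /=.
  rewrite exchange_big; apply: eq_bigr => f _ /=.
  rewrite /determinant big_distrl /=; apply: eq_bigr => s _.
  by rewrite mulrA; congr (_ * _ * _); apply: eq_bigr => p _; rewrite mxE.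
rewrite (bigID (fun f : {ffun 'I_(n + n) -> 'I_(n + n)} => injectiveb f)) /=.
rewrite [X in _ + X]big1 ?addr0; last first.
  move=> f /injectivePn[p [q pq fpq]].
  by rewrite (determinant_alternate pq) ?mul0r // => b; rewrite !mxE fpq.
rewrite /mwedge big_distrr /= (reindex (@pval _)) /=; last first.
  pose to_perm (f : {ffun 'I_(n + n) -> 'I_(n + n)}) := insubd (1%g : 'S_(n + n)) f.
  exists to_perm => [s _|f fi]; first exact: valKd.
  exact: (insubdK _ fi).
apply: eq_big => [s|s _]; first by rewrite (valP s).
have -> : Q (pval s) = row_perm s (M^T) by apply/matrixP => p q; rewrite !mxE pvalE.
rewrite row_permE det_mulmx det_perm det_tr -mulrA mulrCA; congr (_ * (_ * _)).
by rewrite /W; apply: eq_bigr => m _; rewrite pvalE.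
Qed.

(** The indices [lshift n m] and [rshift n m] form a pair; in a Darboux basis
    the symplectic form only sees the two vectors of a pair. *)
Definition partner n (p : 'I_(n + n)) : 'I_(n + n) :=
  match fintype.split p with inl m => rshift n m | inr m => lshift n m end.
Definition orient n (p : 'I_(n + n)) : K := if fintype.split p is inl _ then 1 else - 1.
Definition symplectic n : 'M[K]_(n + n) :=
  \matrix_(p, q) (if q == partner p then orient p else 0).

Lemma partner_l n m : partner (lshift n m) = rshift n m.
Proof. by rewrite /partner (unsplitK (inl m)). Qed.
Lemma partner_r n m : partner (rshift n m) = lshift n m.
Proof. by rewrite /partner (unsplitK (inr m)). Qed.
Lemma orient_l n (m : 'I_n) : orient (lshift n m) = 1.
Proof. by rewrite /orient (unsplitK (inl m)). Qed.
Lemma orient_r n (m : 'I_n) : orient (rshift n m) = -1.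
Proof. by rewrite /orient (unsplitK (inr m)). Qed.

Lemma splitW n (P : 'I_(n + n) -> Prop) :
  (forall m, P (lshift n m)) -> (forall m, P (rshift n m)) -> forall p, P p.
Proof. by move=> Pl Pr p; rewrite -(splitK p); case: (fintype.split p). Qed.

Lemma partnerK n : involutive (@partner n).
Proof. by elim/splitW => m; rewrite ?partner_l ?partner_r ?partner_l. Qed.
Lemma partner_neq n (p : 'I_(n + n)) : (partner p == p) = false.
Proof.
by elim/splitW: p => m; rewrite ?partner_l ?partner_r ?eq_rlshift ?eq_lrshift.
Qed.
Lemma orient_partner n (p : 'I_(n + n)) : orient (partner p) = - orient p.
Proof.
by elim/splitW: p => m; rewrite ?partner_l ?partner_r ?orient_l ?orient_r ?opprK.
Qed.

Definition pairing_perm n (s : 'S_(n + n)) := [forall p, s (partner p) == partner (s p)].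

Lemma pairing_permP n (s : 'S_(n + n)) :
  reflect (forall p, s (partner p) = partner (s p)) (pairing_perm s).
Proof. exact: 'forall_eqP. Qed.

(** In blocks, the matrix of s is (A B; B A), of determinant det (A + B) det
    (A - B). Here A + B is the permutation t of the pairs, and A - B is t with
    a sign for each pair that s reverses; so the two signatures of t cancel
    and the signs of the reversed pairs remain. *)
Lemma pairing_perm_sign n (s : 'S_(n + n)) : pairing_perm s ->
  (-1) ^+ s * \prod_(m < n) orient (s (lshift n m)) = 1 :> K.
Proof.
move=> /pairing_permP sP.
pose idx (p : 'I_(n + n)) : 'I_n := match fintype.split p with inl m => m | inr m => m end.
have idx_partner p : idx (partner p) = idx p.
  by elim/splitW: p => m; rewrite ?partner_l ?partner_r /idx
    ?(unsplitK (inl m)) ?(unsplitK (inr m)).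
have idx_eq p q : idx p = idx q -> q = p \/ q = partner p.
  elim/splitW: p => m; elim/splitW: q => m'; rewrite ?partner_l ?partner_r /idx
    ?(unsplitK (inl m)) ?(unsplitK (inr m)) ?(unsplitK (inl m')) ?(unsplitK (inr m')) => ->;
      by [left|right].
pose sg m := idx (s (lshift n m)).
have sg_inj : injective sg.
  move=> m m' /idx_eq[/perm_inj/lshift_inj //|].
  rewrite -sP partner_l => /perm_inj/eqP; by rewrite eq_lrshift.
pose t := perm sg_inj.
pose A := \matrix_(m, m') (s (lshift n m) == lshift n m')%:R : 'M[K]_n.
pose B := \matrix_(m, m') (s (lshift n m) == rshift n m')%:R : 'M[K]_n.
have sE : perm_mx s = block_mx A B B A.
  apply/matrixP => p q; rewrite !mxE; elim/splitW: p => m; elim/splitW: q => m'.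
  all: rewrite ?(unsplitK (inl m)) ?(unsplitK (inr m)) ?mxE ?(unsplitK (inl m'))
    ?(unsplitK (inr m')) ?mxE //.
    by rewrite -(partner_l m) sP -(partner_r m') (inj_eq (can_inj (@partnerK n))).
  by rewrite -(partner_l m) sP -(partner_l m') (inj_eq (can_inj (@partnerK n))).
have ADB : A + B = perm_mx t.
  apply/matrixP => m m'; rewrite !mxE permE /sg.
  elim/splitW: (s _) => m1; rewrite /idx ?(unsplitK (inl m1)) ?(unsplitK (inr m1)).
    by rewrite eq_lshift eq_lrshift addr0.
  by rewrite eq_rshift eq_rlshift add0r.
have ABB : A - B = diag_mx (\row_m orient (s (lshift n m))) *m perm_mx t.
  apply/matrixP => m m'; rewrite mul_diag_mx !mxE permE /sg.
  elim/splitW: (s _) => m1; rewrite /idx ?(unsplitK (inl m1)) ?(unsplitK (inr m1)).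
    by rewrite eq_lshift eq_lrshift subr0 orient_l mul1r.
  by rewrite eq_rshift eq_rlshift sub0r orient_r mulN1r.
have : \det (perm_mx s : 'M[K]_(n + n)) = \det (A + B) * \det (A - B).
  have := congr1 determinant (erefl
    (block_mx 1%:M 1%:M 0 1%:M *m block_mx A B B A *m block_mx 1%:M (- 1%:M) 0 1%:M)).
  rewrite {1}det_mulmx det_mulmx !det_ublock !det1 !mul1r mulr1 sE => ->.
  rewrite !mulmx_block !mul1mx !mul0mx !mulmx1 !mulmx0 !addr0 !add0r !mulmxN !mulmx1.
  by rewrite [B + A]addrC addNr det_lblock [- B + A]addrC.
rewrite det_perm ADB ABB det_mulmx det_perm det_diag mulrCA.
rewrite -signr_addb addbb expr0 mulr1 => ->.
rewrite -big_split /= big1 // => m _; rewrite mxE.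
by elim/splitW: (s _) => m1; rewrite ?orient_l ?orient_r ?mulr1 ?mulrNN ?mulr1.
Qed.

Lemma pairing_perm_transitive n (m0 : 'I_n) p :
  exists2 t : 'S_(n + n), pairing_perm t & t (lshift n m0) = p.
Proof.
pose f a (q : 'I_(n + n)) : 'I_(n + n) :=
  match fintype.split q with
  | inl m => lshift n (tperm m0 a m)
  | inr m => rshift n (tperm m0 a m)
  end.
have fl a m : f a (lshift n m) = lshift n (tperm m0 a m) by rewrite /f (unsplitK (inl m)).
have fr a m : f a (rshift n m) = rshift n (tperm m0 a m) by rewrite /f (unsplitK (inr m)).
have f_inj a : injective (f a).
  elim/splitW => m; elim/splitW => m'; rewrite ?fl ?fr.
  - by move=> /lshift_inj/perm_inj->.
  - by move=> /eqP; rewrite eq_lrshift.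
  - by move=> /eqP; rewrite eq_rlshift.
  - by move=> /rshift_inj/perm_inj->.
have f_partner a q : f a (partner q) = partner (f a q).
  by elim/splitW: q => m; rewrite ?fl ?fr ?partner_l ?partner_r ?fl ?fr.
elim/splitW: p => a.
  exists (perm (@f_inj a)); last by rewrite permE fl tpermL.
  by apply/pairing_permP => q; rewrite !permE f_partner.
have g_inj : injective (@partner n \o f a) by apply: inj_comp; [exact: can_inj (@partnerK n)|].
exists (perm g_inj); last by rewrite permE /= fl tpermL partner_l.
by apply/pairing_permP => q; rewrite !permE /= f_partner.
Qed.

(** Only the permutations that preserve pairs contribute, and by
    [pairing_perm_sign] all of them with the same sign once F is oriented.
    They form a group that is transitive on the indices, so by averaging every
    index has the same weight. *)
Lemma mwedge_symplectic n (m0 : 'I_n) : (forall k, (k.+1)%:R != 0 :> K) ->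
  exists2 kappa : K, kappa != 0 & forall F : 'M[K]_(n + n),
    mwedge (fun m => if m == m0 then F else symplectic n) =
    kappa * \sum_m (F (lshift n m) (rshift n m) - F (rshift n m) (lshift n m)).
Proof.
move=> char0.
(* The order of the group of permutations that preserve pairs: in the average
   over the indices, each index is the image of a given one under N / 2n of
   them. *)
pose N := #|@pairing_perm n|.
have N0 : (N%:R : K) != 0.
  have /prednK <- : (0 < N)%N by apply/card_gt0P; exists 1%g; apply/pairing_permP => p;
    rewrite !perm1.
  exact: char0.
have n0 : ((n + n)%:R : K) != 0 by rewrite -(ltn_predK (ltn_ord m0)) addSn.
exists (N%:R / (n + n)%:R) => [|F]; first by rewrite mulf_neq0 ?invr_eq0.
pose G p := orient p * F p (partner p).
have WE : mwedge (fun m => if m == m0 then F else symplectic n) =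
    \sum_(s : 'S_(n + n) | pairing_perm s) G (s (lshift n m0)).
  rewrite /mwedge (bigID (@pairing_perm n)) /= [X in _ + X]big1 ?addr0.
    apply: eq_bigr => s sP; have /pairing_permP sP' := sP.
    rewrite (bigD1 m0) //= eqxx /G.
    have := pairing_perm_sign sP; rewrite (bigD1 m0) //=.
    set e0 := orient (s (lshift n m0)).
    have e02 : e0 * e0 = 1 by rewrite /e0; elim/splitW: (s _) => m1;
      rewrite ?orient_l ?orient_r ?mulr1 ?mulrNN ?mulr1.
    move=> sgE; have <- : s (rshift n m0) = partner (s (lshift n m0)).
      by rewrite -sP' partner_l.
    rewrite (eq_bigr (fun m => orient (s (lshift n m)))) => [|m mm0]; last first.
      by rewrite (negPf mm0) mxE -(partner_l m) sP' eqxx.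
    rewrite mulrCA [RHS]mulrC; congr (_ * _).
    by have := congr1 ( *%R e0) sgE; rewrite /= mulr1 => <-;
      rewrite [RHS]mulrCA (mulrA e0 e0) e02 mul1r.
  move=> s /pairing_permP sNP; apply/eqP; rewrite mulf_eq0 signr_eq0 /=.
  apply/negPn/negP => P0; apply: sNP.
  have {P0}Pl m : m != m0 -> s (rshift n m) = partner (s (lshift n m)).
    move=> mm0; apply/eqP/negPn/negP => ne; move/prodf_neq0: P0 => /(_ m isT).
    by rewrite (negPf mm0) mxE (negPf ne) eqxx.
  have Pl0 : s (rshift n m0) = partner (s (lshift n m0)).
    rewrite -[RHS](permKV s); congr (s _).
    have : s ((s^-1)%g (partner (s (lshift n m0)))) = partner (s (lshift n m0)) by rewrite permKV.
    elim/splitW: ((s^-1)%g _) => m; have [->//|mm0] := eqVneq m m0.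
    - by move=> /eqP; rewrite eq_sym partner_neq.
    - rewrite -[s (lshift n m)](@partnerK n) -Pl // => /(can_inj (@partnerK n))/perm_inj/eqP.
      by rewrite eq_rlshift.
    by rewrite Pl // => /(can_inj (@partnerK n))/perm_inj/lshift_inj => e; rewrite e eqxx in mm0.
  elim/splitW => m; rewrite ?partner_l ?partner_r.
    by have [->//|] := eqVneq m m0; exact: Pl.
  have -> : s (rshift n m) = partner (s (lshift n m)).
    by have [->//|] := eqVneq m m0; exact: Pl.
  by rewrite partnerK.
have shift_inv p : \sum_(s : 'S_(n + n) | pairing_perm s) G (s p) =
    \sum_(s : 'S_(n + n) | pairing_perm s) G (s (lshift n m0)).
  have [t tP <-] := pairing_perm_transitive m0 p.
  rewrite [RHS](reindex_inj (mulgI t)) /=; apply: eq_big => [s|s _]; last by rewrite permM.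
  apply/pairing_permP/pairing_permP => sP q; move/pairing_permP: tP => tP.
    by rewrite !permM tP sP.
  by have := sP ((t^-1)%g q); rewrite !permM tP permKV.
have : (n + n)%:R * mwedge (fun m => if m == m0 then F else symplectic n) =
    N%:R * \sum_p G p.
  rewrite WE -[X in X%:R]card_ord mulr_natl -sumr_const.
  under eq_bigr => p _ do rewrite -(shift_inv p).
  rewrite exchange_big /= mulr_natl -sumr_const.
  by apply: eq_bigr => s _; rewrite [RHS](reindex_inj (@perm_inj _ s)).
rewrite big_split_ord /= -big_split /= => WN.
rewrite mulrAC; apply: (mulfI n0); rewrite WN [RHS]mulrC divfK //.
congr (_ * _); apply: eq_bigr => m _.
by rewrite /G orient_l orient_r partner_l partner_r mul1r mulN1r.
Qed.
End Wedge.

(** * Unitary frames and the contraction by a Kaehler form *)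

Section KahlerFrame.
Variables (R : realType) (n : nat).
Local Notation C := R[i].
Local Notation V := 'rV[C]_n.

Lemma iZiZ (u : V) : 'i%C *: ('i%C *: u) = - u.
Proof. by rewrite scalerA -expr2 sqr_i scaleN1r. Qed.

Lemma complexZ (z : C) (u : V) :
  z *: u = (complex.Re z)%:C *: u + (complex.Im z)%:C *: ('i%C *: u).
Proof. by rewrite scalerA -scalerDl [X in _ + X]mulrC -complexE. Qed.

(** A complex-valued two-form on C^n seen as a real vector space; linearity in
    the second variable follows from antisymmetry. *)
Definition rbilin (F : V -> V -> C) : Prop :=
  (forall (a : R) u u' w, F (a%:C *: u + u') w = a%:C * F u w + F u' w) /\
  (forall u w, F u w = - F w u).

Section Bilin.
Variable F : V -> V -> C.
Hypothesis Fb : rbilin F.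

Lemma rbilinDl u u' w : F (u + u') w = F u w + F u' w.
Proof. by have := Fb.1 1 u u' w; rewrite !rmorph1 scale1r mul1r. Qed.
Lemma rbilin0l w : F 0 w = 0.
Proof. by apply: (addrI (F 0 w)); rewrite -rbilinDl !addr0. Qed.
Lemma rbilinZl (a : R) u w : F (a%:C *: u) w = a%:C * F u w.
Proof. by have := Fb.1 a u 0 w; rewrite !addr0 rbilin0l addr0. Qed.
Lemma rbilinNl u w : F (- u) w = - F u w.
Proof. by apply/eqP; rewrite -addr_eq0 -rbilinDl addNr rbilin0l. Qed.
Lemma rbilinNr u w : F w (- u) = - F w u.
Proof. by rewrite Fb.2 rbilinNl -Fb.2. Qed.
Lemma rbilin_suml I (r : seq I) (c : I -> R) (u : I -> V) w :
  F (\sum_(i <- r) (c i)%:C *: u i) w = \sum_(i <- r) (c i)%:C * F (u i) w.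
Proof.
elim: r => [|i r IH]; first by rewrite !big_nil rbilin0l.
by rewrite !big_cons rbilinDl rbilinZl IH.
Qed.
Lemma rbilin_sumr I (r : seq I) (c : I -> R) (u : I -> V) w :
  F w (\sum_(i <- r) (c i)%:C *: u i) = \sum_(i <- r) (c i)%:C * F w (u i).
Proof.
by rewrite Fb.2 rbilin_suml -sumrN; apply: eq_bigr => i _; rewrite -mulrN -Fb.2.
Qed.
End Bilin.

(** Coordinates in the basis [real_basis], with the same indexing. *)
Definition rcoord (u : V) (p : 'I_(n + n)) : R :=
  match fintype.split p with inl m => complex.Re (u 0 m) | inr m => complex.Im (u 0 m) end.

Lemma rcoord_sum u : u = \sum_p (rcoord u p)%:C *: @real_basis R n p.
Proof.
rewrite big_split_ord /= -big_split /= {1}(row_sum_delta u).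
apply: eq_bigr => m _; rewrite /rcoord /real_basis.
by rewrite (unsplitK (inl m)) (unsplitK (inr m)) -complexZ.
Qed.

Variable om : V -> V -> R.
Hypothesis om_lin : forall (a : R) u u' w, om (a%:C *: u + u') w = a * om u w + om u' w.
Hypothesis om_anti : forall u w, om u w = - om w u.
Hypothesis om_J : forall u w, om ('i%C *: u) ('i%C *: w) = om u w.
Hypothesis om_pos : forall u, u <> 0 -> 0 < om u ('i%C *: u).

Lemma om_rbilin : rbilin (fun u w => (om u w)%:C).
Proof.
split=> [a u u' w|u w]; first by rewrite om_lin rmorphD rmorphM.
by rewrite om_anti rmorphN.
Qed.

Lemma om_Jl u w : om ('i%C *: u) w = - om u ('i%C *: w).
Proof.
have := om_J u ('i%C *: w); rewrite iZiZ => <-; apply: complexI.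
by rewrite rmorphN /= (rbilinNr om_rbilin) opprK.
Qed.

(** The Hermitian form whose real part is the Riemannian metric om (., i .)
    and whose imaginary part is - om. *)
Definition kherm (u w : V) : C := om u ('i%C *: w) -i* om u w.

Lemma khermJ u w : kherm w u = (kherm u w)^*.
Proof.
rewrite /kherm /=; congr (_ +i* _).
  by rewrite om_anti om_Jl opprK.
by rewrite om_anti.
Qed.

Lemma khermD u u' w : kherm (u + u') w = kherm u w + kherm u' w.
Proof.
have D y : om (u + u') y = om u y + om u' y.
  by have := om_lin 1 u u' y; rewrite rmorph1 scale1r mul1r.
by rewrite /kherm !D opprD.
Qed.

Lemma kherm0 w : kherm 0 w = 0.
Proof. by apply: (addrI (kherm 0 w)); rewrite -khermD !addr0. Qed.

Lemma khermZ z u w : kherm (z *: u) w = z * kherm u w.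
Proof.
have Z (a : R) y v : om (a%:C *: v) y = a * om v y.
  by apply: complexI; rewrite (rbilinZl om_rbilin) rmorphM.
have N : om u (- w) = - om u w.
  by apply: complexI; rewrite (rbilinNr om_rbilin) -rmorphN.
case: z => a b; rewrite complexZ khermD /kherm !Z !om_Jl iZiZ N /=.
by apply/eqP; rewrite eq_complex /=; apply/andP; split; apply/eqP; ring.
Qed.

Definition kgram : 'M[C]_n := \matrix_(a, b) kherm (delta_mx 0 a) (delta_mx 0 b).

Lemma khermE u w : kherm u w = (u *m kgram *m w ^t*) 0 0.
Proof.
have L I (r : seq I) (c : I -> C) (b : I -> V) y :
    kherm (\sum_(i <- r) c i *: b i) y = \sum_(i <- r) c i * kherm (b i) y.
  elim: r => [|i r IH]; first by rewrite !big_nil kherm0.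
  by rewrite !big_cons khermD khermZ IH.
rewrite -mulmxA mxE {1}(row_sum_delta u) L; apply: eq_bigr => a _; congr (_ * _).
rewrite mxE khermJ {1}(row_sum_delta w) L rmorph_sum; apply: eq_bigr => b _.
by rewrite rmorphM /= -khermJ !mxE mulrC.
Qed.

Lemma kherm_diag u : kherm u u = (om u ('i%C *: u))%:C.
Proof.
have o0 : om u u = 0 by have := om_anti u u; lra.
by rewrite /kherm o0 oppr0.
Qed.

Definition kframe (e : 'I_n -> V) : Prop :=
  forall a b, kherm (e a) (e b) = (a == b)%:R.

Lemma kframe_exists : exists2 P : 'M[C]_n, P \in unitmx & kframe (fun a => row a P).
Proof.
have [|c c0|P Pu PE] := @posdef_orthonormal _ _ kgram.
- by apply/matrixP => a b; rewrite !mxE -khermJ.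
- by rewrite -khermE kherm_diag ltcR; apply: om_pos; exact/eqP.
exists P => // a b; rewrite khermE.
have -> : (a == b)%:R = (P *m kgram *m P ^t*) a b by rewrite PE mxE.
by rewrite -row_mul !mxE; apply: eq_bigr => c _; rewrite !mxE.
Qed.

(** In the basis (e_a, i e_a) the form om becomes standard, so
    [mwedge_symplectic] evaluates both terms of the quotient. The determinant
    of the change of basis, the factor 2^-n and the constant kappa cancel. *)
Lemma contraction_kframe (F : V -> V -> C) (e : 'I_n -> V) : rbilin F -> kframe e ->
  n%:R * wedge2 (fun m => if val m == 0%N then F else fun u w => (om u w)%:C)
           (@real_basis R n)
    / wedge2 (fun=> fun u w => (om u w)%:C) (@real_basis R n)
  = \sum_a F (e a) ('i%C *: e a).
Proof.
move=> Fb ef; case: (posnP n) => [n0|npos].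
  rewrite [in X in X%:R]n0 mul0r mul0r big1 // => a _.
  by have := ltn_ord a; rewrite [in X in (_ < X)%N]n0.
pose m0 := Ordinal npos.
have valm0 (m : 'I_n) : (val m == 0%N) = (m == m0) by [].
pose mx (G : V -> V -> C) b : 'M[C]_(n + n) :=
  \matrix_(p, q) G (b p : V) (b q).
pose b' p := match fintype.split p with inl a => e a | inr a => 'i%C *: e a end.
pose N : 'M[C]_(n + n) := \matrix_(p, q) (rcoord (b' p) q)%:C.
have wedgeE (al : 'I_n -> V -> V -> C) : wedge2 al (@real_basis R n) =
    (2 ^+ n)^-1 * mwedge (fun m => mx (al m) (@real_basis R n)).
  rewrite /wedge2 /mwedge; congr (_ * _); apply: eq_bigr => s _; congr (_ * _).
  by apply: eq_bigr => m _; rewrite mxE.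
have mxN G : rbilin G -> N *m mx G (@real_basis R n) *m N^T = mx G b'.
  move=> Gb; apply/matrixP => p q; rewrite [RHS]mxE.
  rewrite [b' p]rcoord_sum [b' q]rcoord_sum (rbilin_sumr Gb).
  rewrite mxE; apply: eq_bigr => l _; rewrite mulrC !mxE; congr (_ * _).
  by rewrite (rbilin_suml Gb); apply: eq_bigr => l' _; rewrite !mxE.
have mxJ : mx (fun u w => (om u w)%:C) b' = symplectic C n.
  have oe a b : om (e a) (e b) = 0.
    by have /(congr1 (@complex.Im R)) := ef a b; case: (a == b) => /= /eqP;
      rewrite ?oppr_eq0 => /eqP.
  have oie a b : om (e a) ('i%C *: e b) = (a == b)%:R.
    by have /(congr1 (@complex.Re R)) := ef a b; case: (a == b).
  apply/matrixP => p q; rewrite !mxE /b'.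
  elim/splitW: p => a; elim/splitW: q => b.
  all: rewrite ?partner_l ?partner_r ?orient_l ?orient_r ?(unsplitK (inl a)) ?(unsplitK (inr a))
    ?(unsplitK (inl b)) ?(unsplitK (inr b)).
  - by rewrite oe eq_lrshift.
  - by rewrite oie eq_rshift eq_sym; case: eqP.
  - by rewrite om_Jl oie eq_lshift eq_sym; case: eqP; rewrite ?oppr0 ?rmorphN1.
  - by rewrite om_J oe eq_rlshift.
have char0 k : k.+1%:R != 0 :> C by rewrite pnatr_eq0.
have [kappa kappa0 WE] := mwedge_symplectic m0 char0.
have detN : \det N != 0.
  apply: contra_neq (oner_neq0 C) => d0.
  have := congr1 determinant (mxN _ om_rbilin); rewrite mxJ !det_mulmx d0 !mul0r.
  (* The standard form is nondegenerate, so the change of basis is invertible. *)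
  have SS : symplectic C n *m symplectic C n = - 1%:M.
    apply/matrixP => p q; rewrite !mxE (bigD1 (partner p)) //= big1 => [|l /negPf lp]; last first.
      by rewrite !mxE lp mul0r.
    rewrite !mxE eqxx partnerK orient_partner addr0 eq_sym.
    case: eqP => _; rewrite ?mulr0 ?mulr0n ?oppr0 //.
    rewrite mulr1n; elim/splitW: p => a; by rewrite ?orient_l ?orient_r ?mulrNN ?mulr1 ?mul1r.
  move=> S0; have := congr1 determinant SS; rewrite det_mulmx -S0 mul0r.
  by rewrite -scaleN1r detZ det1 mulr1 => /esym/eqP; rewrite signr_eq0.
have WN al : (forall m, rbilin (al m)) ->
    mwedge (fun m => mx (al m) (@real_basis R n)) = (\det N)^-1 * mwedge (fun m => mx (al m) b').
  move=> alb; apply: (mulfI detN); rewrite mulrA mulfV // mul1r -mwedge_congr.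
  by rewrite /mwedge; under eq_bigr => s _ do under eq_bigr => m _ do rewrite mxN //.
have two0 : (2 ^+ n)^-1 != 0 :> C by rewrite invr_eq0 expf_neq0 // pnatr_eq0.
rewrite !wedgeE !WN; [|by move=> m; exact: om_rbilin|]; last first.
  by move=> m; case: ifP => _ //; exact: om_rbilin.
have -> : mwedge (fun=> mx (fun u w => (om u w)%:C) b') = kappa * (n%:R * 2).
  rewrite mxJ; transitivity (mwedge (fun m => if m == m0 then symplectic C n else symplectic C n)).
    by rewrite /mwedge; under [RHS]eq_bigr => s _ do under eq_bigr => m _ do rewrite if_same.
  rewrite WE -[in X in X%:R](card_ord n) mulr_natl -sumr_const; congr (_ * _).
  apply: eq_bigr => m _.
  rewrite !mxE partner_l partner_r !eqxx orient_l orient_r opprK //.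
have -> : mwedge (fun m => mx (if val m == 0%N then F else fun u w => (om u w)%:C) b') =
    kappa * (2 * \sum_a F (e a) ('i%C *: e a)).
  transitivity (mwedge (fun m => if m == m0 then mx F b' else symplectic C n)).
    rewrite /mwedge; apply: eq_bigr => s _; congr (_ * _); apply: eq_bigr => m _.
    by rewrite valm0; case: eqP => //; rewrite mxJ.
  rewrite WE [2 * _]mulr_sumr; congr (_ * _); apply: eq_bigr => m _.
  rewrite !mxE /b' (unsplitK (inl m)) (unsplitK (inr m)) [F ('i%C *: _) _]Fb.2 opprK.
  by rewrite -mulr2n mulr_natl.
have n0 : n%:R != 0 :> C by rewrite pnatr_eq0 -lt0n.
have t0 : 2 != 0 :> C by rewrite pnatr_eq0.
set S := \sum_a _; set d := \det N in detN *; set t := (2 ^+ n)^-1 in two0 *.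
by field; rewrite n0 kappa0 two0 detN.
Qed.

End KahlerFrame.

(** * One-variable calculus of complex and matrix valued functions *)

Section FunctionAlgebra.
Variables (C : comNzRingType) (T : Type) (P : (T -> C) -> Prop).
Hypothesis P_cst : forall c, P (fun=> c).
Hypothesis P_add : forall f g, P f -> P g -> P (fun s => f s + g s).
Hypothesis P_mul : forall f g, P f -> P g -> P (fun s => f s * g s).

(** The lemmas of this section propagate a regularity property from the
    entries of matrix functions to determinants, adjugates and products; they
    are applied to differentiability at a point and to continuity at a point.
    *)
Lemma fsum_closed I (r : seq I) (Q : pred I) (F : I -> T -> C) :
  (forall i, P (F i)) -> P (fun s => \sum_(i <- r | Q i) F i s).
Proof.
move=> FP; elim: r => [|i r IH].
  by rewrite (_ : (fun s => _) = fun=> 0) //; apply/funext => s; rewrite big_nil.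
rewrite (_ : (fun s => _) = fun s => (if Q i then F i s else 0) + \sum_(j <- r | Q j) F j s).
  by apply: P_add => //; case: (Q i).
by apply/funext => s; rewrite big_cons; case: (Q i); rewrite ?add0r.
Qed.

Lemma fprod_closed I (r : seq I) (Q : pred I) (F : I -> T -> C) :
  (forall i, P (F i)) -> P (fun s => \prod_(i <- r | Q i) F i s).
Proof.
move=> FP; elim: r => [|i r IH].
  by rewrite (_ : (fun s => _) = fun=> 1) //; apply/funext => s; rewrite big_nil.
rewrite (_ : (fun s => _) = fun s => (if Q i then F i s else 1) * \prod_(j <- r | Q j) F j s).
  by apply: P_mul => //; case: (Q i).
by apply/funext => s; rewrite big_cons; case: (Q i); rewrite ?mul1r.
Qed.

Lemma fdet_closed n (G : T -> 'M[C]_n) :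
  (forall a b, P (fun s => G s a b)) -> P (fun s => \det (G s)).
Proof.
by move=> GP; apply: fsum_closed => p; apply: P_mul => //; exact: fprod_closed.
Qed.

Lemma fadj_closed n (G : T -> 'M[C]_n) a b :
  (forall a b, P (fun s => G s a b)) -> P (fun s => \adj (G s) a b).
Proof.
move=> GP; rewrite (_ : (fun s => _) = fun s => cofactor (G s) b a).
  apply: P_mul => //; apply: fdet_closed => c d.
  rewrite (_ : (fun s => _) = fun s => G s (lift b c) (lift a d)) //.
  by apply/funext => s; rewrite !mxE.
by apply/funext => s; rewrite mxE.
Qed.

Lemma fmulmx_closed m n p (G : T -> 'M[C]_(m, n)) (H : T -> 'M[C]_(n, p)) a b :
  (forall a b, P (fun s => G s a b)) -> (forall a b, P (fun s => H s a b)) ->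
  P (fun s => (G s *m H s) a b).
Proof.
move=> GP HP; rewrite (_ : (fun s => _) = fun s => \sum_c G s a c * H s c b).
  by apply: fsum_closed => c; exact: P_mul.
by apply/funext => s; rewrite mxE.
Qed.

End FunctionAlgebra.

(** The inverse as a rational expression in the entries, so that its
    regularity follows from the lemmas on determinants and adjugates. *)
Definition adjinv (F : fieldType) n (A : 'M[F]_n) : 'M[F]_n := (\det A)^-1 *: \adj A.

Lemma adjinvE (F : fieldType) n (A : 'M[F]_n) : A \in unitmx -> adjinv A = invmx A.
Proof. by rewrite /invmx => ->. Qed.

Lemma adjinv_entry (F : fieldType) n (A : 'M[F]_n) a b :
  adjinv A a b = (\det A)^-1 * \adj A a b.
Proof. by rewrite mxE. Qed.

Section Cderiv.
Variable R : realType.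
Local Notation C := R[i].

Definition has_cderiv (g : R -> C) (t : R) (l : C) : Prop :=
  is_derive t 1 (fun s => complex.Re (g s)) (complex.Re l) /\
  is_derive t 1 (fun s => complex.Im (g s)) (complex.Im l).

Lemma has_cderivE g t l : has_cderiv g t l -> cderiv g t = l.
Proof.
case=> gr gi; rewrite /cderiv !derive1E !derive_val.
by case: l {gr gi}.
Qed.

Lemma has_cderiv_near g g' t l :
  (\forall s \near t, g s = g' s) -> has_cderiv g t l -> has_cderiv g' t l.
Proof.
move=> gg' [gr gi]; split.
  by apply: near_eq_is_derive gr; apply: filterS gg' => s ->.
by apply: near_eq_is_derive gi; apply: filterS gg' => s ->.
Qed.

Lemma has_cderiv_ext g g' t l : g =1 g' -> has_cderiv g t l -> has_cderiv g' t l.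
Proof. by move=> /funext->. Qed.

Lemma has_cderiv_cst c t : has_cderiv (fun=> c) t 0.
Proof. by split; exact: is_derive_cst. Qed.

Lemma Re_add (x y : C) : complex.Re (x + y) = complex.Re x + complex.Re y.
Proof. by case: x; case: y. Qed.
Lemma Im_add (x y : C) : complex.Im (x + y) = complex.Im x + complex.Im y.
Proof. by case: x; case: y. Qed.
Lemma Re_sum (I : Type) (r : seq I) (F : I -> C) :
  complex.Re (\sum_(i <- r) F i) = \sum_(i <- r) complex.Re (F i).
Proof.
elim: r => [|i r IH]; first by rewrite !big_nil.
by rewrite !big_cons Re_add IH.
Qed.
Lemma Re_mul (x y : C) : complex.Re (x * y) =
  complex.Re x * complex.Re y - complex.Im x * complex.Im y.
Proof. by case: x; case: y. Qed.
Lemma Im_mul (x y : C) : complex.Im (x * y) =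
  complex.Re x * complex.Im y + complex.Im x * complex.Re y.
Proof. by case: x; case: y. Qed.

Lemma has_cderivD f g t l l' : has_cderiv f t l -> has_cderiv g t l' ->
  has_cderiv (fun s => f s + g s) t (l + l').
Proof.
move=> [fr fi] [gr gi]; split; rewrite ?Re_add ?Im_add.
  rewrite (_ : (fun s => _) = (fun s => complex.Re (f s)) \+ (fun s => complex.Re (g s))).
    exact: is_deriveD.
  by apply/funext => s; rewrite Re_add.
rewrite (_ : (fun s => _) = (fun s => complex.Im (f s)) \+ (fun s => complex.Im (g s))).
  exact: is_deriveD.
by apply/funext => s; rewrite Im_add.
Qed.

Lemma has_cderivM f g t l l' : has_cderiv f t l -> has_cderiv g t l' ->
  has_cderiv (fun s => f s * g s) t (l * g t + f t * l').
Proof.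
move=> [fr fi] [gr gi]; split; rewrite ?Re_add ?Im_add ?Re_mul ?Im_mul.
  have -> : (fun s => complex.Re (f s * g s)) =
      ((fun s => complex.Re (f s)) * (fun s => complex.Re (g s))
       - (fun s => complex.Im (f s)) * (fun s => complex.Im (g s)))%R.
    by apply/funext => s; rewrite Re_mul.
  apply: (is_derive_eq (is_deriveB (is_deriveM fr gr) (is_deriveM fi gi))).
  by rewrite /GRing.scale /=; ring.
have -> : (fun s => complex.Im (f s * g s)) =
    ((fun s => complex.Re (f s)) * (fun s => complex.Im (g s))
     + (fun s => complex.Im (f s)) * (fun s => complex.Re (g s)))%R.
  by apply/funext => s; rewrite Im_mul.
apply: (is_derive_eq (is_deriveD (is_deriveM fr gi) (is_deriveM fi gr))).
by rewrite /GRing.scale /=; ring.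
Qed.

Lemma Re_inv (z : C) : complex.Re z^-1 = complex.Re z * (complex.Re z ^+ 2 + complex.Im z ^+ 2)^-1.
Proof. by case: z. Qed.
Lemma Im_inv (z : C) :
  complex.Im z^-1 = - (complex.Im z * (complex.Re z ^+ 2 + complex.Im z ^+ 2)^-1).
Proof. by case: z. Qed.

Lemma sq_modulus_eq0 (z : C) :
  (complex.Re z ^+ 2 + complex.Im z ^+ 2 == 0) = (z == 0).
Proof. by case: z => a b; rewrite eq_complex /= paddr_eq0 ?sqr_ge0 // !sqrf_eq0. Qed.

Lemma sq_modulus_derivable f t l : has_cderiv f t l ->
  derivable (fun s => complex.Re (f s) ^+ 2 + complex.Im (f s) ^+ 2) t 1.
Proof.
by case=> [[fr _] [fi _]]; exact: derivableD (derivableM fr fr) (derivableM fi fi).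
Qed.

Lemma has_cderivV f t l : has_cderiv f t l -> f t != 0 ->
  exists l', has_cderiv (fun s => (f s)^-1) t l'.
Proof.
move=> fl ft0; have dN := sq_modulus_derivable fl; case: fl => [[fr _] [fi _]].
pose N s := complex.Re (f s) ^+ 2 + complex.Im (f s) ^+ 2.
have dV : derivable (fun s => (N s)^-1) t 1.
  by apply: derivableV dN; rewrite /N sq_modulus_eq0.
have dr : derivable (fun s => complex.Re (f s)^-1) t 1.
  rewrite (_ : (fun s => _) = (fun s => complex.Re (f s)) * (fun s => (N s)^-1)).
    exact: derivableM fr dV.
  by apply/funext => s; exact: Re_inv.
have di : derivable (fun s => complex.Im (f s)^-1) t 1.
  rewrite (_ : (fun s => _) = - ((fun s => complex.Im (f s)) * (fun s => (N s)^-1))).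
    exact: derivableN (derivableM fi dV).
  by apply/funext => s; exact: Im_inv.
exists ('D_1 (fun s => complex.Re (f s)^-1) t +i* 'D_1 (fun s => complex.Im (f s)^-1) t).
by split; [exact: derivableP dr|exact: derivableP di].
Qed.

Lemma has_cderiv_neq0 f t l : has_cderiv f t l -> f t != 0 ->
  \forall s \near t, f s != 0.
Proof.
move=> fl ft0; pose N s := complex.Re (f s) ^+ 2 + complex.Im (f s) ^+ 2.
have cN : {for t, continuous N}.
  by apply/differentiable_continuous/derivable1_diffP; exact: sq_modulus_derivable fl.
have Nt : N t != 0 by rewrite /N sq_modulus_eq0.
have : \forall s \near t, N s != 0 by exact: (cvgr_neq0 (N t) cN Nt).
by apply: filterS => s; rewrite /N sq_modulus_eq0.
Qed.

Lemma has_cderiv_scale c g t l : has_cderiv g t l -> has_cderiv (fun s => c * g s) t (c * l).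
Proof.
by move=> gl; have := has_cderivM (has_cderiv_cst c t) gl; rewrite mul0r add0r.
Qed.

Lemma has_cderivN g t l : has_cderiv g t l -> has_cderiv (fun s => - g s) t (- l).
Proof.
move=> /(has_cderiv_scale (-1)); rewrite mulN1r; apply: has_cderiv_ext.
by move=> s; rewrite mulN1r.
Qed.

Lemma has_cderivB f g t l l' : has_cderiv f t l -> has_cderiv g t l' ->
  has_cderiv (fun s => f s - g s) t (l - l').
Proof. by move=> fl gl; apply: has_cderivD => //; exact: has_cderivN. Qed.

Lemma has_cderiv_sum I (r : seq I) (g : I -> R -> C) t (l : I -> C) :
  (forall i, has_cderiv (g i) t (l i)) ->
  has_cderiv (fun s => \sum_(i <- r) g i s) t (\sum_(i <- r) l i).
Proof.
move=> gl; elim: r => [|i r IH].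
  rewrite big_nil; apply: has_cderiv_ext (has_cderiv_cst 0 t).
  by move=> s; rewrite big_nil.
rewrite big_cons; apply: has_cderiv_ext (has_cderivD (gl i) IH).
by move=> s; rewrite big_cons.
Qed.

Lemma has_cderiv_uniq g t l l' : has_cderiv g t l -> has_cderiv g t l' -> l = l'.
Proof. by move=> /has_cderivE <- /has_cderivE. Qed.

Definition has_mderiv m n (G : R -> 'M[C]_(m, n)) t (L : 'M[C]_(m, n)) : Prop :=
  forall a b, has_cderiv (fun s => G s a b) t (L a b).

Lemma has_mderiv_near m n (G G' : R -> 'M[C]_(m, n)) t L :
  (\forall s \near t, G s = G' s) -> has_mderiv G t L -> has_mderiv G' t L.
Proof.
move=> GG' GL a b; apply: has_cderiv_near (GL a b).
by apply: filterS GG' => s ->.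
Qed.

Lemma has_mderivB m n (G G' : R -> 'M[C]_(m, n)) t L L' :
  has_mderiv G t L -> has_mderiv G' t L' -> has_mderiv (fun s => G s - G' s) t (L - L').
Proof.
move=> GL GL' a b; rewrite !mxE; apply: has_cderiv_ext (has_cderivB (GL a b) (GL' a b)).
by move=> s; rewrite !mxE.
Qed.

Lemma has_mderivM m n p (G : R -> 'M[C]_(m, n)) (H : R -> 'M[C]_(n, p)) t L L' :
  has_mderiv G t L -> has_mderiv H t L' ->
  has_mderiv (fun s => G s *m H s) t (L *m H t + G t *m L').
Proof.
move=> GL HL a b; rewrite !mxE -big_split /=.
apply: has_cderiv_ext (has_cderiv_sum _ (fun c => has_cderivM (GL a c) (HL c b))).
by move=> s; rewrite !mxE.
Qed.

Lemma has_cderiv_tr n (G : R -> 'M[C]_n) t L :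
  has_mderiv G t L -> has_cderiv (fun s => \tr (G s)) t (\tr L).
Proof. by move=> GL; apply: has_cderiv_sum => a. Qed.

(** The entries of the inverse are rational in those of G, so a derivative
    exists; differentiating G G^-1 = 1 gives its value. *)
Lemma has_mderiv_adjinv n (G : R -> 'M[C]_n) t L : G t \in unitmx ->
  has_mderiv G t L ->
  has_mderiv (fun s => adjinv (G s)) t (- (adjinv (G t) *m L *m adjinv (G t))).
Proof.
move=> Gu GL.
pose P (g : R -> C) := exists l, has_cderiv g t l.
have Pc c : P (fun=> c) by exists 0; exact: has_cderiv_cst.
have Pa f g : P f -> P g -> P (fun s => f s + g s).
  by move=> [l fl] [l' gl]; eexists; exact: has_cderivD fl gl.
have Pm f g : P f -> P g -> P (fun s => f s * g s).
  by move=> [l fl] [l' gl]; eexists; exact: has_cderivM fl gl.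
have PG a b : P (fun s => G s a b) by exists (L a b).
have [d dP] := fdet_closed Pc Pa Pm PG.
have d0 : \det (G t) != 0 by rewrite -unitfE -unitmxE.
have [d' dP'] := has_cderivV dP d0.
have /choice [L' LP'] : forall ab : 'I_n * 'I_n, exists l,
    has_cderiv (fun s => adjinv (G s) ab.1 ab.2) t l.
  move=> [a b] /=; have [l lP] := fadj_closed Pc Pa Pm a b PG.
  eexists; apply: has_cderiv_ext (has_cderivM dP' lP).
  by move=> s; rewrite !mxE.
pose Ld : 'M[C]_n := \matrix_(a, b) L' (a, b).
have JL : has_mderiv (fun s => adjinv (G s)) t Ld by move=> a b; rewrite mxE; exact: (LP' (a, b)).
have GJ : has_mderiv (fun s => G s *m adjinv (G s)) t 0.
  apply: (@has_mderiv_near _ _ (fun=> 1%:M)); last by move=> a b;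
    rewrite [X in has_cderiv _ _ X]mxE; exact: has_cderiv_cst.
  apply: filterS (has_cderiv_neq0 dP d0) => s s0.
  by rewrite adjinvE ?mulmxV // unitmxE unitfE.
have E0 : L *m adjinv (G t) + G t *m Ld = 0.
  by apply/matrixP => a b; exact: has_cderiv_uniq (has_mderivM GL JL a b) (GJ a b).
suff -> : - (adjinv (G t) *m L *m adjinv (G t)) = Ld by [].
move/eqP: E0; rewrite addrC addr_eq0 => /eqP/(congr1 (mulmx (adjinv (G t)))).
by rewrite {1}adjinvE // mulKmx // mulmxN mulmxA => ->.
Qed.

End Cderiv.

Opaque adjinv.

Section SecondDerivativeTest.
Variable R : realType.

Lemma near0_ball (P : R -> Prop) : (\forall t \near 0, P t) ->
  exists2 e : R, 0 < e & forall t, `|t| < e -> P t.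
Proof.
move=> /nbhs_ballP[e /= e0 eP]; exists e => // t te; apply: eP.
by rewrite /ball /= sub0r normrN.
Qed.

Lemma mvt_closed (G G' : R -> R) (a b : R) : a < b ->
  (forall t, a <= t <= b -> is_derive t 1 G (G' t)) ->
  exists2 c, a < c < b & G b - G a = G' c * (b - a).
Proof.
move=> ab GG'.
have [] := @MVT R G G' a b ab.
- by move=> t; rewrite in_itv /= => /andP[at_ tb]; apply: GG'; rewrite !ltW.
- apply: derivable_within_continuous => t; rewrite in_itv /= => tab.
  by have := GG' t tab => ?; exact: ex_derive.
by move=> c; rewrite in_itv /= => cab ->; exists c.
Qed.

(** If s were positive, G' would be positive just to the right of 0, and by
    the mean value theorem G would exceed G 0 there. *)
Lemma deriv_at_local_max (G : R -> R) (G' : R -> R) (s : R) :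
  (\forall t \near (0 : R), is_derive (t : R) 1 G (G' t)) -> is_derive (0 : R) 1 G' s ->
  (\forall t \near (0 : R), G t <= G 0) -> G' 0 = 0 /\ s <= 0.
Proof.
move=> /near0_ball[e1 e10 GG'] G's /near0_ball[e2 e20 Gmax].
pose e := Num.min e1 e2; have e0 : 0 < e by rewrite lt_min e10.
have e_1 : e <= e1 by rewrite ge_min lexx.
have e_2 : e <= e2 by rewrite ge_min lexx orbT.
have G'0 : G' 0 = 0.
  have d0 : is_derive (0 : R) 1 G 0.
    apply: (@derive1_at_max _ _ (- e) e); first by lra.
    - move=> t; rewrite in_itv /= => tab.
      have ? : is_derive t 1 G (G' t) by apply: GG'; rewrite ltr_norml; lra.
      exact: ex_derive.
    - by rewrite in_itv /=; lra.
    - by move=> t; rewrite in_itv /= => tab; apply: Gmax; rewrite ltr_norml; lra.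
  have d0' : is_derive (0 : R) 1 G (G' 0) by apply: GG'; rewrite normr0.
  by rewrite -(@derive_val _ _ _ _ _ _ _ d0') (@derive_val _ _ _ _ _ _ _ d0).
split=> //; rewrite leNgt; apply/negP => s0.
have : \forall h \near (0 : R)^', 0 < h^-1 *: ((G' \o shift 0) (h *: 1) - G' 0).
  have [] := G's => dG' sE; apply: (cvgr_gt s) => //.
  by rewrite -sE; exact: dG'.
move=> /nbhs_ballP[d /= d0 dP].
pose m := Num.min e d; have m0 : 0 < m by rewrite lt_min e0.
have m_1 : m <= e by rewrite ge_min lexx.
have m_2 : m <= d by rewrite ge_min lexx orbT.
have [|t tm|c cm GE] := @mvt_closed G G' 0 (m / 2); first by lra.
  by apply: GG'; rewrite ger0_norm; lra.
have := dP c; rewrite /ball /= sub0r normrN ger0_norm; last by lra.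
move=> /(_ _ _)/=; rewrite G'0 subr0 addr0 /GRing.scale /= mulr1.
have -> : c < d by lra.
have cn : c != 0 by rewrite gt_eqF; lra.
move=> /(_ isT cn).
rewrite pmulr_rgt0 ?invr_gt0; last by lra.
move=> G'c.
have := Gmax (m / 2); rewrite ger0_norm; last by lra.
have -> : m / 2 < e2 by lra.
move=> /(_ isT); rewrite -subr_le0 GE subr0 leNgt mulr_gt0 //; lra.
Qed.

End SecondDerivativeTest.

(** * Directional derivatives in charts *)

Section NumFieldContinuity.
Variables (K : numFieldType) (T : topologicalType).
Implicit Types (f g : T -> K^o) (x : T).

Lemma ncontinuousD f g x : {for x, continuous f} -> {for x, continuous g} ->
  {for x, continuous (fun y => f y + g y : K^o)}.
Proof. exact: cvgD. Qed.

Lemma ncontinuousM f g x : {for x, continuous f} -> {for x, continuous g} ->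
  {for x, continuous (fun y => f y * g y : K^o)}.
Proof. exact: cvgM. Qed.

Lemma ncontinuousV f x : f x != 0 -> {for x, continuous f} ->
  {for x, continuous (fun y => (f y)^-1 : K^o)}.
Proof. by move=> f0 fc; apply: cvgV. Qed.
End NumFieldContinuity.

Section Topology.
Variable R : realType.
Local Notation C := R[i].

Lemma cvg_mx (U : topologicalType) m n (S : Type) (F : set_system S) {FF : Filter F}
    (f : S -> 'M[U]_(m, n)) (L : 'M[U]_(m, n)) :
  (forall a b, (fun s => f s a b) @ F --> L a b) -> f @ F --> L.
Proof.
move=> fL A [P PL PA]; rewrite /nbhs /=.
have : F [set s | forall ab : 'I_m * 'I_n, P ab.1 ab.2 (f s ab.1 ab.2)].
  apply: (@filter_forall _ _ (fun (ab : 'I_m * 'I_n) s => P ab.1 ab.2 (f s ab.1 ab.2)) F).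
  by move=> [a b] /=; exact: (fL a b _ (PL a b)).
by apply: filterS => s sP; apply: PA => a b; exact: (sP (a, b)).
Qed.

Lemma continuous_mx (U T : topologicalType) m n (f : T -> 'M[U]_(m, n)) (x : T) :
  (forall a b, {for x, continuous (fun y => f y a b)}) -> {for x, continuous f}.
Proof. by move=> fc; apply: cvg_mx => a b; exact: fc. Qed.

Lemma Re_normc (z : C) : `|complex.Re z|%:C <= `|z|.
Proof. exact: normc_ge_Re. Qed.
Lemma Im_normc (z : C) : `|complex.Im z|%:C <= `|z|.
Proof.
rewrite normc_def lecR -sqrtr_sqr ler_wsqrtr // lerDr sqr_ge0 //.
Qed.
Lemma normc_ReIm (z : C) : `|z| <= (`|complex.Re z| + `|complex.Im z|)%:C.
Proof.
rewrite {1}(complexE z) rmorphD (le_trans (ler_normD _ _)) // normrM.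
by rewrite !normc_def /= !(expr0n, addr0, add0r) /= expr1n sqrtr1 mul1r !sqrtr_sqr.
Qed.

Lemma cvgr_distC_lt_ (z : C) (f : C^o -> R) :
  (forall e, 0 < e -> nbhs (z : C^o) [set w | `|f z - f w| < e]) ->
  f @ (z : C^o) --> f z.
Proof. by move=> H; apply/(@cvgrPdist_lt R R^o C^o (nbhs (z : C^o)) _). Qed.

Lemma Re_continuous : continuous (@complex.Re R : C^o -> R).
Proof.
move=> z; apply: cvgr_distC_lt_ => e e0.
have e0' : 0 < e%:C by rewrite ltcR.
have := nbhsx_ballx (z : C^o) _ e0'.
apply: filterS => w; rewrite /ball /=; rewrite -ltcR; apply: le_lt_trans.
by rewrite (le_trans _ (Re_normc _)) //; case: z; case: w.
Qed.

Lemma Im_continuous : continuous (@complex.Im R : C^o -> R).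
Proof.
move=> z; apply: cvgr_distC_lt_ => e e0.
have e0' : 0 < e%:C by rewrite ltcR.
have := nbhsx_ballx (z : C^o) _ e0'.
apply: filterS => w; rewrite /ball /=; rewrite -ltcR; apply: le_lt_trans.
by rewrite (le_trans _ (Im_normc _)) //; case: z; case: w.
Qed.

Lemma cvg_complex (S : Type) (F : set_system S) {FF : Filter F} (f : S -> C) (l : C) :
  (fun s => complex.Re (f s)) @ F --> complex.Re l ->
  (fun s => complex.Im (f s)) @ F --> complex.Im l ->
  (f : S -> C^o) @ F --> (l : C^o).
Proof.
move=> fr fi; apply/cvgrPdist_lt => e; rewrite ltcE => /andP[/eqP/= ei er].
have e2 : 0 < complex.Re e / 2 by rewrite divr_gt0.
move/cvgrPdist_lt: (fr) => /(_ _ e2); move/cvgrPdist_lt: (fi) => /(_ _ e2).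
apply: filterS2 => s si sr.
apply: (le_lt_trans (normc_ReIm _)).
have -> : e = (complex.Re e)%:C by case: e ei {er e2 si sr} => ? ? /= ->.
rewrite ltcR [ltRHS]splitr ltrD //.
  by apply: le_lt_trans sr; case: l {fr fi si}; case: (f s).
by apply: le_lt_trans si; case: l {fr fi sr}; case: (f s).
Qed.

End Topology.

Section DirectionalDerivative.
Variables (R : realType) (V : normedModType R).
Implicit Types (g : V -> R) (p v w : V).

Lemma is_derive_line g p v (s d : R) :
  is_derive (p + s *: v) v g d <-> is_derive s 1 (fun t : R => g (p + t *: v)) d.
Proof.
have E : (fun h : R => h^-1 *: ((g \o shift (p + s *: v)) (h *: v) - g (p + s *: v))) =
  (fun h : R => h^-1 *: (((fun t : R => g (p + t *: v)) \o shift s) (h *: 1)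
     - (fun t : R => g (p + t *: v)) s)).
  apply/funext => h /=; congr (_ *: (g _ - _)).
  by rewrite addrCA -scalerDl [h *: 1]mulr1.
by split=> -[dg <-]; split; move: dg; rewrite /derivable /derive E.
Qed.

Lemma is_derive_line0 g p v (d : R) :
  is_derive p v g d <-> is_derive (0 : R) 1 (fun t : R => g (p + t *: v)) d.
Proof. by rewrite -is_derive_line scale0r addr0. Qed.

Lemma is_derive_scale_dir g p v (a d : R) :
  is_derive p v g d -> is_derive p (a *: v) g (a * d).
Proof.
move=> /is_derive_line0 gd; apply/is_derive_line0.
rewrite (_ : (fun t => _) = (fun t : R => g (p + t *: v)) \o (fun t => a * t)).
  have ? : is_derive (0 : R) 1 (fun t : R => a * t) a.
    have := is_deriveZ a (is_derive_id (0 : R) 1); rewrite /GRing.scale /= mulr1; exact.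
  have ? : is_derive (a * 0) 1 (fun t : R => g (p + t *: v)) d by rewrite mulr0.
  by rewrite mulrC; exact: is_derive1_comp.
by apply/funext => t /=; rewrite scalerA mulrC.
Qed.

Lemma derive_dist g p v (e : R) : derivable g p v -> 0 < e ->
  exists2 d : R, 0 < d & forall h : R, 0 < h < d ->
    `|'D_v g p - h^-1 * (g (p + h *: v) - g p)| < e.
Proof.
move=> dg e0; have /(_ _ _ e0) := (cvgrPdist_lt _ _).1 (dg : _ --> 'D_v g p).
move=> /nbhs_ballP[d /= d0 dP]; exists d => // h /andP[h0 hd].
have := dP h; rewrite /ball /= sub0r normrN gtr0_norm // => /(_ hd).
have hn0 : h != 0 by rewrite gt_eqF.
by move=> /(_ hn0); rewrite /= [h *: v + p]addrC.
Qed.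

(** Go from p to p + h v and then to p + h v + h w. By the mean value theorem
    the slope of the second step is the derivative along w at an intermediate
    point, which tends to the derivative at p by continuity. *)
Lemma derive_dirD g p v w :
  derivable g p v -> derivable g p (v + w) ->
  (\forall q \near p, derivable g q w) ->
  {for p, continuous (fun q => 'D_w g q)} ->
  'D_(v + w) g p = 'D_v g p + 'D_w g p.
Proof.
move=> dv dvw dw cw.
suff le_e : forall e, 0 < e -> `|'D_(v + w) g p - ('D_v g p + 'D_w g p)| < 3 * e.
  apply/eqP; rewrite -subr_eq0 -normr_le0 leNgt; apply/negP => n0.
  set N := `|_| in n0 *; have := le_e (N / 3); rewrite -/N => /(_ _); lra.
move=> e e0.
have [d1 d10 d1P] := derive_dist dv e0.
have [d2 d20 d2P] := derive_dist dvw e0.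
have cw' : \forall q \near p, `|'D_w g p - 'D_w g q| < e by exact: (cvgrPdist_lt _ _).1.
have /nbhs_ballP[d3 /= d30 d3P] : \forall q \near p, derivable g q w /\ `|'D_w g p - 'D_w g q| < e.
  by apply: filterS2 dw cw'.
pose B := 1 + `|v| + `|w|.
have B0 : 0 < B by rewrite /B -addrA ltr_wpDr // addr_ge0.
pose h := Num.min (Num.min d1 d2) (d3 / B) / 2.
have m0 : 0 < Num.min (Num.min d1 d2) (d3 / B) by rewrite !lt_min d10 d20 divr_gt0.
have mle : [/\ Num.min (Num.min d1 d2) (d3 / B) <= d1, Num.min (Num.min d1 d2) (d3 / B) <= d2
   & Num.min (Num.min d1 d2) (d3 / B) <= d3 / B] by split; rewrite !ge_min lexx ?orbT.
have h0 : 0 < h by rewrite /h; lra.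
have hd1 : 0 < h < d1 by case: mle => *; rewrite /h; lra.
have hd2 : 0 < h < d2 by case: mle => *; rewrite /h; lra.
have hd3 : h < d3 / B by case: mle => *; rewrite /h; lra.
clearbody h.
have near_p s : 0 <= s <= h -> ball p d3 (p + h *: v + s *: w).
  move=> /andP[s0 sh]; rewrite -ball_normE /ball_ /= -addrA opprD addNKr normrN.
  rewrite (le_lt_trans (ler_normD _ _)) // !normrZ (ger0_norm s0)  (gtr0_norm h0).
  apply: (@le_lt_trans _ _ (h * B)).
    by rewrite /B !mulrDr mulr1; have := ler_wpM2r (normr_ge0 w) sh; lra.
  by rewrite -ltr_pdivlMr.
have [||c cP gE] := @mvt_closed R (fun s => g (p + h *: v + s *: w))
    (fun s => 'D_w g (p + h *: v + s *: w)) 0 h.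
- exact: h0.
- move=> s sh; apply/is_derive_line; apply: derivableP.
  exact: (d3P _ (near_p s sh)).1.
have ch : 0 <= c <= h by case/andP: cP => /ltW-> /ltW->.
have := (d3P _ (near_p c ch)).2; set Dc := 'D_w g _ in gE *.
have := d1P h hd1; have := d2P h hd2.
move: gE; rewrite subr0 scale0r addr0 => gE.
have -> : p + h *: (v + w) = p + h *: v + h *: w by rewrite scalerDr addrA.
have -> : h^-1 * (g (p + h *: v + h *: w) - g p) = Dc + h^-1 * (g (p + h *: v) - g p).
  by rewrite -(subrK (g (p + h *: v)) (g (p + h *: v + h *: w))) gE; field; rewrite gt_eqF.
rewrite !ltr_norml; lra.
Qed.

End DirectionalDerivative.

Section RealCoordinates.
Variables (R : realType) (n : nat).
Local Notation C := R[i].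
Local Notation RV := ('rV[R]_n * 'rV[R]_n)%type.

Definition to_real (z : 'rV[C]_n) : RV :=
  (map_mx (@complex.Re R) z, map_mx (@complex.Im R) z).

Lemma of_realK (p : RV) : to_real (of_real p) = p.
Proof. by case: p => p q; congr pair; apply/rowP => a; rewrite !mxE. Qed.

Lemma to_realK (z : 'rV[C]_n) : of_real (to_real z) = z.
Proof. by apply/rowP => a; rewrite !mxE /=; case: (z 0 a). Qed.

Lemma of_real_line (p w : RV) (t : R) :
  of_real (p + t *: w) = of_real p + t%:C *: of_real w.
Proof.
by apply/rowP => a; rewrite !mxE; apply/eqP; rewrite eq_complex /=; apply/andP; split;
  apply/eqP; ring.
Qed.

Lemma to_real_line (z u : 'rV[C]_n) (t : R) :
  to_real (z + t%:C *: u) = to_real z + t *: to_real u.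
Proof. by rewrite -[RHS]of_realK of_real_line !to_realK. Qed.

Lemma of_real_continuous : continuous (@of_real R n : RV -> 'rV[C^o]_n).
Proof.
move=> p; apply: cvg_mx => a b; apply: cvg_complex; rewrite mxE.
  rewrite (_ : (fun s => _) = (fun M : 'rV[R]_n => M 0 b) \o fst) /=.
    apply: continuous_comp; [exact: cvg_fst|exact: coord_continuous].
  by apply/funext => q; rewrite mxE.
rewrite (_ : (fun s => _) = (fun M : 'rV[R]_n => M 0 b) \o snd) /=.
  apply: continuous_comp; [exact: cvg_snd|exact: coord_continuous].
by apply/funext => q; rewrite mxE.
Qed.

Lemma to_real_continuous : continuous (to_real : 'rV[C^o]_n -> RV).
Proof.
move=> z.
have mxc (g : C -> R) : continuous (g : C^o -> R) ->
    (fun w : 'rV[C^o]_n => map_mx g w) @ z --> map_mx g z.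
  move=> gc; apply: (@continuous_mx R 'rV[C^o]_n 1 n (fun w => map_mx g w) z) => a b.
  rewrite (_ : (fun s => _) = (g : C^o -> R) \o (fun M : 'rV[C^o]_n => M a b)) /=.
    by apply: continuous_comp; [exact: coord_continuous|exact: gc].
  by apply/funext => q; rewrite mxE.
exact: (cvg_pair (mxc _ (@Re_continuous R)) (mxc _ (@Im_continuous R))).
Qed.

Lemma line_continuous (z u : 'rV[C]_n) : continuous (fun t : R => z + t%:C *: u : 'rV[C^o]_n).
Proof.
rewrite (_ : (fun t => _) = (@of_real R n : RV -> 'rV[C^o]_n) \o
    (fun t : R => to_real z + t *: to_real u)); last first.
  by apply/funext => t; rewrite /= of_real_line !to_realK.
move=> t; apply: continuous_comp; last exact: of_real_continuous.
by apply: cvgD; [exact: cvg_cst|apply: cvgZr_tmp; exact: cvg_id].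
Qed.

End RealCoordinates.

Section ChartCalculus.
Variables (R : realType) (X : topologicalType) (n : nat).
Variables (M : complex_atlas R X n) (i : cidx M).
Local Notation C := R[i].

Definition chart_line (x : X) (u : 'rV[C]_n) (t : R) : X :=
  param i (chart i x + t%:C *: u).

Definition has_dX (f : X -> C) (x : X) (u : 'rV[C]_n) (l : C) : Prop :=
  has_cderiv (fun t => f (chart_line x u t)) 0 l.

Lemma has_dXE f x u l : has_dX f x u l -> dX i f x u = l.
Proof. exact: has_cderivE. Qed.

Lemma chart_line0 x u : cdom i x -> chart_line x u 0 = x.
Proof. by move=> ix; rewrite /chart_line scale0r addr0 chartK. Qed.

Lemma chart_image_paramK z : (chart i @` cdom i) z ->
  cdom i (param i z) /\ chart i (param i z) = z.
Proof. by move=> [x ix <-]; rewrite chartK. Qed.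

Lemma near_chart_image x : cdom i x ->
  \forall z \near chart i x, (chart i @` cdom i) z.
Proof.
move=> ix; have : open_nbhs (chart i x) (chart i @` cdom i).
  by split; [exact: chart_open|exists x].
by move=> /open_nbhs_nbhs.
Qed.

Lemma near_param x (W : set X) : cdom i x -> nbhs x W ->
  \forall z \near chart i x, (chart i @` cdom i) z /\ W (param i z).
Proof.
move=> ix Wx; apply: filterI; first exact: near_chart_image.
by have := @param_continuous _ _ _ M i x ix W; rewrite chartK //; apply.
Qed.

Lemma near_chart_line x u (W : set X) : cdom i x -> nbhs x W ->
  \forall t \near (0 : R), W (chart_line x u t) /\
    chart i (chart_line x u t) = chart i x + t%:C *: u.
Proof.
move=> ix Wx.
have := @line_continuous R n (chart i x) u 0; rewrite /continuous_at scale0r addr0.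
move=> /(_ _ (near_param ix Wx)) H.
have : \forall t \near (0 : R), (chart i @` cdom i) (chart i x + t%:C *: u) /\
  W (chart_line x u t) by exact: H.
apply: filterS => t /= [zi Wz].
by split => //; have [] := chart_image_paramK zi.
Qed.

Lemma near_cdom x : cdom i x -> nbhs x (cdom i).
Proof.
move=> ix; have : open_nbhs x (cdom i) by split=> //; exact: cdom_open.
exact: open_nbhs_nbhs.
Qed.

(** All the regularity of h, of the Chern connection, of om and of mu that the
    proof uses: continuity, and directional derivatives in the chart that are
    continuous in the point and real linear in the direction. *)
Definition C1at (f : X -> C) (x : X) : Prop :=
  [/\ {for x, continuous (f : X -> C^o)},
      forall u, has_dX f x u (dX i f x u),
      forall u, {for x, continuous (fun y => dX i f y u : C^o)}
    & forall (a : R) u u', dX i f x (a%:C *: u + u') = a%:C * dX i f x u + dX i f x u'].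

Lemma smooth_C1 (W : set X) f x : open W -> smooth_on M W f -> cdom i x -> W x -> C1at f x.
Proof.
move=> oW fW ix Wx.
pose D : set ('rV[R]_n * 'rV[R]_n) := [set p | (chart i @` (cdom i `&` W)) (of_real p)].
pose g1 p := complex.Re (f (param i (of_real p))).
pose g2 p := complex.Im (f (param i (of_real p))).
have [/(_ 1%N)[/= g1c g1d] /(_ 1%N)[/= g2c g2d]] := fW i.
rewrite -/D in g1c g1d g2c g2d.
pose pt y := to_real (chart i y).
have Dpt y : cdom i y -> W y -> D (pt y).
  by move=> iy Wy; rewrite /D /= to_realK; exists y.
have nearD : \forall p \near pt x, D p.
  have : nbhs (of_real (pt x) : 'rV[C^o]_n) [set z | (chart i @` cdom i) z /\ W (param i z)].
    by rewrite to_realK; apply: near_param => //; exact: open_nbhs_nbhs.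
  move=> /of_real_continuous; apply: filterS => p [/= [y iy yp]].
  by rewrite -yp chartK // => Wy; exists y.
have hasD y u : cdom i y -> W y -> has_dX f y u
    ('D_(to_real u) g1 (pt y) +i* 'D_(to_real u) g2 (pt y)).
  move=> iy Wy; split=> /=.
    rewrite (_ : (fun s => _) = fun t : R => g1 (pt y + t *: to_real u)).
      by apply: (is_derive_line0 _ _ _ _).1; apply: derivableP;
        exact: ((g1d (to_real u)).1 _ (Dpt _ iy Wy)).
    by apply/funext => t; rewrite /g1 -to_real_line to_realK.
  rewrite (_ : (fun s => _) = fun t : R => g2 (pt y + t *: to_real u)).
    by apply: (is_derive_line0 _ _ _ _).1; apply: derivableP;
      exact: ((g2d (to_real u)).1 _ (Dpt _ iy Wy)).
  by apply/funext => t; rewrite /g2 -to_real_line to_realK.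
have dXE y u : cdom i y -> W y -> dX i f y u =
    'D_(to_real u) g1 (pt y) +i* 'D_(to_real u) g2 (pt y).
  by move=> iy Wy; apply: has_dXE; exact: hasD.
have nearW : \forall y \near x, cdom i y /\ W y.
  by apply: filterI; [exact: near_cdom|exact: open_nbhs_nbhs].
have ptc : {for x, continuous pt}.
  by apply: continuous_comp; [exact: chart_continuous|exact: to_real_continuous].
have cont_near (h : X -> C) (k1 k2 : 'rV[R]_n * 'rV[R]_n -> R) :
    (forall y, cdom i y -> W y -> h y = k1 (pt y) +i* k2 (pt y)) ->
    {for pt x, continuous k1} -> {for pt x, continuous k2} -> {for x, continuous (h : X -> C^o)}.
  move=> hE k1c k2c; rewrite /prop_for /continuous_at hE //.
  apply: (@cvg_trans _ ((fun y => k1 (pt y) +i* k2 (pt y) : C^o) @ x)).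
    by apply: near_eq_cvg; apply: filterS nearW => y [iy Wy]; rewrite hE.
  by apply: cvg_complex => /=; apply: continuous_comp.
have Dx := Dpt x ix Wx.
split.
- apply: (cont_near f g1 g2); [|exact: g1c|exact: g2c].
  by move=> y iy Wy; rewrite /g1 /g2 /pt to_realK chartK //; case: (f y).
- by move=> u; rewrite dXE //; exact: hasD.
- move=> u; apply: (cont_near (fun y => dX i f y u)
    (fun p => 'D_(to_real u) g1 p) (fun p => 'D_(to_real u) g2 p)).
  + by move=> y iy Wy; rewrite dXE.
  + exact: (g1d (to_real u)).2.1.
  + exact: (g2d (to_real u)).2.1.
move=> a u u'; rewrite !dXE //.
have -> : to_real (a%:C *: u + u') = a *: to_real u + to_real u'.
  by rewrite addrC to_real_line addrC.
have lin g : (forall w, (forall z, D z -> derivable g z w) /\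
      (forall z, D z -> {for z, continuous (fun z => 'D_w g z)}) /\ True) ->
    'D_(a *: to_real u + to_real u') g (pt x) =
     a * 'D_(to_real u) g (pt x) + 'D_(to_real u') g (pt x).
  move=> gd; rewrite derive_dirD; first last.
  - exact: (gd _).2.1.
  - by apply: filterS nearD => q; exact: (gd _).1.
  - exact: (gd _).1.
  - exact: (gd _).1.
  congr (_ + _).
  have gP := derivableP ((gd (to_real u)).1 _ Dx).
  exact: (@derive_val _ _ _ _ _ _ _ (is_derive_scale_dir a gP)).
rewrite (lin g1 g1d) (lin g2 g2d).
move: ('D_(to_real u) g1 (pt x)) ('D_(to_real u') g1 (pt x)) => p p'.
move: ('D_(to_real u) g2 (pt x)) ('D_(to_real u') g2 (pt x)) => q q'.
by apply/eqP; rewrite eq_complex /=; apply/andP; split; apply/eqP; ring.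
Qed.

End ChartCalculus.

(** * Comparison of two Hermitian metrics *)

Section Gram.
Variables (R : realType) (X : topologicalType) (n r : nat).
Variables (M : complex_atlas R X n) (E : hol_bundle M r).
Local Notation C := R[i].

Definition gram (h : tot E -> tot E -> C) (j : fidx E) (x : X) : 'M[C]_r :=
  \matrix_(a, b) h (frame j x (delta_mx 0 a)) (frame j x (delta_mx 0 b)).

Lemma smooth_cst (V : normedModType R) (D : set V) (c : R) : smooth D (fun=> c).
Proof.
move=> k; elim: k c => [|k IH] c /=.
  by split => // z _; exact: cst_continuous.
split; first by move=> z _; exact: cst_continuous.
move=> w; split; first by move=> z _; exact: derivable_cst.
have -> : (fun z => 'D_w (fun=> c) z) = (fun=> 0 : R) :> (V -> R).
  by apply/funext => z; exact: derive_cst.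
exact: IH.
Qed.

Lemma smooth_row_cst (W : set X) (c : 'rV[C]_r) : smooth_row_on M W (fun=> c).
Proof. by move=> a i; split; exact: smooth_cst. Qed.

Lemma dX_cst (i : cidx M) (c : C) x u : dX i (fun=> c) x u = 0.
Proof. by apply: has_dXE; exact: has_cderiv_cst. Qed.

Lemma dXrow_cst (i : cidx M) (c : 'rV[C]_r) x u : dXrow i (fun=> c) x u = 0.
Proof. by apply/rowP => a; rewrite !mxE dX_cst. Qed.

Lemma cov_cst A (i : cidx M) (j : fidx E) c u x : cov A i j u (fun=> c) x = c *m A i j u x.
Proof. by rewrite /cov dXrow_cst add0r. Qed.

Section Metric.
Variable h : tot E -> tot E -> C.
Hypothesis hh : hermitian_metric h.

Lemma metric_gram j x (c d : 'rV[C]_r) : fdom j x ->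
  h (frame j x c) (frame j x d) = (c *m gram h j x *m d ^t*) 0 0.
Proof.
case: hh => hlin hconj _ _ jx.
have L I (s : seq I) (k : I -> C) (b : I -> 'rV[C]_r) d' :
    h (frame j x (\sum_(i <- s) k i *: b i)) (frame j x d') =
    \sum_(i <- s) k i * h (frame j x (b i)) (frame j x d').
  have h0 : h (frame j x 0) (frame j x d') = 0.
    by have := hlin j x d' jx (-1) 0 0; rewrite scaler0 addr0 scaleN1r addNr.
  elim: s => [|i s IH]; first by rewrite !big_nil.
  by rewrite !big_cons hlin // IH.
rewrite -mulmxA mxE {1}(row_sum_delta c) L; apply: eq_bigr => a _; congr (_ * _).
rewrite mxE hconj ?bproj_frame // {1}(row_sum_delta d) L rmorph_sum.
apply: eq_bigr => b _; rewrite rmorphM /= -hconj ?bproj_frame // !mxE mulrC; congr (_ * _).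
Qed.

Lemma gram_herm j x : fdom j x -> (gram h j x) ^t* = gram h j x.
Proof.
case: hh => _ hconj _ _ jx; apply/matrixP => a b; rewrite !mxE.
by rewrite -hconj // !bproj_frame.
Qed.

Lemma gram_pos j x (c : 'rV[C]_r) : fdom j x -> c != 0 -> 0 < (c *m gram h j x *m c ^t*) 0 0.
Proof.
by case: hh => _ _ hpos _ jx /eqP c0; rewrite -metric_gram //; exact: hpos.
Qed.

Lemma gram_orthonormal j x : fdom j x ->
  exists2 P : 'M[C]_r, P \in unitmx & P *m gram h j x *m P ^t* = 1%:M.
Proof.
by move=> jx; apply: posdef_orthonormal; [exact: gram_herm|move=> c; exact: gram_pos].
Qed.

Lemma gram_unit j x : fdom j x -> gram h j x \in unitmx.
Proof.
move=> /gram_orthonormal[P Pu PE].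
have : P *m gram h j x *m P ^t* \in unitmx by rewrite PE unitmx1.
by rewrite !unitmx_mul => /andP[/andP[_ ->] _].
Qed.

Lemma gram_C1 (i : cidx M) j x a b : cdom i x -> fdom j x ->
  C1at i (fun y => gram h j y a b) x.
Proof.
move=> ix jx; apply: (@smooth_C1 _ _ _ _ _ (fdom j)) => //; first exact: fdom_open.
rewrite (_ : (fun y => _) = fun y => h (frame j y (delta_mx 0 a)) (frame j y (delta_mx 0 b))).
  by case: hh.
by apply/funext => y; rewrite mxE.
Qed.

Section Chern.
Variable A : conn_form E.
Hypothesis hA : chern_connection h A.

Lemma chern_C1 (i : cidx M) j x u a b : cdom i x -> fdom j x ->
  C1at i (fun y => A i j u y a b) x.
Proof.
move=> ix jx; apply: (@smooth_C1 _ _ _ _ _ (cdom i `&` fdom j)) => //.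
  by apply: openI; [exact: cdom_open|exact: fdom_open].
by case: hA => [[_ As _] _ _]; exact: As.
Qed.

Lemma chern_lin (i : cidx M) j x (a : R) u u' : cdom i x -> fdom j x ->
  A i j (a%:C *: u + u') x = a%:C *: A i j u x + A i j u' x.
Proof. by case: hA => [[Al _ _] _ _]; exact: Al. Qed.

(** On a constant section the (0,1)-condition says that the connection form
    has type (1,0). *)
Lemma chern_J (i : cidx M) j x u : cdom i x -> fdom j x ->
  A i j ('i%C *: u) x = 'i%C *: A i j u x.
Proof.
move=> ix jx; apply/row_matrixP => a.
case: hA => _ CR _.
have := CR i j x u setT (fun=> delta_mx 0 a) ix jx openT I (smooth_row_cst _ _).
rewrite !cov_cst !dXrow_cst scaler0 addr0 -!rowE => /(congr1 ( *:%R 'i%C)).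
rewrite scalerDr scalerA -expr2 sqr_i scaler0 scaleN1r => /eqP; rewrite subr_eq0 => /eqP <-.
by apply/rowP => b; rewrite !mxE.
Qed.

Lemma chern_linC (i : cidx M) j x (z : C) u u' : cdom i x -> fdom j x ->
  A i j (z *: u + u') x = z *: A i j u x + A i j u' x.
Proof.
move=> ix jx; rewrite complexZ -addrA !chern_lin // chern_J //.
rewrite addrA scalerA -scalerDl; congr (_ *: _ + _).
by rewrite [RHS]complexE [X in _ + X]mulrC.
Qed.

Lemma chern_sum (i : cidx M) j x u : cdom i x -> fdom j x ->
  A i j u x = \sum_c u 0 c *: A i j (delta_mx 0 c) x.
Proof.
move=> ix jx.
have A0 : A i j 0 x = 0.
  by have := chern_linC (-1) 0 0 ix jx; rewrite scaler0 addr0 scaleN1r addNr.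
rewrite {1}(row_sum_delta u); elim: (index_enum _) => [|a s IH]; first by rewrite !big_nil.
by rewrite !big_cons chern_linC // IH.
Qed.

(** This is compatibility with h, applied to the constant sections of the
    frame. *)
Lemma chern_gram (i : cidx M) j x u : cdom i x -> fdom j x ->
  has_mderiv (fun t => gram h j (chart_line i x u t)) 0
    (A i j u x *m gram h j x + gram h j x *m (A i j u x) ^t*).
Proof.
move=> ix jx a b.
have [_ gd _ _] := gram_C1 a b ix jx.
have := gd u; rewrite /has_dX; congr (has_cderiv _ _ _).
case: hA => _ _ comp.
have := comp i j x u setT (fun=> delta_mx 0 a) (fun=> delta_mx 0 b) ix jx openT I
  (smooth_row_cst _ _) (smooth_row_cst _ _).
rewrite !cov_cst -!rowE !metric_gram // => H.
transitivity (dX i (fun y => h (frame j y (delta_mx 0 a)) (frame j y (delta_mx 0 b))) x u).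
  by apply: (congr1 (fun f => dX i f x u)); apply/funext => y; rewrite mxE.
rewrite {}H -row_mul [RHS]mxE; congr (_ + _).
  rewrite (_ : delta_mx 0 b ^t* = delta_mx b 0); first by rewrite -colE !mxE.
  by apply/matrixP => p q; rewrite !mxE conjC_nat andbC.
rewrite -rowE !mxE; apply: eq_bigr => c _; rewrite !mxE //.
Qed.

End Chern.
End Metric.
End Gram.

Section Comparison.
Variables (R : realType) (X : topologicalType) (n r : nat).
Variables (M : complex_atlas R X n) (E : hol_bundle M r).
Local Notation C := R[i].
Variables (h0 h1 : tot E -> tot E -> C) (A0 A1 : conn_form E).
Hypotheses (hh0 : hermitian_metric h0) (hh1 : hermitian_metric h1).
Hypotheses (hA0 : chern_connection h0 A0) (hA1 : chern_connection h1 A1).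

(** The matrix K with h1 (c, d) = h0 (c K, d). *)
Definition comparison j x : 'M[C]_r := gram h1 j x *m adjinv (gram h0 j x).

Definition conn_diff (i : cidx M) j u x : 'M[C]_r := A1 i j u x - A0 i j u x.

(** The squared norm of B as a homomorphism from (E, h0) to (E, h1). *)
Definition conn_energy j x (B : 'M[C]_r) : C :=
  \tr (B *m gram h1 j x *m B ^t* *m adjinv (gram h0 j x)).

(** The first two terms are complex linear in u and the third is antilinear:
    they are the (1,0) and (0,1) parts of dK. *)
Definition comparison_deriv (i : cidx M) j x u : 'M[C]_r :=
  A1 i j u x *m comparison j x - comparison j x *m A0 i j u x +
  gram h1 j x *m (conn_diff i j u x) ^t* *m adjinv (gram h0 j x).

(** With J = g0^-1, the derivative of g1 g0^-1 given by d g = a g + g a^* for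
    both metrics: the two terms containing a0 g0 J simplify. *)
Lemma comparison_deriv_algebra (a1 a0 g0 g1 J : 'M[C]_r) :
  J *m g0 = 1%:M -> g0 *m J = 1%:M ->
  (a1 *m g1 + g1 *m a1 ^t*) *m J + g1 *m - (J *m (a0 *m g0 + g0 *m a0 ^t*) *m J) =
  a1 *m (g1 *m J) - g1 *m J *m a0 + g1 *m (a1 - a0) ^t* *m J.
Proof.
move=> Jg gJ.
have -> : (a1 - a0) ^t* = a1 ^t* - a0 ^t* by apply/matrixP => a b; rewrite !mxE rmorphB.
have -> : J *m (a0 *m g0 + g0 *m a0 ^t*) *m J = J *m a0 + a0 ^t* *m J.
  by rewrite mulmxDr mulmxDl !mulmxA Jg mul1mx -mulmxA gJ mulmx1.
rewrite mulmxN !mulmxDr mulmxDl mulmxN mulmxDl mulNmx !mulmxA.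
by rewrite opprD addrACA.
Qed.

Lemma comparison_has_deriv (i : cidx M) j x u : cdom i x -> fdom j x ->
  has_mderiv (fun t => comparison j (chart_line i x u t)) 0 (comparison_deriv i j x u).
Proof.
move=> ix jx.
have u0 := gram_unit hh0 jx.
have g0' : gram h0 j (chart_line i x u 0) \in unitmx by rewrite chart_line0.
have := has_mderivM (chern_gram hh1 hA1 u ix jx)
  (has_mderiv_adjinv g0' (chern_gram hh0 hA0 u ix jx)).
rewrite chart_line0 //; congr (has_mderiv _ _ _).
rewrite /comparison_deriv /comparison /conn_diff !adjinvE //.
apply: comparison_deriv_algebra; [exact: mulVmx|exact: mulmxV].
Qed.

Lemma tr_conj_form (m : nat) (N : 'M[C]_(m, r)) H :
  \tr (N *m H *m N ^t*) = \sum_a (row a N *m H *m (row a N) ^t*) 0 0.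
Proof.
rewrite /mxtrace; apply: eq_bigr => a _; rewrite -row_mul !mxE.
by apply: eq_bigr => b _; rewrite !mxE.
Qed.

Lemma gram_invmx j x : fdom j x -> exists2 P : 'M[C]_r, P \in unitmx &
  adjinv (gram h0 j x) = P ^t* *m P.
Proof.
move=> jx; have [P Pu PE] := gram_orthonormal hh0 jx; exists P => //.
have u0 := gram_unit hh0 jx.
rewrite adjinvE //; apply: (can_inj (mulmxK u0)); rewrite mulVmx //.
by apply/esym; rewrite -mulmxA; exact: mulmx1C.
Qed.

(** If the rows of P are h0-orthonormal then H0^-1 = P^* P, and the trace
    becomes the sum of the h1-norms of the rows of P B. *)
Lemma conn_energy_sum j x : fdom j x -> exists2 P : 'M[C]_r, P \in unitmx &
  forall B, conn_energy j x B =
    \sum_a (row a (P *m B) *m gram h1 j x *m (row a (P *m B)) ^t*) 0 0.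
Proof.
move=> jx; have [P Pu PE] := gram_invmx jx; exists P => // B.
rewrite -tr_conj_form trmx_mul map_mxM /= /conn_energy PE.
by rewrite mulmxA mxtrace_mulC !mulmxA.
Qed.

Lemma gram1_ge0 j x (c : 'rV[C]_r) : fdom j x -> 0 <= (c *m gram h1 j x *m c ^t*) 0 0.
Proof.
move=> jx; have [->|c0] := eqVneq c 0; last exact/ltW/gram_pos.
by rewrite !mul0mx mxE.
Qed.

Lemma conn_energy_ge0 j x B : fdom j x -> 0 <= conn_energy j x B.
Proof.
move=> jx; have [P Pu ->] := conn_energy_sum jx.
by apply: sumr_ge0 => a _; exact: gram1_ge0.
Qed.

Lemma conn_energy_eq0 j x B : fdom j x -> conn_energy j x B = 0 -> B = 0.
Proof.
move=> jx; have [P Pu ->] := conn_energy_sum jx.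
move=> /eqP; rewrite psumr_eq0 => [/allP S0|a _]; last exact: gram1_ge0.
suff PB : P *m B = 0 by rewrite -(mulKmx Pu B) PB mulmx0.
apply/row_matrixP => a; rewrite row0; apply/eqP; apply: contraT => a0.
have := S0 a; rewrite mem_index_enum => /(_ isT) /=.
by rewrite gt_eqF //; exact: gram_pos.
Qed.

Lemma tr_comparison_gt0 j x : (0 < r)%N -> fdom j x -> 0 < \tr (comparison j x).
Proof.
move=> r0 jx; have [P Pu PE] := gram_invmx jx.
rewrite /comparison PE mulmxA mxtrace_mulC mulmxA tr_conj_form.
have Prow a : row a P != 0.
  apply: contraTneq Pu => Pa; apply/negP => /mulmxV /row_matrixP/(_ a).
  rewrite row_mul Pa mul0mx => /rowP/(_ a); rewrite !mxE eqxx => /eqP.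
  by rewrite eq_sym oner_eq0.
rewrite (bigD1 (Ordinal r0)) //= ltr_wpDr //; last exact: gram_pos.
by apply: sumr_ge0 => a _; exact: gram1_ge0.
Qed.

Lemma conj_tr m (N : 'M[C]_m) : (\tr N)^* = \tr (N ^t*).
Proof. by rewrite /mxtrace rmorph_sum; apply: eq_bigr => a _; rewrite !mxE. Qed.

Lemma tr_conj_algebra (B g J : 'M[C]_r) : g ^t* = g -> J ^t* = J ->
  \tr (g *m B ^t* *m J) = (\tr (B *m (g *m J)))^*.
Proof.
by move=> gh Jh; rewrite conj_tr !trmx_mul !map_mxM /= gh Jh mxtrace_mulC mulmxA.
Qed.

(** The (0,1) part of dK is adjoint to the (1,0) part, so that their traces
    are conjugate. *)
Lemma tr_comparison_deriv (i : cidx M) j x u : fdom j x ->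
  \tr (comparison_deriv i j x u) =
  (2 * complex.Re (\tr (conn_diff i j u x *m comparison j x)))%:C.
Proof.
move=> jx; rewrite /comparison_deriv mxtraceD.
set B := conn_diff i j u x; set K := comparison j x.
have -> : \tr (A1 i j u x *m K - K *m A0 i j u x) = \tr (B *m K).
  by rewrite linearB /= (mxtrace_mulC K) /B mulmxBl linearB.
have -> : \tr (gram h1 j x *m B ^t* *m adjinv (gram h0 j x)) = (\tr (B *m K))^*.
  have [P Pu PE] := gram_invmx jx; rewrite /K /comparison PE.
  by apply: tr_conj_algebra; [exact: gram_herm|rewrite trmx_mul map_mxM /= trmxCK].
by rewrite rmorphM /= addcJ rmorph_nat.
Qed.

Lemma tr_comparison_has_deriv (i : cidx M) j x u : cdom i x -> fdom j x ->
  has_cderiv (fun t => \tr (comparison j (chart_line i x u t))) 0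
    (2 * complex.Re (\tr (conn_diff i j u x *m comparison j x)))%:C.
Proof.
move=> ix jx; rewrite -tr_comparison_deriv //.
exact: has_cderiv_tr (comparison_has_deriv u ix jx).
Qed.

Definition conn_deriv (A : conn_form E) (i : cidx M) j u w x : 'M[C]_r :=
  \matrix_(a, b) dX i (fun y => A i j u y a b) x w.

Lemma conn_diff_has_deriv (i : cidx M) j x u w : cdom i x -> fdom j x ->
  has_mderiv (fun t => conn_diff i j u (chart_line i x w t)) 0
    (conn_deriv A1 i j u w x - conn_deriv A0 i j u w x).
Proof.
move=> ix jx; apply: has_mderivB => a b; rewrite mxE.
  by have [_ d _ _] := chern_C1 hA1 u a b ix jx; exact: d.
by have [_ d _ _] := chern_C1 hA0 u a b ix jx; exact: d.
Qed.

(** The derivative along w of 2 Re tr (B(u) K), that is of D_u (tr K). *)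
Definition tr_hessian (i : cidx M) j x u w : R :=
  2 * complex.Re (\tr ((conn_deriv A1 i j u w x - conn_deriv A0 i j u w x) *m comparison j x
                 + conn_diff i j u x *m comparison_deriv i j x w)).

Lemma tr_comparison_has_hessian (i : cidx M) j x u w : cdom i x -> fdom j x ->
  is_derive (0 : R) 1 (fun t : R => 2 * complex.Re
    (\tr (conn_diff i j u (chart_line i x w t) *m comparison j (chart_line i x w t))))
    (tr_hessian i j x u w).
Proof.
move=> ix jx.
have [d _] := has_cderiv_tr (has_mderivM (conn_diff_has_deriv u w ix jx)
  (comparison_has_deriv w ix jx)).
rewrite chart_line0 // in d.
by have := is_deriveZ 2 d; apply.
Qed.

(** Twice the (0,1)-derivative of the connection form, in the direction u. *)
Definition dbar_conn (A : conn_form E) (i : cidx M) j u x : 'M[C]_r :=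
  conn_deriv A i j u u x + 'i%C *: conn_deriv A i j u ('i%C *: u) x.

Lemma conn_derivJ (A : conn_form E) h (hA : chern_connection h A) (i : cidx M) j u w x :
  cdom i x -> fdom j x ->
  conn_deriv A i j ('i%C *: u) w x = 'i%C *: conn_deriv A i j u w x.
Proof.
move=> ix jx; apply/matrixP => a b; rewrite !mxE; apply: has_dXE.
have [_ d _ _] := chern_C1 hA u a b ix jx.
have dom : nbhs x (fdom j `&` cdom i).
  by apply: filterI; [apply: open_nbhs_nbhs; split => //; exact: fdom_open|exact: near_cdom].
apply: has_cderiv_near (has_cderiv_scale 'i%C (d w)).
apply: filterS (near_chart_line w ix dom) => t [[jt it] _].
by rewrite (chern_J hA) // !mxE.
Qed.

(** D_u + i D_{i u} cancels the (1,0) part of dK and doubles the (0,1) part.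
    *)
Lemma comparison_dbar_algebra (a1 a0 K g B J : 'M[C]_r) :
  a1 *m K - K *m a0 + g *m B ^t* *m J +
  'i%C *: (('i%C *: a1) *m K - K *m ('i%C *: a0) + g *m ('i%C *: B) ^t* *m J) =
  2%:R *: (g *m B ^t* *m J).
Proof.
have -> : ('i%C *: B) ^t* = ('i%C)^* *: B ^t* by apply/matrixP => a b; rewrite !mxE rmorphM.
rewrite -!scalemxAr -!scalemxAl -scalerBr.
rewrite !scalerDr !scalerA -expr2 sqr_i.
have -> : ('i%C)^* = - 'i%C :> C by apply/eqP; rewrite eq_complex /= oppr0 !eqxx.
rewrite mulrN -expr2 sqr_i opprK.
by rewrite !scaleN1r -opprD scale1r addrACA subrr add0r -mulr2n scaler_nat.
Qed.

(** As B(i u) = i B(u), the sum is 2 Re of the operator D_u + i D_{i u}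
    applied to tr (B(u) K). On B(u) it gives [dbar_conn], and on K twice the
    (0,1) part of dK, whence the energy. *)
Lemma tr_hessian_sum (i : cidx M) j x u : cdom i x -> fdom j x ->
  tr_hessian i j x u u + tr_hessian i j x ('i%C *: u) ('i%C *: u) =
  2 * complex.Re (\tr ((dbar_conn A1 i j u x - dbar_conn A0 i j u x) *m comparison j x))
  + 4 * complex.Re (conn_energy j x (conn_diff i j u x)).
Proof.
move=> ix jx; rewrite /tr_hessian.
set K := comparison j x; set B := conn_diff i j u x.
have BJ : conn_diff i j ('i%C *: u) x = 'i%C *: B.
  by rewrite /conn_diff (chern_J hA1) // (chern_J hA0) // -scalerBr.
have DK : comparison_deriv i j x u + 'i%C *: comparison_deriv i j x ('i%C *: u) =
    2%:R *: (gram h1 j x *m B ^t* *m adjinv (gram h0 j x)).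
  rewrite /comparison_deriv BJ -/B -/K (chern_J hA1) // (chern_J hA0) //.
  exact: comparison_dbar_algebra.
rewrite -mulrDr -Re_add BJ (conn_derivJ hA1) // (conn_derivJ hA0) //.
rewrite -scalerBr -!scalemxAl -linearD /=.
rewrite addrACA scalemxAl -mulmxDl scalemxAr -mulmxDr DK -scalemxAr !mulmxA.
have -> : dbar_conn A1 i j u x - dbar_conn A0 i j u x =
    conn_deriv A1 i j u u x - conn_deriv A0 i j u u x +
    'i%C *: (conn_deriv A1 i j u ('i%C *: u) x - conn_deriv A0 i j u ('i%C *: u) x).
  by rewrite /dbar_conn scalerBr opprD addrACA.
rewrite mxtraceD mxtraceZ Re_add mulrDr /conn_energy; congr (_ + _).
by move: (\tr (B *m gram h1 j x *m _ *m _)) => z; rewrite Re_mul /=; ring.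
Qed.

End Comparison.

(** * Curvature and the weighted Bochner identity *)

Section Curvature.
Variables (R : realType) (X : topologicalType) (n r : nat).
Variables (M : complex_atlas R X n) (E : hol_bundle M r).
Local Notation C := R[i].
Variables (h : tot E -> tot E -> C) (A : conn_form E).
Hypothesis hA : chern_connection h A.

Lemma curvatureE (i : cidx M) j u w x :
  curvature A i j u w x = conn_deriv A i j w u x - conn_deriv A i j u w x
    + (A i j w x *m A i j u x - A i j u x *m A i j w x).
Proof.
apply/row_matrixP => a; rewrite rowK.
have covE u' w' : cov A i j u' (cov A i j w' (fun=> delta_mx 0 a)) x =
    row a (conn_deriv A i j w' u' x + A i j w' x *m A i j u' x).
  rewrite linearD /= row_mul {1}/cov cov_cst -rowE; congr (_ + _).
  have -> : cov A i j w' (fun=> delta_mx 0 a) = fun y => row a (A i j w' y).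
    by apply/funext => y; rewrite cov_cst -rowE.
  apply/rowP => b; rewrite /dXrow /conn_deriv ![in RHS]mxE ![in LHS]mxE.
  by apply: (congr1 (fun f => dX i f x u')); apply/funext => y; rewrite mxE.
rewrite !covE -linearB /=; congr (row a _).
by rewrite opprD addrACA.
Qed.

Lemma dX_near (i : cidx M) (W : set X) f g x u : cdom i x -> nbhs x W ->
  (forall y, W y -> f y = g y) -> dX i f x u = dX i g x u.
Proof.
move=> ix Wx fg; rewrite /dX /cderiv !derive1E.
have near_line : \forall t \near (0 : R), W (chart_line i x u t).
  by apply: filterS (near_chart_line u ix Wx) => t [].
by congr (_ +i* _); apply: near_eq_derive; apply: filterS near_line => t Wt;
  rewrite -/(chart_line i x u t) fg.
Qed.

Lemma conn_deriv_lin (i : cidx M) j (a : R) u u' w x : cdom i x -> fdom j x ->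
  conn_deriv A i j (a%:C *: u + u') w x = a%:C *: conn_deriv A i j u w x + conn_deriv A i j u' w x.
Proof.
move=> ix jx; apply/matrixP => p q; rewrite !mxE.
have [_ d _ _] := chern_C1 hA u p q ix jx; have [_ d' _ _] := chern_C1 hA u' p q ix jx.
have dD : has_dX i (fun y => a%:C * A i j u y p q + A i j u' y p q) x w
    (a%:C * dX i (fun y => A i j u y p q) x w + dX i (fun y => A i j u' y p q) x w).
  exact: has_cderivD (has_cderiv_scale a%:C (d w)) (d' w).
rewrite -(has_dXE dD); apply: (@dX_near _ (cdom i `&` fdom j)) => //.
  by apply: filterI; [exact: near_cdom|apply: open_nbhs_nbhs; split => //; exact: fdom_open].
by move=> y [iy jy]; rewrite (chern_lin hA) // !mxE.
Qed.

(** Linearity in the direction of differentiation is where the continuity of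
    the partial derivatives of the connection matters. *)
Lemma curvature_rbilin (i : cidx M) j x p q : cdom i x -> fdom j x ->
  rbilin (fun u w => curvature A i j u w x p q).
Proof.
move=> ix jx; split=> [a u u' w|u w]; last first.
  have -> : curvature A i j u w x = - curvature A i j w u x.
    by rewrite !curvatureE opprD !opprB.
  by rewrite mxE.
have D : conn_deriv A i j w (a%:C *: u + u') x =
    a%:C *: conn_deriv A i j w u x + conn_deriv A i j w u' x.
  by apply/matrixP => c d; rewrite !mxE; have [_ _ _ ->] := chern_C1 hA w c d ix jx.
have -> : curvature A i j (a%:C *: u + u') w x =
    a%:C *: curvature A i j u w x + curvature A i j u' w x.
  rewrite !curvatureE D conn_deriv_lin // (chern_lin hA) //.
  rewrite mulmxDr mulmxDl -scalemxAl -scalemxAr.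
  move: (conn_deriv _ _ _ _ _ _) (conn_deriv _ _ _ _ _ _) => D1 D2.
  move: (conn_deriv _ _ _ _ _ _) (conn_deriv _ _ _ _ _ _) => D3 D4.
  move: (_ *m _) (_ *m _) (_ *m _) (_ *m _) => P1 P2 P3 P4.
  by apply/matrixP => c d; rewrite !mxE; ring.
move: (curvature _ _ _ _ _ _) (curvature _ _ _ _ _ _) => P1 P2.
by rewrite !mxE.
Qed.

(** As A(i u) = i A(u), the commutator in the curvature vanishes. *)
Lemma curvature_J (i : cidx M) j x u : cdom i x -> fdom j x ->
  curvature A i j u ('i%C *: u) x = 'i%C *: dbar_conn A i j u x.
Proof.
move=> ix jx; rewrite curvatureE (conn_derivJ hA) // (chern_J hA) //.
rewrite -scalemxAl -scalemxAr subrr addr0 /dbar_conn scalerDr scalerA -expr2 sqr_i.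
by rewrite scaleN1r.
Qed.

Lemma contracted_curvatureE (om : kahler_form M) (i : cidx M) j x e :
  cdom i x -> fdom j x -> kframe (kform om i x) e ->
  contracted_curvature om A i j x = 'i%C *: \sum_a dbar_conn A i j (e a) x.
Proof.
move=> ix jx ke; apply/matrixP => p q; rewrite mxE /Defs.contraction.
rewrite (@contraction_kframe _ _ (kform om i x) _ _ _ _ e) //.
- rewrite [RHS]mxE summxE mulr_sumr; apply: eq_bigr => a _.
  by rewrite curvature_J // mxE.
- by move=> a u u' w; exact: kform_linear.
- by move=> u w; exact: kform_antisym.
- by move=> u w; exact: kform_J.
- exact: curvature_rbilin.
Qed.

End Curvature.

Section WeightedBochner.
Variables (R : realType) (X : topologicalType) (n k r : nat).
Variables (M : complex_atlas R X n) (om : kahler_form M) (T : torus_action M k).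
Variables (mu : X -> 'rV[R]_k) (v : 'rV[R]_k -> R) (E : hol_bundle M r) (L : torus_lift E T).
Local Notation C := R[i].
Variables (h0 h1 : tot E -> tot E -> C) (A0 A1 : conn_form E).
Hypotheses (hh0 : hermitian_metric h0) (hh1 : hermitian_metric h1).
Hypotheses (hA0 : chern_connection h0 A0) (hA1 : chern_connection h1 A1).
Variables c0 c1 : R.
Hypothesis HE0 : forall i j x, cdom i x -> fdom j x ->
  ('i%C / (2 * pi)%:C) *: weighted_contraction L om mu v A0 i j x = (c0%:C)%:M.
Hypothesis HE1 : forall i j x, cdom i x -> fdom j x ->
  ('i%C / (2 * pi)%:C) *: weighted_contraction L om mu v A1 i j x = (c1%:C)%:M.

(** The Lie derivative on E is the same for both metrics. *)
Lemma canonical_moment_diff (i : cidx M) j xi x :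
  canonical_moment L A1 i j xi x - canonical_moment L A0 i j xi x =
  conn_diff A0 A1 i j (vecfield T i xi x) x.
Proof.
by apply/row_matrixP => a; rewrite linearB /= !rowK !cov_cst -!rowE opprB addrA subrK -linearB.
Qed.

Lemma HE_algebra (w q : C) (S0 S1 P0 P1 D0 D1 : 'M[C]_r) : q != 0 ->
  ('i%C / q) *: (w *: ('i%C *: S0) + P0) = D0 ->
  ('i%C / q) *: (w *: ('i%C *: S1) + P1) = D1 ->
  w *: (S1 - S0) = 'i%C *: (P1 - P0) - q *: (D1 - D0).
Proof.
move=> q0 <- <-; apply/matrixP => a b; rewrite !mxE.
have i2 : 'i%C * 'i%C = -1 :> C by rewrite -expr2 sqr_i.
have qE z : q * ('i%C / q * z) = 'i%C * z by rewrite mulrA mulrCA divff // mulr1.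
rewrite (mulrBr q) !qE.
move: 'i%C i2 => J J2.
transitivity (- (J * J) * (w * (S1 a b - S0 a b))); last by ring.
by rewrite J2 opprK mul1r.
Qed.

Lemma HE_diff (i : cidx M) j x e : cdom i x -> fdom j x -> kframe (kform om i x) e ->
  (v (mu x))%:C *: \sum_a (dbar_conn A1 i j (e a) x - dbar_conn A0 i j (e a) x) =
  'i%C *: conn_diff A0 A1 i j (vecfield T i (dweight v (mu x)) x) x
  - ((2 * pi * (c1 - c0))%:C)%:M.
Proof.
move=> ix jx ke.
have := HE1 ix jx; have := HE0 ix jx; rewrite /weighted_contraction.
rewrite (contracted_curvatureE hA0 ix jx ke) (contracted_curvatureE hA1 ix jx ke).
set S0 := \sum_a _; set S1 := \sum_a _ => e0 e1.
rewrite sumrB -/S1 -/S0 -canonical_moment_diff.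
have -> : ((2 * pi * (c1 - c0))%:C)%:M = (2 * pi)%:C *: ((c1%:C)%:M - (c0%:C)%:M) :> 'M[C]_r.
  apply/matrixP => a b; rewrite !mxE; case: (a == b).
    by rewrite !mulr1n rmorphM rmorphB.
  by rewrite !mulr0n subrr mulr0.
apply: HE_algebra e0 e1.
by rewrite -(rmorph0 (real_complex R)) (inj_eq (@complexI R)) mulf_neq0 ?gt_eqF ?pi_gt0.
Qed.

(** The contracted curvatures are eliminated by the two weighted equations;
    the term i B(V) that they leave is B(i V), whose trace against K is the
    derivative of tr K along i V. *)
Lemma weighted_bochner (i : cidx M) j x e : cdom i x -> fdom j x ->
  kframe (kform om i x) e ->
  v (mu x) * \sum_a (tr_hessian h0 h1 A0 A1 i j x (e a) (e a)
                   + tr_hessian h0 h1 A0 A1 i j x ('i%C *: e a) ('i%C *: e a)) =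
  2 * complex.Re (\tr (conn_diff A0 A1 i j ('i%C *: vecfield T i (dweight v (mu x)) x) x
                       *m comparison h0 h1 j x))
  - 4 * pi * (c1 - c0) * complex.Re (\tr (comparison h0 h1 j x))
  + 4 * v (mu x) * \sum_a complex.Re (conn_energy h0 h1 j x (conn_diff A0 A1 i j (e a) x)).
Proof.
move=> ix jx ke.
under eq_bigr => a _ do rewrite (tr_hessian_sum hA0 hA1) //.
rewrite big_split /= -!mulr_sumr mulrDr; congr (_ + _); last by ring.
have vRe (t : R) (z : C) : t * complex.Re z = complex.Re (t%:C * z).
  by rewrite Re_mul /= mul0r subr0.
have trE (I : Type) (s : seq I) (w : C) (F : I -> 'M[C]_r) K :
    w * \sum_(a <- s) \tr (F a *m K) = \tr ((w *: \sum_(a <- s) F a) *m K).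
  by rewrite -scalemxAl mulmx_suml mxtraceZ raddf_sum.
rewrite -Re_sum mulrCA (vRe (v (mu x))) trE (HE_diff ix jx ke).
rewrite mulmxBl [\tr (_ - _)]linearB /= mul_scalar_mx mxtraceZ.
have -> : conn_diff A0 A1 i j ('i%C *: vecfield T i (dweight v (mu x)) x) x =
   'i%C *: conn_diff A0 A1 i j (vecfield T i (dweight v (mu x)) x) x.
  by rewrite /conn_diff (chern_J hA1) // (chern_J hA0) // -scalerBr.
set z := \tr _; set w := \tr _.
have ReB (y y' : C) : complex.Re (y - y') = complex.Re y - complex.Re y' by case: y; case: y'.
by rewrite ReB -vRe; ring.
Qed.

End WeightedBochner.

(** * Euclidean geometry of the charts *)

Section EuclideanForm.
Variables (R : realType) (n : nat).
Local Notation C := R[i].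
Local Notation V := 'rV[C]_n.

Definition edot (u w : V) : R := \sum_a (complex.Re (u 0 a) * complex.Re (w 0 a)
  + complex.Im (u 0 a) * complex.Im (w 0 a)).

Lemma edotC u w : edot u w = edot w u.
Proof. by apply: eq_bigr => a _; rewrite [X in X + _]mulrC [X in _ + X]mulrC. Qed.

Lemma edotDl u u' w : edot (u + u') w = edot u w + edot u' w.
Proof.
by rewrite -big_split /=; apply: eq_bigr => a _; rewrite mxE Re_add Im_add; ring.
Qed.

Lemma edotZl (t : R) u w : edot (t%:C *: u) w = t * edot u w.
Proof.
rewrite mulr_sumr; apply: eq_bigr => a _; rewrite mxE Re_mul Im_mul /=; ring.
Qed.

Lemma edot_ge0 u : 0 <= edot u u.
Proof. by apply: sumr_ge0 => a _; rewrite -!expr2 addr_ge0 ?sqr_ge0. Qed.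

Lemma edot_coord (u : V) a : complex.Re (u 0 a) ^+ 2 + complex.Im (u 0 a) ^+ 2 <= edot u u.
Proof.
rewrite /edot (bigD1 a) //= -!expr2 lerDl; apply: sumr_ge0 => b _.
by rewrite -!expr2 addr_ge0 ?sqr_ge0.
Qed.

Lemma edotDr u u' w : edot w (u + u') = edot w u + edot w u'.
Proof. by rewrite edotC edotDl !(edotC w). Qed.

Lemma edotZr (t : R) u w : edot w (t%:C *: u) = t * edot w u.
Proof. by rewrite edotC edotZl edotC. Qed.

Lemma edot_line u w (t : R) :
  edot (u + t%:C *: w) (u + t%:C *: w) = edot u u + 2 * t * edot u w + t ^+ 2 * edot w w.
Proof. by rewrite !(edotDl, edotDr, edotZl, edotZr) (edotC w u); ring. Qed.

Lemma edot_sq_add u w : edot (u + w) (u + w) <= 2 * edot u u + 2 * edot w w.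
Proof.
have := edot_line u w 1; have := edot_line u w (-1); rewrite rmorph1 scale1r => H ->.
have := edot_ge0 (u + (-1)%:C *: w); rewrite H; lra.
Qed.

Lemma edot_le u w : - (2 * edot u w) <= edot u u + edot w w.
Proof.
have := edot_line u w 1; rewrite rmorph1 scale1r => H.
have := edot_ge0 (u + w); rewrite H; lra.
Qed.

Lemma edotJ u : edot ('i%C *: u) ('i%C *: u) = edot u u.
Proof.
apply: eq_bigr => a _; rewrite mxE Re_mul Im_mul /=; ring.
Qed.

Lemma edot_of_real_continuous (y : V) :
  continuous (fun p : 'rV[R]_n * 'rV[R]_n => edot (of_real p - y) (of_real p - y)).
Proof.
move=> p.
pose P (g : 'rV[R]_n * 'rV[R]_n -> R) := {for p, continuous g}.
have Pc c : P (fun=> c) by exact: cst_continuous.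
have Pa f g : P f -> P g -> P (fun s => f s + g s) by exact: continuousD.
have Pm f g : P f -> P g -> P (fun s => f s * g s) by exact: continuousM.
have Pre a : P (fun q => complex.Re ((of_real q - y) 0 a)).
  rewrite (_ : (fun q => _) = fun q : 'rV[R]_n * 'rV[R]_n => q.1 0 a + - complex.Re (y 0 a)).
    apply: Pa => //.
    by apply: (@continuous_comp _ _ _ fst (fun M : 'rV[R]_n => M 0 a));
      [exact: cvg_fst|exact: coord_continuous].
  by apply/funext => q; rewrite !mxE Re_add /=; case: (y 0 a).
have Pim a : P (fun q => complex.Im ((of_real q - y) 0 a)).
  rewrite (_ : (fun q => _) = fun q : 'rV[R]_n * 'rV[R]_n => q.2 0 a + - complex.Im (y 0 a)).
    apply: Pa => //.
    by apply: (@continuous_comp _ _ _ snd (fun M : 'rV[R]_n => M 0 a));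
      [exact: cvg_snd|exact: coord_continuous].
  by apply/funext => q; rewrite !mxE Im_add /=; case: (y 0 a).
by apply: (fsum_closed Pc Pa) => a; apply: Pa; apply: Pm.
Qed.

(** The inequality is stated in real coordinates because there compactness
    follows from that of products of segments. *)
Lemma annulus_compact (y : V) (d rho : R) :
  compact [set p : 'rV[R]_n * 'rV[R]_n | d <= edot (of_real p - y) (of_real p - y) <= rho ^+ 2].
Proof.
pose box (c : 'rV[R]_n) := [set u : 'rV[R]_n |
  forall a, [set` `[c 0 a - `|rho|, c 0 a + `|rho|]] (u 0 a)].
have boxc c : compact (box c).
  by apply: (@rV_compact R n (fun a => [set` `[c 0 a - `|rho|, c 0 a + `|rho|]])) => a;
    exact: segment_compact.
pose q p := edot (of_real p - y) (of_real p - y).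
apply: (@subclosed_compact _ _ (box (to_real y).1 `*` box (to_real y).2)).
- rewrite (_ : mkset _ = (q @^-1` [set t | t <= rho ^+ 2]) `&` (q @^-1` [set t | d <= t])).
    have qc : continuous q by exact: edot_of_real_continuous.
    apply: closedI; first exact: ((continuous_closedP q).1 qc _ (@closed_le R _)).
    exact: ((continuous_closedP q).1 qc _ (@closed_ge R _)).
  by apply/seteqP; split=> p /=; [move=> /andP[]|move=> [? ?]; apply/andP].
- exact: compact_setX.
move=> p /= /andP[_ pr].
have coord (s t : R) : s ^+ 2 <= rho ^+ 2 -> s = t -> `|t| <= `|rho|.
  by move=> H <-; rewrite -ler_sqr ?nnegrE ?normr_ge0 // !real_normK ?num_real.
split=> a /=; rewrite in_itv /= !mxE.
  have := edot_coord (of_real p - y) a; rewrite !mxE => H.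
  have : `|p.1 0 a - complex.Re (y 0 a)| <= `|rho|.
    apply: (coord (complex.Re ((p.1 0 a +i* p.2 0 a)%C - y 0 a))); last by case: (y 0 a).
    have := sqr_ge0 (complex.Im ((p.1 0 a +i* p.2 0 a)%C - y 0 a)); lra.
  by rewrite ler_distl.
have := edot_coord (of_real p - y) a; rewrite !mxE => H.
have : `|p.2 0 a - complex.Im (y 0 a)| <= `|rho|.
  apply: (coord (complex.Im ((p.1 0 a +i* p.2 0 a)%C - y 0 a))); last by case: (y 0 a).
  have := sqr_ge0 (complex.Re ((p.1 0 a +i* p.2 0 a)%C - y 0 a)); lra.
by rewrite ler_distl.
Qed.

End EuclideanForm.

(** * The strong maximum principle *)

Section Barrier.
Variable R : realType.

Lemma barrier_deriv (al q b c t : R) :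
  is_derive t 1 (fun s : R => expR (- al * (q + 2 * s * b + s ^+ 2 * c)))
    (- al * (2 * b + 2 * t * c) * expR (- al * (q + 2 * t * b + t ^+ 2 * c))).
Proof.
have d1 : is_derive t 1 (fun s : R => - al * (q + 2 * s * b + s ^+ 2 * c))
    (- al * (2 * b + 2 * t * c)).
  rewrite (_ : (fun s => _) =
    (- al) *: (cst q + (2 * b) *: (id : R -> R) + c *: ((id : R -> R) ^+ 2))).
    by apply: is_derive_eq; rewrite /GRing.scale /= ?expr1; ring.
  by apply/funext => s; rewrite /= /cst !fctE /GRing.scale /=; ring.
have := is_derive1_comp (is_derive_expR _) d1.
by rewrite mulrC.
Qed.

Lemma barrier_deriv2 (al q b c : R) :
  is_derive (0 : R) 1 (fun t : R =>
      - al * (2 * b + 2 * t * c) * expR (- al * (q + 2 * t * b + t ^+ 2 * c)))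
    ((4 * al ^+ 2 * b ^+ 2 - 2 * al * c) * expR (- al * q)).
Proof.
have d1 : is_derive (0 : R) 1 (fun t : R => - al * (2 * b + 2 * t * c)) (- al * (2 * c)).
  rewrite (_ : (fun s => _) = (- al) *: (cst (2 * b) + (2 * c) *: (id : R -> R))).
    by apply: is_derive_eq; rewrite /GRing.scale /=; ring.
  by apply/funext => s; rewrite /= /cst !fctE /GRing.scale /=; ring.
have := is_deriveM d1 (barrier_deriv al q b c 0).
move=> H; apply: (is_derive_eq H).
by rewrite /GRing.scale /= !(mulr0, mul0r, expr0n, addr0) /=; ring.
Qed.

Variables (X : topologicalType) (n : nat) (M : complex_atlas R X n) (i : cidx M).
Local Notation C := R[i].

Lemma is_derive_chart_line (f f1 : X -> R) x u : cdom i x ->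
  (\forall y \near x, is_derive (0 : R) 1 (fun t : R => f (chart_line i y u t)) (f1 y)) ->
  \forall t \near (0 : R), is_derive (t : R) 1 (fun t : R => f (chart_line i x u t))
     (f1 (chart_line i x u t)).
Proof.
move=> ix ff1; apply: filterS (near_chart_line u ix ff1) => t [dt ct].
have -> : t = t + 0 *: (1 : R) by rewrite scale0r addr0.
apply/is_derive_line; rewrite scale0r addr0; move: dt; congr (is_derive _ _ _ _).
apply/funext => s; congr f; rewrite /chart_line -/(chart_line i x u t) ct.
by rewrite -addrA -scalerDl -rmorphD [s *: 1]mulr1.
Qed.

(** The two necessary conditions at a maximum of f + ep exp (- al |z|^2), in
    the direction u. *)
Lemma barrier_test (f f1 : X -> R) (f2 : R) x u (al ep : R) (y0 : 'rV[C]_n) : cdom i x ->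
  (\forall y \near x, is_derive (0 : R) 1 (fun t : R => f (chart_line i y u t)) (f1 y)) ->
  is_derive (0 : R) 1 (fun t : R => f1 (chart_line i x u t)) f2 ->
  let z := chart i x - y0 in
  (\forall t \near (0 : R),
    f (chart_line i x u t) + ep * expR (- al * edot (z + t%:C *: u) (z + t%:C *: u))
     <= f x + ep * expR (- al * edot z z)) ->
  f1 x = ep * (2 * al * edot z u) * expR (- al * edot z z) /\
  f2 <= - (ep * ((4 * al ^+ 2 * edot z u ^+ 2 - 2 * al * edot u u) * expR (- al * edot z z))).
Proof.
move=> ix ff1 f12 z zmax.
pose W (t : R) := expR (- al * (edot z z + 2 * t * edot z u + t ^+ 2 * edot u u)).
pose W1 (t : R) := - al * (2 * edot z u + 2 * t * edot u u) * W t.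
have W0 : W 0 = expR (- al * edot z z).
  by rewrite /W; congr expR; ring.
have [] := @deriv_at_local_max R
  (fun t => f (chart_line i x u t) + ep * W t)
  (fun t => f1 (chart_line i x u t) + ep * W1 t)
  (f2 + ep * ((4 * al ^+ 2 * edot z u ^+ 2 - 2 * al * edot u u) * expR (- al * edot z z))).
- apply: filterS (is_derive_chart_line ix ff1) => t dt.
  have dW : is_derive t 1 W (W1 t) by exact: barrier_deriv.
  exact: is_deriveD dt (is_deriveZ ep dW).
- have dW := barrier_deriv2 al (edot z z) (edot z u) (edot u u).
  exact: is_deriveD f12 (is_deriveZ ep dW).
- apply: filterS zmax => t; rewrite chart_line0 // W0 /W -edot_line //.
rewrite chart_line0 // /W1 W0 !(mulr0, mul0r, addr0) => H1 H2; split.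
  by move/eqP: H1; rewrite addr_eq0 => /eqP ->; ring.
lra.
Qed.

Lemma edot_continuous (y : 'rV[C]_n) :
  continuous (fun z : 'rV[C^o]_n => edot (z - y) (z - y) : R).
Proof.
rewrite (_ : (fun z => _) = (fun p => edot (of_real p - y) (of_real p - y)) \o
    (@to_real R n : 'rV[C^o]_n -> _)); last by apply/funext => z /=; rewrite to_realK.
by move=> z; apply: continuous_comp; [exact: to_real_continuous|exact: edot_of_real_continuous].
Qed.

Lemma edot_subC (y z : 'rV[C]_n) : edot (y - z) (y - z) = edot (z - y) (z - y).
Proof.
apply: eq_bigr => a _; rewrite !mxE.
by case: (y 0 a) => p q; case: (z 0 a) => p' q' /=; ring.
Qed.

Lemma nbhs_edot (z0 : 'rV[C]_n) (W : set 'rV[C]_n) :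
  nbhs (z0 : 'rV[C^o]_n) W ->
  exists2 rho : R, 0 < rho & forall z, edot (z - z0) (z - z0) < rho ^+ 2 -> W z.
Proof.
move=> /nbhs_ballP[e /=]; rewrite ltcE => /andP[/eqP/= ei er] eW.
exists (complex.Re e) => // z ze; apply: eW; split=> [|a b].
  by rewrite ltcE /= ei eqxx.
rewrite (ord1 a) /ball /= normc_def ltcE /= ei eqxx /=.
rewrite -[ltRHS]ger0_norm ?ltW // -sqrtr_sqr ltr_sqrt ?exprn_gt0 //.
apply: le_lt_trans ze; have := edot_coord (z - z0) b; rewrite !mxE.
by case: (z 0 b) => p q; case: (z0 0 b) => p' q' /=; lra.
Qed.

(** At x, the operator v sum_a (D_{e_a}^2 + D_{i e_a}^2) - D_V is nonnegative
    on f, whose first and second derivatives are f1 and f2; the frame is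
    bounded and spans uniformly, and V / v is bounded, in terms of K only. *)
Definition elliptic_at (K : R) (f1 f2 : 'rV[C]_n -> X -> R) (x : X) : Prop :=
  exists (e : 'I_n -> 'rV[C]_n) (V : 'rV[C]_n) (v : R),
   [/\ 0 < v, forall z, edot z z <= K * \sum_a (edot z (e a) ^+ 2 + edot z ('i%C *: e a) ^+ 2),
       \sum_a edot (e a) (e a) <= K, edot V V <= K * v ^+ 2 &
       f1 V x <= v * \sum_a (f2 (e a) x + f2 ('i%C *: e a) x)].

(** At a maximum, [barrier_test] in the directions e_a, i e_a and V bounds the
    operator of [elliptic_at] on f by minus ep times its value on exp (- al
    |z|^2). For al this large the latter is positive: the term of order al^2
    is controlled from below since |z|^2 >= d. *)
Lemma barrier_not_max (K : R) (f : X -> R) (f1 f2 : 'rV[C]_n -> X -> R) (x : X)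
    (y0 : 'rV[C]_n) (d rho ep : R) : cdom i x -> 0 < K -> 0 < d -> 0 < ep ->
  (forall u, \forall y \near x,
    is_derive (0 : R) 1 (fun t : R => f (chart_line i y u t)) (f1 u y)) ->
  (forall u, is_derive (0 : R) 1 (fun t : R => f1 u (chart_line i x u t)) (f2 u x)) ->
  elliptic_at K f1 f2 x ->
  let z := chart i x - y0 in
  let al := K * (5 * K + rho ^+ 2 + 1) / (4 * d) in
  d <= edot z z <= rho ^+ 2 ->
  ~ forall u, \forall t \near (0 : R),
    f (chart_line i x u t) + ep * expR (- al * edot (z + t%:C *: u) (z + t%:C *: u))
     <= f x + ep * expR (- al * edot z z).
Proof.
move=> ix K0 d0 ep0 ff1 f12 [e [V [v [v0 ze eK VK fV]]]] z al /andP[dz zr] zmax.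
have al0 : 0 < al.
  have r2 := sqr_ge0 rho.
  by rewrite /al divr_gt0 ?mulr_gt0 //; lra.
have test u := barrier_test ix (ff1 u) (f12 u) (zmax u).
move: zmax test; rewrite -/z; set E := expR (- al * edot z z) => _ test.
have E0 : 0 < E by exact: expR_gt0.
have [f1V _] := test V.
have f2e a : f2 (e a) x + f2 ('i%C *: e a) x <=
  - (ep * ((4 * al ^+ 2 * (edot z (e a) ^+ 2 + edot z ('i%C *: e a) ^+ 2)
            - 4 * al * edot (e a) (e a)) * E)).
  have [_ H1] := test (e a); have [_ H2] := test ('i%C *: e a).
  rewrite edotJ in H2; apply: (le_trans (lerD H1 H2)).
  by rewrite le_eqVlt; apply/orP; left; apply/eqP; ring.
have {}ze := ze z; set S := \sum_a (edot z (e a) ^+ 2 + edot z ('i%C *: e a) ^+ 2) in ze.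
set N := \sum_a edot (e a) (e a) in eK.
have sum_le : \sum_a (f2 (e a) x + f2 ('i%C *: e a) x) <=
    - (ep * ((4 * al ^+ 2 * S - 4 * al * N) * E)).
  apply: (le_trans (ler_sum _ (fun a _ => f2e a))).
  rewrite sumrN lerN2 le_eqVlt; apply/orP; left; apply/eqP.
  rewrite -mulr_sumr -mulr_suml; congr (_ * (_ * _)).
  by rewrite sumrB -!mulr_sumr.
(* |v z + V|^2 >= 0, divided by v. *)
have edotV : - (2 * edot z V) <= v * (rho ^+ 2 + K).
  have := edot_le (v%:C *: z) V; rewrite edotZl edotZl edotZr => H.
  rewrite -(ler_pM2l v0).
  have : v * (v * edot z z) <= v * (v * rho ^+ 2) by rewrite !ler_pM2l.
  lra.
have SK : d / K <= S by rewrite ler_pdivrMr // mulrC; exact: le_trans dz ze.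
have key : ep * (2 * al * edot z V) * E <= v * - (ep * ((4 * al ^+ 2 * S - 4 * al * N) * E)).
  by rewrite -f1V; apply: (le_trans fV); rewrite ler_pM2l.
have key2 : 2 * edot z V + v * (4 * al * S - 4 * N) <= 0.
  rewrite -(pmulr_rle0 _ (mulr_gt0 (mulr_gt0 ep0 E0) al0)).
  have -> : ep * E * al * (2 * edot z V + v * (4 * al * S - 4 * N)) =
    ep * (2 * al * edot z V) * E - v * - (ep * ((4 * al ^+ 2 * S - 4 * al * N) * E)) by ring.
  by rewrite subr_le0.
have : 4 * al * S - 4 * N <= rho ^+ 2 + K.
  by rewrite -(ler_pM2l v0); lra.
have : 4 * al * (d / K) <= 4 * al * S by rewrite ler_pM2l // mulr_gt0.
(* The choice of al: more than the 4 N + rho^2 + K that the tests permit. *)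
have -> : 4 * al * (d / K) = 5 * K + rho ^+ 2 + 1.
  by rewrite /al; field; rewrite !gt_eqF.
lra.
Qed.

(** Suppose f y < m for some y near x0. Add to f a small multiple of a
    Gaussian centred at y and consider the maximum of the sum on an annulus
    around y that contains x0. It is not on the inner sphere, where f is
    smaller than m by at least ep, nor on the outer one, where the Gaussian is
    smaller than at x0; and in the interior it contradicts [barrier_not_max].
    *)
Lemma strong_maximum (K : R) (f : X -> R) f1 f2 (m : R) (x0 : X) : cdom i x0 -> 0 < K ->
  (\forall x \near x0, {for x, continuous f}) ->
  (\forall x \near x0, forall u,
     is_derive (0 : R) 1 (fun t : R => f (chart_line i x u t)) (f1 u x)) ->
  (\forall x \near x0, forall u,
     is_derive (0 : R) 1 (fun t : R => f1 u (chart_line i x u t)) (f2 u x)) ->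
  (\forall x \near x0, elliptic_at K f1 f2 x) -> (forall x, f x <= m) -> f x0 = m ->
  \forall x \near x0, f x = m.
Proof.
move=> ix0 K0 nfc nf1 nf2 nell fm fx0.
pose G : set X := [set x | [/\ {for x, continuous f},
  forall u, \forall y \near x, is_derive (0 : R) 1 (fun t : R => f (chart_line i y u t)) (f1 u y),
  forall u, is_derive (0 : R) 1 (fun t : R => f1 u (chart_line i x u t)) (f2 u x) &
  elliptic_at K f1 f2 x]].
have nG : nbhs x0 G.
  have nf1' := nbhs_interior nf1.
  apply: filterS2 (filterI nfc nf2) (filterI nf1' nell) => x [xc x2] [x1 xe]; split => // u.
  by apply: filterS x1 => y; exact.
have [rho0 rho00 inG] := nbhs_edot (near_param ix0 nG).
(* Points at distance rho of y, itself at distance rho of x0, stay in the ball of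
   radius 3 rho where the hypotheses hold. *)
have [rho rho_gt0 rho3] : exists2 rho : R, 0 < rho & rho0 = 3 * rho.
  by exists (rho0 / 3); [rewrite divr_gt0|field].
have near_rho : \forall y \near x0,
    cdom i y /\ edot (chart i y - chart i x0) (chart i y - chart i x0) < rho ^+ 2.
  apply: filterI; first exact: near_cdom.
  have qc : {for x0, continuous (fun y =>
    edot (chart i y - chart i x0) (chart i y - chart i x0) : R)}.
    apply: (@continuous_comp _ _ _ (chart i)
      (fun z : 'rV[C^o]_n => edot (z - chart i x0) (z - chart i x0))).
      exact: chart_continuous.
    exact: edot_continuous.
  have lt0 : edot (chart i x0 - chart i x0) (chart i x0 - chart i x0) < rho ^+ 2.
    by rewrite subrr /edot big1 ?exprn_gt0 // => a _; rewrite mxE /= mulr0 addr0.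
  exact: (cvgr_lt _ qc _ lt0).
apply: filterS near_rho => y [iy yrho].
apply/eqP; case: eqP => // /eqP fym.
have {}fym : f y < m by rewrite lt_neqAle fym fm.
(* Any level between f y and m serves to define the inner sphere. *)
pose m' := (f y + m) / 2; have m'm : m' < m by rewrite /m'; lra.
have fym' : f y < m' by rewrite /m'; lra.
have rho_rho0 : 4 * rho ^+ 2 < rho0 ^+ 2.
  have -> : rho0 ^+ 2 = 9 * rho ^+ 2 by rewrite rho3; ring.
  by have := exprn_gt0 2 rho_gt0; lra.
have [yc _ _ _] : G y.
  have := inG (chart i y); rewrite chartK //; case=> //.
  by have := exprn_gt0 2 rho_gt0; lra.
have nfm' : \forall x \near y, f x < m' by exact: (cvgr_lt _ yc _ fym').
have [r r0 rP] := nbhs_edot (near_param iy nfm').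
(* The inner sphere |z|^2 = d lies where f < m'. *)
pose d := r ^+ 2 / 2; have d0 : 0 < d by rewrite divr_gt0 ?exprn_gt0.
have dr : d < r ^+ 2 by rewrite /d; have := exprn_gt0 2 r0; lra.
pose q p : R := edot (of_real p - chart i y) (of_real p - chart i y).
pose A := [set p : 'rV[R]_n * 'rV[R]_n | d <= q p <= rho ^+ 2].
have A_in p : A p -> (chart i @` cdom i) (of_real p) /\ G (param i (of_real p)).
  move=> /andP[_ pr]; apply: inG.
  have := edot_sq_add (of_real p - chart i y) (chart i y - chart i x0).
  rewrite addrA subrK -/(q p); lra.
pose p0 := to_real (chart i x0).
have q0 : q p0 < rho ^+ 2.
  by rewrite /q /p0 to_realK edot_subC.
have Ap0 : A p0.
  apply/andP; split; last exact: ltW.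
  rewrite leNgt; apply/negP => qd.
  have [_] : (chart i @` cdom i) (chart i x0) /\ f (param i (chart i x0)) < m'.
    by apply: rP; move: qd; rewrite /q /p0 to_realK; lra.
  by rewrite chartK // fx0; lra.
pose al := K * (5 * K + rho ^+ 2 + 1) / (4 * d).
have al0 : 0 < al.
  by have r2 := sqr_ge0 rho; rewrite /al divr_gt0 ?mulr_gt0 //; lra.
(* A Gaussian is at most 1, so that f + ep * Gaussian < m' + ep = m on the inner
   sphere. *)
pose ep := m - m'; have ep0 : 0 < ep by rewrite subr_gt0.
pose g p : R := f (param i (of_real p)) + ep * expR (- al * q p).
have gc : {within A, continuous g}.
  apply: continuous_in_subspaceT => p; rewrite inE => Ap.
  have [pim [pc _ _ _]] := A_in p Ap.
  have c1 : {for p, continuous (fun p => f (param i (of_real p)))}.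
    apply: (@continuous_comp _ _ _ (fun p => param i (of_real p)) f); last exact: pc.
    apply: (@continuous_comp ('rV[R]_n * 'rV[R]_n)%type 'rV[C^o]_n X (@of_real R n) (param i) p).
      exact: of_real_continuous.
    by case: pim => x ix <-; exact: param_continuous.
  have c2 : {for p, continuous (fun p => - al * q p)}.
    by apply: continuousM; [exact: cst_continuous|exact: edot_of_real_continuous].
  have c3 : {for p, continuous (fun p => ep * expR (- al * q p))}.
    apply: continuousM; first exact: cst_continuous.
    by apply: (@continuous_comp _ _ _ (fun p => - al * q p) (@expR R)); last exact: continuous_expR.
  exact: continuousD c1 c3.
have [ps] := @compact_EVT_max _ R g A (ex_intro _ p0 Ap0)
  (@annulus_compact R n (chart i y) d rho) gc.
rewrite inE => Aps gmax.
have [psim [_ xs1 xs2 xse]] := A_in ps Aps.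
have [ixs chs] := chart_image_paramK psim.
set xs := param i (of_real ps) in ixs chs xs1 xs2 xse.
have g0 : g p0 <= g ps by apply: gmax; rewrite inE.
have gp0 : m + ep * expR (- al * rho ^+ 2) < g p0.
  rewrite /g {1}/p0 to_realK chartK // fx0 ltrD2l ltr_pM2l // ltr_expR.
  by rewrite !mulNr ltrN2 ltr_pM2l.
have [qd qr] : d < q ps /\ q ps < rho ^+ 2.
  case/andP: Aps => qd qr; split; rewrite lt_neqAle ?qd ?qr ?andbT; apply/eqP => qE.
    have [_ fxs] : (chart i @` cdom i) (of_real ps) /\ f xs < m' by apply: rP; rewrite -/(q ps) -qE.
    have : expR (- al * q ps) <= 1.
      by rewrite -expR0 ler_expR mulNr oppr_le0 mulr_ge0 //; [exact: ltW|exact: edot_ge0].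
    rewrite -(ler_pM2l ep0) mulr1 => ee.
    have : 0 < ep * expR (- al * rho ^+ 2) by rewrite mulr_gt0 // expR_gt0.
    by move: g0 gp0; rewrite {2}/g -/xs /ep in ee *; lra.
  by move: g0 gp0; rewrite {2}/g -/xs qE; have := fm xs; lra.
exfalso; apply: (barrier_not_max ixs K0 d0 ep0 xs1 xs2 xse (y0 := chart i y) (rho := rho)).
  by rewrite chs -/(q ps) !ltW.
move=> u; rewrite chs -/al.
have qcont : {for 0, continuous (fun t : R =>
    edot (of_real ps + t%:C *: u - chart i y) (of_real ps + t%:C *: u - chart i y))}.
  apply: (@continuous_comp _ _ _ (fun t : R => of_real ps + t%:C *: u : 'rV[C^o]_n)
    (fun z : 'rV[C^o]_n => edot (z - chart i y) (z - chart i y))).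
    exact: line_continuous.
  exact: edot_continuous.
have qE0 :
    edot (of_real ps + (0 : R)%:C *: u - chart i y)
         (of_real ps + (0 : R)%:C *: u - chart i y) = q ps.
  by rewrite scale0r addr0.
have n1 : \forall t \near (0 : R),
    d < edot (of_real ps + t%:C *: u - chart i y) (of_real ps + t%:C *: u - chart i y).
  by apply: (cvgr_gt _ qcont); rewrite qE0.
have n2 : \forall t \near (0 : R),
    edot (of_real ps + t%:C *: u - chart i y) (of_real ps + t%:C *: u - chart i y) < rho ^+ 2.
  by apply: (cvgr_lt _ qcont); rewrite qE0.
apply: filterS2 n1 n2 => t t1 t2.
have At : A (to_real (of_real ps + t%:C *: u)).
  by rewrite /A /= /q to_realK; apply/andP; split; exact: ltW.
have := gmax (to_real (of_real ps + t%:C *: u)); rewrite inE => /(_ At).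
rewrite /g /q to_realK -/xs /chart_line chs.
by rewrite [_ - _ + _]addrAC.
Qed.

End Barrier.

(** * Independence of the frame *)

Section FrameChange.
Variables (R : realType) (X : topologicalType) (n r : nat).
Variables (M : complex_atlas R X n) (E : hol_bundle M r).
Local Notation C := R[i].

Definition trans_mx (j l : fidx E) (x : X) : 'M[C]_r :=
  \matrix_a triv l (frame j x (delta_mx 0 a)).

Lemma triv_frame j l x c : fdom j x -> fdom l x ->
  triv l (frame j x c) = c *m trans_mx j l x.
Proof.
move=> jx lx; have lin := trans_linear jx lx.
have lin0 : triv l (frame j x 0) = 0.
  by have := lin (-1) 0 0; rewrite scaler0 addr0 scaleN1r addNr.
have L I (s : seq I) (k : I -> C) (b : I -> 'rV[C]_r) :
    triv l (frame j x (\sum_(i <- s) k i *: b i)) = \sum_(i <- s) k i *: triv l (frame j x (b i)).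
  elim: s => [|i s IH]; first by rewrite !big_nil.
  by rewrite !big_cons lin IH.
rewrite {1}(row_sum_delta c) L mulmx_sum_row; apply: eq_bigr => a _.
by rewrite rowK.
Qed.

Lemma frame_change j l x c : fdom j x -> fdom l x ->
  frame j x c = frame l x (c *m trans_mx j l x).
Proof.
move=> jx lx; rewrite -triv_frame //.
have bp : bproj (frame j x c) = x by exact: bproj_frame.
by have := @trivK _ _ _ _ _ E l (frame j x c); rewrite bp => ->.
Qed.

Lemma trans_mx_unit j l x : fdom j x -> fdom l x -> trans_mx j l x \in unitmx.
Proof.
move=> jx lx; suff /mulmx1_unit[] : trans_mx j l x *m trans_mx l j x = 1%:M by [].
apply/row_matrixP => a; rewrite !rowE mulmx1 mulmxA -triv_frame //.
by rewrite -frame_change // frameK.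
Qed.

Variables (h0 h1 : tot E -> tot E -> C).
Hypotheses (hh0 : hermitian_metric h0) (hh1 : hermitian_metric h1).

Lemma gram_change h (hh : hermitian_metric h) j l x : fdom j x -> fdom l x ->
  gram h j x = trans_mx j l x *m gram h l x *m (trans_mx j l x) ^t*.
Proof.
move=> jx lx; apply/matrixP => a b;
  rewrite mxE (frame_change _ jx lx) [X in h _ X](frame_change _ jx lx).
rewrite (metric_gram hh) // -!rowE -row_mul !mxE; apply: eq_bigr => c _; by rewrite !mxE.
Qed.

Lemma comparison_gram j x : fdom j x -> comparison h0 h1 j x *m gram h0 j x = gram h1 j x.
Proof.
by move=> jx; rewrite /comparison adjinvE ?(gram_unit hh0) // mulmxKV // (gram_unit hh0).
Qed.

(** Both sides agree after multiplication by the invertible matrices G0l and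
    T'. *)
Lemma quotient_congr (Kj Kl T T' G0j G0l G1j G1l : 'M[C]_r) :
  T' \in unitmx -> G0l \in unitmx -> Kj *m G0j = G1j -> Kl *m G0l = G1l ->
  G0j = T *m G0l *m T' -> G1j = T *m G1l *m T' -> Kj *m T = T *m Kl.
Proof.
move=> T'u Gu <- <- ->; rewrite !mulmxA => H.
by apply: (can_inj (mulmxK Gu)); apply: (can_inj (mulmxK T'u)).
Qed.

Lemma comparison_change j l x : fdom j x -> fdom l x ->
  comparison h0 h1 j x *m trans_mx j l x = trans_mx j l x *m comparison h0 h1 l x.
Proof.
move=> jx lx; have Tu := trans_mx_unit jx lx.
have Tu' : (trans_mx j l x) ^t* \in unitmx by rewrite map_unitmx unitmx_tr.
exact: (quotient_congr Tu' (gram_unit hh0 lx) (comparison_gram jx) (comparison_gram lx)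
  (gram_change hh0 jx lx) (gram_change hh1 jx lx)).
Qed.

Lemma trace_similar (Kj Kl T : 'M[C]_r) :
  T \in unitmx -> Kj *m T = T *m Kl -> \tr Kj = \tr Kl.
Proof.
by move=> Tu KT; rewrite -(mulmxK Tu Kj) KT mxtrace_mulC mulKmx.
Qed.

Lemma tr_comparison_change j l x : fdom j x -> fdom l x ->
  \tr (comparison h0 h1 j x) = \tr (comparison h0 h1 l x).
Proof.
move=> jx lx; have Tu := trans_mx_unit jx lx.
exact: trace_similar Tu (comparison_change jx lx).
Qed.

(** A choice of frame at each point, used to define global objects from frame
    independent expressions. *)
Definition frame_at (x : X) : fidx E := projT1 (cid (fdom_cover E x)).

Lemma frame_atP x : fdom (frame_at x) x.
Proof. exact: projT2 (cid (fdom_cover E x)). Qed.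

Definition tr_ratio (x : X) : R := complex.Re (\tr (comparison h0 h1 (frame_at x) x)).

Lemma tr_ratioE j x : fdom j x -> tr_ratio x = complex.Re (\tr (comparison h0 h1 j x)).
Proof. by move=> jx; exact: congr1 (tr_comparison_change (frame_atP x) jx). Qed.

Lemma near_fdom (j : fidx E) x : fdom j x -> nbhs x (fdom j).
Proof. by move=> jx; apply: open_nbhs_nbhs; split => //; exact: fdom_open. Qed.

Lemma comparison_continuous (i : cidx M) j x a b : cdom i x -> fdom j x ->
  {for x, continuous (fun y => comparison h0 h1 j y a b : C^o)}.
Proof.
move=> ix jx.
pose P (g : X -> C) := {for x, continuous (g : X -> C^o)}.
have Pc c : P (fun=> c) by exact: cst_continuous.
have Pa f g : P f -> P g -> P (fun s => f s + g s).
  by move=> fc gc; exact: ncontinuousD fc gc.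
have Pm f g : P f -> P g -> P (fun s => f s * g s).
  by move=> fc gc; exact: ncontinuousM fc gc.
have Pg h (hh : hermitian_metric h) c d : P (fun y => gram h j y c d).
  by have [] := gram_C1 hh c d ix jx.
have Pdet := fdet_closed Pc Pa Pm (Pg h0 hh0).
have PV : P (fun y => (\det (gram h0 j y))^-1).
  apply: (ncontinuousV _ Pdet).
  by rewrite -unitfE -unitmxE; exact: gram_unit.
apply: (fmulmx_closed Pc Pa Pm); first exact: Pg.
move=> c d; rewrite (_ : (fun y => _) = fun y => (\det (gram h0 j y))^-1 * \adj (gram h0 j y) c d).
  exact: (Pm _ _ PV (fadj_closed Pc Pa Pm c d (Pg h0 hh0))).
by apply/funext => y; rewrite adjinv_entry.
Qed.

Lemma tr_ratio_continuous : continuous tr_ratio.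
Proof.
move=> x; have [i ix] := cdom_cover M x; have jx := frame_atP x; set j := frame_at x in jx.
pose P (g : X -> C) := {for x, continuous (g : X -> C^o)}.
have Pc c : P (fun=> c) by exact: cst_continuous.
have Pa f g : P f -> P g -> P (fun s => f s + g s).
  by move=> fc gc; exact: ncontinuousD fc gc.
have trc : P (fun y => \tr (comparison h0 h1 j y)).
  apply: (@fsum_closed _ _ P Pc Pa _ _ xpredT (fun a y => comparison h0 h1 j y a a)) => a.
  exact: (comparison_continuous ix jx).
have rc : {for x, continuous (fun y => complex.Re (\tr (comparison h0 h1 j y)))}.
  by apply: (@continuous_comp _ C^o _ _ (@complex.Re R)); [exact: trc|exact: Re_continuous].
rewrite /continuous_at (tr_ratioE jx); apply: cvg_trans rc.
by apply: near_eq_cvg; apply: filterS (near_fdom jx) => y jy; rewrite (tr_ratioE jy).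
Qed.

End FrameChange.

(** * Local bounds for the Kaehler metric *)

Section FormBounds.
Variables (R : realType) (n : nat).
Local Notation C := R[i].

(** A norm on matrices that is visibly continuous in the entries. *)
Definition entry_sum (N : 'M[C]_n) : R :=
  \sum_a \sum_b (`|complex.Re (N a b)| + `|complex.Im (N a b)|).

Lemma entry_sum_ge0 N : 0 <= entry_sum N.
Proof. by apply: sumr_ge0 => a _; apply: sumr_ge0 => b _; rewrite addr_ge0. Qed.

Lemma form_bound (N : 'M[C]_n) (u : 'rV[C]_n) :
  `|complex.Re ((u *m N *m u ^t*) 0 0)| <= entry_sum N * edot u u.
Proof.
have -> : (u *m N *m u ^t*) 0 0 = \sum_a \sum_b u 0 a * N a b * (u 0 b)^*.
  rewrite mxE exchange_big; apply: eq_bigr => b _; rewrite !mxE big_distrl.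
  by apply: eq_bigr => a _.
rewrite Re_sum (le_trans (ler_norm_sum _ _ _)) // mulr_suml ler_sum // => a _.
rewrite Re_sum (le_trans (ler_norm_sum _ _ _)) // mulr_suml ler_sum // => b _.
have := edot_coord u a; have := edot_coord u b.
case: (u 0 a) => p q; case: (u 0 b) => p' q'; case: (N a b) => s t /=.
set e := edot u u => h1 h2.
have z1 : `|p * p' + q * q'| <= e.
  rewrite ler_norml; apply/andP; split.
    have := sqr_ge0 (p + p'); have := sqr_ge0 (q + q'); nra.
  have := sqr_ge0 (p - p'); have := sqr_ge0 (q - q'); nra.
have z2 : `|q * p' - p * q'| <= e.
  rewrite ler_norml; apply/andP; split.
    have := sqr_ge0 (p - q'); have := sqr_ge0 (q + p'); nra.
  have := sqr_ge0 (p + q'); have := sqr_ge0 (q - p'); nra.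
have -> : (p * s - q * t) * p' - (p * t + q * s) * - q' =
   s * (p * p' + q * q') - t * (q * p' - p * q') by ring.
apply: (le_trans (ler_normB _ _)); rewrite !normrM mulrDl lerD //; exact: ler_wpM2l.
Qed.

Lemma edot_mx (u : 'rV[C]_n) : edot u u = complex.Re ((u *m u ^t*) 0 0).
Proof.
rewrite mxE Re_sum; apply: eq_bigr => a _; rewrite !mxE.
by case: (u 0 a) => p q /=; ring.
Qed.

(** In the coordinates w = u P^-1 the form is |w|^2, and |u|^2 is the form of
    matrix P P^* evaluated at w. *)
Lemma posdef_lower (G : 'M[C]_n) P : P \in unitmx -> P *m G *m P ^t* = 1%:M ->
  exists2 c : R, 0 < c & forall u, c * edot u u <= complex.Re ((u *m G *m u ^t*) 0 0).
Proof.
move=> Pu PE; pose B := entry_sum (P *m P ^t*) + 1.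
have B0 : 0 < B by rewrite ltr_wpDl // entry_sum_ge0.
exists B^-1 => [|u]; first by rewrite invr_gt0.
rewrite mulrC ler_pdivrMr //.
pose w := u *m invmx P; have uE : u = w *m P by rewrite /w mulmxKV.
have wG : (u *m G *m u ^t*) = w *m w ^t*.
  rewrite uE trmx_mul map_mxM /= !mulmxA -[w *m P *m G]mulmxA -[w *m (P *m G) *m _]mulmxA PE.
  by rewrite mulmx1.
have uu : u *m u ^t* = w *m (P *m P ^t*) *m w ^t*.
  by rewrite uE trmx_mul map_mxM /= !mulmxA.
rewrite wG -edot_mx edot_mx uu.
have := form_bound (P *m P ^t*) w; have := edot_ge0 w.
have := ler_norm (complex.Re ((w *m (P *m P ^t*) *m w ^t*) 0 0)).
rewrite /B; lra.
Qed.

End FormBounds.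

Section MetricBounds.
Variables (R : realType) (X : topologicalType) (n : nat) (M : complex_atlas R X n).
Variables (om : kahler_form M) (i : cidx M).
Local Notation C := R[i].
Local Notation kg := (fun y => kgram (kform om i y)).

Lemma kform_gram y u : cdom i y ->
  kform om i y u ('i%C *: u) = complex.Re ((u *m kg y *m u ^t*) 0 0).
Proof.
move=> iy; rewrite -khermE //.
- by move=> a u1 u2 w; exact: kform_linear.
- by move=> u1 w; exact: kform_antisym.
- by move=> u1 w; exact: kform_J.
Qed.

Lemma kform_kframe y : cdom i y ->
  exists2 P : 'M[C]_n, P \in unitmx & kframe (kform om i y) (fun a => row a P).
Proof.
move=> iy; apply: kframe_exists.
- by move=> a u1 u2 w; exact: kform_linear.
- by move=> u1 w; exact: kform_antisym.
- by move=> u1 w; exact: kform_J.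
- by move=> u; exact: kform_pos.
Qed.

Lemma kframe_gram y P : cdom i y -> kframe (kform om i y) (fun a => row a P) ->
  P *m kg y *m P ^t* = 1%:M.
Proof.
move=> iy kP; apply/matrixP => a b; have := kP a b; rewrite khermE.
- rewrite -row_mul !mxE => <-; apply: eq_bigr => c _; by rewrite !mxE.
- by move=> c u1 u2 w; exact: kform_linear.
- by move=> u1 w; exact: kform_antisym.
- by move=> u1 w; exact: kform_J.
Qed.

Lemma kform_continuous y u w : cdom i y -> {for y, continuous (fun x => kform om i x u w)}.
Proof.
move=> iy.
have [kc _ _ _] := smooth_C1 (cdom_open i) (kform_smooth om i u w) iy iy.
by apply: (@continuous_comp _ C^o _ (fun x => (kform om i x u w)%:C) (@complex.Re R));
  [exact: kc|exact: Re_continuous].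
Qed.

(** The bounds hold at x0, and near x0 the Gram matrix differs from its value
    there by at most c / 2 in the norm [entry_sum]. *)
Lemma metric_bounds x0 : cdom i x0 -> exists c D : R, [/\ 0 < c, 0 < D &
  \forall y \near x0, forall u, c * edot u u <= kform om i y u ('i%C *: u) <= D * edot u u].
Proof.
move=> ix.
have [P Pu kP] := kform_kframe ix.
have [c c0 cP] := posdef_lower Pu (kframe_gram ix kP).
pose dev y : R := entry_sum (kg y - kg x0).
have devc : {for x0, continuous dev}.
  pose Q (g : X -> R) := {for x0, continuous g}.
  have Qc d : Q (fun=> d) by exact: cst_continuous.
  have Qa f g : Q f -> Q g -> Q (fun s => f s + g s) by move=> fc gc; exact: cvgD fc gc.
  have Qn g : Q g -> Q (fun s => `|g s|).
    by move=> gc; apply: (@continuous_comp _ _ _ g (fun t : R => `|t|)) => //;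
      exact: norm_continuous.
  have Qk u w : Q (fun y => kform om i y u w) by exact: kform_continuous ix.
  apply: (@fsum_closed _ _ Q Qc Qa _ _ xpredT (fun a y => \sum_b _)) => a.
  apply: (@fsum_closed _ _ Q Qc Qa _ _ xpredT (fun b y => _)) => b.
  apply: (Qa (fun y => `|complex.Re ((kg y - kg x0) a b)|)
    (fun y => `|complex.Im ((kg y - kg x0) a b)|)).
    apply: (Qn (fun y => complex.Re ((kg y - kg x0) a b))).
    rewrite (_ : (fun y => _) = fun y =>
      kform om i y (delta_mx 0 a) ('i%C *: delta_mx 0 b) + - complex.Re (kg x0 a b)).
      by apply: Qa => //; exact: Qk.
    by apply/funext => y; rewrite !mxE.
  apply: (Qn (fun y => complex.Im ((kg y - kg x0) a b))).
  rewrite (_ : (fun y => _) = fun y =>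
    -1 * kform om i y (delta_mx 0 a) (delta_mx 0 b) + - complex.Im (kg x0 a b)).
    by apply: Qa => //; apply: cvgM; [exact: Qc|exact: Qk].
  by apply/funext => y; rewrite !mxE /= mulN1r.
have dev0 : dev x0 < c / 2.
  rewrite /dev subrr /entry_sum big1 ?divr_gt0 // => a _; rewrite big1 // => b _.
  by rewrite mxE /= !normr0 addr0.
have near_dev : \forall y \near x0, dev y < c / 2 by exact: (cvgr_lt _ devc _ dev0).
exists (c / 2), (entry_sum (kg x0) + c); split; first by rewrite divr_gt0.
  by rewrite ltr_wpDl // entry_sum_ge0.
apply: filterS2 near_dev (near_cdom ix) => y ydev iy u.
rewrite kform_gram //.
have -> : u *m kg y *m u ^t* = u *m kg x0 *m u ^t* + u *m (kg y - kg x0) *m u ^t*.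
  by rewrite -mulmxDl -mulmxDr addrC subrK.
rewrite mxE Re_add; have := cP u.
have := form_bound (kg x0) u; have := form_bound (kg y - kg x0) u; rewrite -/(dev y).
set p := complex.Re _; set q := complex.Re _; set e := edot u u.
have e0 : 0 <= e by exact: edot_ge0.
have : dev y * e <= c / 2 * e by rewrite ler_wpM2r // ltW.
rewrite !ler_norml => H1 /andP[H2 H3] /andP[H4 H5] H6.
apply/andP; split; first by lra.
rewrite mulrDl; have : 0 <= c * e by rewrite mulr_ge0 // ltW.
lra.
Qed.

End MetricBounds.

(** * Uniform ellipticity *)

Section Ellipticity.
Variables (R : realType) (X : topologicalType) (n k : nat) (M : complex_atlas R X n).
Variables (om : kahler_form M) (T : torus_action M k) (i : cidx M).
Variables (mu : X -> 'rV[R]_k) (mu_moment : moment_map om T mu).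
Variables (v : 'rV[R]_k -> R) (v_weight : polytope_weight (moment_polytope mu) v).
Local Notation C := R[i].

Definition dmu (b : 'I_k) (u : 'rV[C]_n) (y : X) : R :=
  complex.Re (dX i (fun x => (mu x 0 b)%:C) y u).

Lemma mu_C1 b y : cdom i y -> C1at i (fun x => (mu x 0 b)%:C) y.
Proof.
by move=> iy; case: mu_moment => mus _ _; exact: (smooth_C1 openT (mus b) iy I).
Qed.

Lemma dmu_sum b u y : cdom i y ->
  dmu b u y = \sum_p rcoord u p * dmu b (@real_basis R n p) y.
Proof.
move=> iy; have [_ _ _ lin] := mu_C1 b iy.
have lin0 : dX i (fun x => (mu x 0 b)%:C) y 0 = 0.
  by have := lin (-1) 0 0; rewrite scaler0 addr0 rmorphN1 mulN1r addNr.
have L I (s : seq I) (c : I -> R) (w : I -> 'rV[C]_n) :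
    dX i (fun x => (mu x 0 b)%:C) y (\sum_(p <- s) (c p)%:C *: w p) =
    \sum_(p <- s) (c p)%:C * dX i (fun x => (mu x 0 b)%:C) y (w p).
  elim: s => [|p s IH]; first by rewrite !big_nil.
  by rewrite !big_cons lin IH.
rewrite /dmu {1}(rcoord_sum u) L Re_sum; apply: eq_bigr => p _.
by rewrite Re_mul /= mul0r subr0.
Qed.

Lemma kform_vecfield xi u y : cdom i y ->
  kform om i y u (vecfield T i xi y) = \sum_b xi 0 b * dmu b u y.
Proof.
move=> iy; case: mu_moment => _ _ /(_ i y u xi iy) mE; apply: complexI; rewrite -mE.
have d b := let: And4 _ d _ _ := mu_C1 b iy in d u.
have := has_cderiv_sum (index_enum 'I_k) (fun b => has_cderiv_scale (xi 0 b)%:C (d b)).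
move=> H.
have -> : dX i (fun x => (pairing (mu x) xi)%:C) y u =
    \sum_b (xi 0 b)%:C * dX i (fun x => (mu x 0 b)%:C) y u.
  apply: has_dXE; apply: has_cderiv_ext H => t.
  by rewrite /pairing rmorph_sum; apply: eq_bigr => b _; rewrite rmorphM mulrC.
rewrite rmorph_sum; apply: eq_bigr => b _; rewrite rmorphM; congr (_ * _).
have d0 : is_derive (0 : R) (1 : R) (fun=> 0 : R) (0 : R) by exact: is_derive_cst.
have imE : complex.Im (dX i (fun x => (mu x 0 b)%:C) y u) = 0.
  case: (d b) => _ dim.
  by rewrite -(@derive_val _ _ _ _ _ _ _ dim); exact: (@derive_val _ _ _ _ _ _ _ d0).
by rewrite [LHS]complexE imE rmorph0 mulr0 addr0.
Qed.

Lemma rcoord_le (u : 'rV[C]_n) p : `|rcoord u p| <= Num.sqrt (edot u u).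
Proof.
rewrite -sqrtr_sqr ler_sqrt ?edot_ge0 //.
rewrite /rcoord; case: (fintype.split p) => a; have := edot_coord u a.
  have := sqr_ge0 (complex.Im (u 0 a)); lra.
have := sqr_ge0 (complex.Re (u 0 a)); lra.
Qed.

Lemma mu_continuous x0 : cdom i x0 -> {for x0, continuous mu}.
Proof.
move=> ix; apply: continuous_mx => a b.
have [mc _ _ _] := mu_C1 b ix.
rewrite (ord1 a); apply: (@continuous_comp _ C^o _ (fun x => (mu x 0 b)%:C) (@complex.Re R));
  [exact: mc|exact: Re_continuous].
Qed.

Lemma dweight_continuous b x0 : cdom i x0 ->
  {for x0, continuous (fun y => dweight v (mu y) 0 b)}.
Proof.
move=> ix; case: v_weight => -[U [_ PU vU]] _.
have [_ /(_ (delta_mx 0 b))[_ [vc _]]] := vU 1%N.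
rewrite (_ : (fun y => _) = fun y => 'D_(delta_mx 0 b : 'rV[R]_k) v (mu y)).
  apply: (@continuous_comp _ _ _ mu (fun p => 'D_(delta_mx 0 b : 'rV[R]_k) v p)).
    exact: mu_continuous.
  by apply: vc; apply: PU; exists x0.
by apply/funext => y; rewrite mxE.
Qed.

Lemma weight_continuous x0 : cdom i x0 -> {for x0, continuous (fun y => v (mu y))}.
Proof.
move=> ix; case: v_weight => -[U [_ PU vU]] _.
have [vc _] := vU 0%N.
apply: (@continuous_comp _ _ _ mu v); first exact: mu_continuous.
by apply: vc; apply: PU; exists x0.
Qed.

Lemma weight_gt0 y : 0 < v (mu y).
Proof. by case: v_weight => _; apply; exists y. Qed.

(** The moment map equation gives g (V, V) = - d<mu, xi>(i V) with xi =
    dv(mu), which is at most a constant times |V|; and g (V, V) >= c |V|^2. *)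
Lemma vecfield_bound x0 : cdom i x0 -> exists2 K : R, 0 < K &
  \forall y \near x0, edot (vecfield T i (dweight v (mu y)) y) (vecfield T i (dweight v (mu y)) y)
    <= K * v (mu y) ^+ 2.
Proof.
move=> ix; have [c [D [c0 D0 cD]]] := metric_bounds om ix.
pose B y : R := \sum_b \sum_p (`|dweight v (mu y) 0 b| * `|dmu b (@real_basis R n p) y|).
have Bc : {for x0, continuous B}.
  pose Q (g : X -> R) := {for x0, continuous g}.
  have Qc d : Q (fun=> d) by exact: cst_continuous.
  have Qa f g : Q f -> Q g -> Q (fun s => f s + g s) by move=> fc gc; exact: cvgD fc gc.
  have Qn g : Q g -> Q (fun s => `|g s|).
    by move=> gc; apply: (@continuous_comp _ _ _ g (fun t : R => `|t|)) => //;
      exact: norm_continuous.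
  apply: (@fsum_closed _ _ Q Qc Qa _ _ xpredT (fun b y => \sum_p _)) => b.
  apply: (@fsum_closed _ _ Q Qc Qa _ _ xpredT (fun p y => _)) => p.
  have q1 : Q (fun y => `|dweight v (mu y) 0 b|) by apply: Qn; exact: dweight_continuous.
  have q2 : Q (fun y => `|dmu b (@real_basis R n p) y|).
    apply: (Qn (fun y => dmu b (@real_basis R n p) y)).
    have [_ _ dc _] := mu_C1 b ix.
    by apply: (@continuous_comp _ C^o _
      (fun x => dX i (fun x => (mu x 0 b)%:C) x (@real_basis R n p)) (@complex.Re R));
      [exact: dc|exact: Re_continuous].
  exact: cvgM q1 q2.
have nB : \forall y \near x0, B y < B x0 + 1 by apply: (cvgr_lt _ Bc); rewrite ltrDl.
have vx0 := weight_gt0 x0.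
have v2 : v (mu x0) / 2 < v (mu x0) by lra.
have nv : \forall y \near x0, v (mu x0) / 2 < v (mu y)
  by exact: (cvgr_gt _ (weight_continuous ix) _ v2).
have B0 : 0 <= B x0 by apply: sumr_ge0 => b _; apply: sumr_ge0 => p _; rewrite mulr_ge0.
set B1 := B x0 + 1 in nB; have B10 : 0 < B1 by rewrite /B1 ltr_wpDl.
set v1 := v (mu x0) / 2 in nv; have v10 : 0 < v1 by rewrite /v1 divr_gt0.
exists ((B1 / c) ^+ 2 / v1 ^+ 2); first by rewrite divr_gt0 ?exprn_gt0 // divr_gt0.
apply: filterS2 (filterI nB nv) (filterI cD (near_cdom ix)) => y [By vy] [cDy iy].
set V := vecfield T i _ y.
have /andP[cV _] := cDy V.
have e0 := edot_ge0 V.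
set r := Num.sqrt (edot V V); have r2 : r ^+ 2 = edot V V by rewrite sqr_sqrtr.
have r0 : 0 <= r by exact: sqrtr_ge0.
have VB : kform om i y V ('i%C *: V) <= B y * r.
  have J u w : kform om i y ('i%C *: u) w = - kform om i y u ('i%C *: w).
    apply: om_Jl.
    - by move=> a u1 u2 w'; exact: kform_linear.
    - by move=> u1 w'; exact: kform_antisym.
    - by move=> u1 w'; exact: kform_J.
  have -> : kform om i y V ('i%C *: V) = - kform om i y ('i%C *: V) V by rewrite J opprK.
  rewrite {2}/V kform_vecfield // (le_trans (ler_norm _)) // normrN.
  rewrite (le_trans (ler_norm_sum _ _ _)) // /B mulr_suml ler_sum // => b _.
  rewrite dmu_sum // normrM mulr_suml.
  apply: (le_trans (ler_wpM2l (normr_ge0 _) (ler_norm_sum _ _ _))).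
  rewrite mulr_sumr ler_sum // => p _; rewrite normrM -mulrA ler_wpM2l // mulrC ler_wpM2l //.
  by apply: (le_trans (rcoord_le _ _)); rewrite edotJ.
have rB : c * r <= B1.
  have [->|rn0] := eqVneq r 0; first by rewrite mulr0 ltW.
  have rpos : 0 < r by rewrite lt0r rn0.
  rewrite -(ler_pM2r rpos) -mulrA -expr2 r2; apply: (le_trans cV); apply: (le_trans VB).
  by rewrite ler_pM2r // ltW.
have rBc : r <= B1 / c by rewrite ler_pdivlMr // mulrC.
rewrite -r2 mulrAC ler_pdivlMr ?exprn_gt0 // ler_pM ?sqr_ge0 //.
  by rewrite lerXn2r // nnegrE ltW // divr_gt0.
by rewrite lerXn2r // ?nnegrE ltW // (lt_trans v10).
Qed.

Lemma edot_sumr I (s : seq I) (w : I -> 'rV[C]_n) z :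
  edot z (\sum_(a <- s) w a) = \sum_(a <- s) edot z (w a).
Proof.
elim: s => [|a s IH]; last by rewrite !big_cons edotDr IH.
by rewrite !big_nil /edot big1 // => a _; rewrite mxE /= !mulr0 addr0.
Qed.

(** For the first bound write z = sum_a t_a e_a, so that |t|^2 = g (z, z) <= D
    |z|^2, and expand one factor of <z, z>. *)
Lemma kahler_elliptic x0 : cdom i x0 -> exists2 K : R, 0 < K &
  \forall y \near x0, exists2 P : 'M[C]_n, kframe (kform om i y) (fun a => row a P) &
   [/\ forall z, edot z z <= K * \sum_a (edot z (row a P) ^+ 2 + edot z ('i%C *: row a P) ^+ 2),
       \sum_a edot (row a P) (row a P) <= K &
       edot (vecfield T i (dweight v (mu y)) y) (vecfield T i (dweight v (mu y)) y)
         <= K * v (mu y) ^+ 2].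
Proof.
move=> ix; have [c [D [c0 D0 cD]]] := metric_bounds om ix.
have [K1 K10 nK1] := vecfield_bound ix.
have nc0 : 0 <= n%:R / c :> R by rewrite divr_ge0 // ltW.
exists (D + n%:R / c + K1); first by lra.
apply: filterS2 (filterI nK1 cD) (near_cdom ix) => y [VK cDy] iy.
have [P Pu kP] := kform_kframe om iy; exists P => //; split.
- move=> z; set S := \sum_a _.
  have S0 : 0 <= S by apply: sumr_ge0 => a _; rewrite addr_ge0 ?sqr_ge0.
  suff : edot z z <= D * S.
    move=> H; apply: (le_trans H); rewrite ler_wpM2r //; lra.
  pose t := z *m invmx P; have zE : z = t *m P by rewrite /t mulmxKV.
  have tt : edot t t <= D * edot z z.
    have /andP[_] := cDy z; rewrite kform_gram // {1 2}zE trmx_mul map_mxM /= !mulmxA.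
    rewrite -[t *m P *m _]mulmxA -[t *m (P *m _) *m _]mulmxA (kframe_gram iy kP) mulmx1.
    by rewrite -edot_mx.
  have zz : 2 * edot z z <= edot t t / D + D * S.
    rewrite {2}zE mulmx_sum_row edot_sumr mulr_sumr mulr_suml mulr_sumr -big_split /=.
    apply: ler_sum => a _; rewrite complexZ edotDr !edotZr -!expr2.
    set p := complex.Re _; set q := complex.Im _; set al := edot z _; set be := edot z _.
    have h1 := sqr_ge0 (p - D * al); have h2 := sqr_ge0 (q - D * be).
    rewrite -(ler_pM2r D0).
    rewrite [X in _ <= X](_ : _ = (p ^+ 2 + q ^+ 2) + D ^+ 2 * al ^+ 2 + D ^+ 2 * be ^+ 2);
      last first.
      by field; rewrite gt_eqF.
    rewrite [X in X <= _](_ : _ = 2 * (p * (D * al)) + 2 * (q * (D * be))); last by ring.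
    move: h1 h2; rewrite !sqrrB !exprMn; lra.
  have : edot t t / D <= edot z z by rewrite ler_pdivrMr // mulrC.
  lra.
- have row_le a : edot (row a P) (row a P) <= c^-1.
    have /andP[H _] := cDy (row a P).
    have : kform om i y (row a P) ('i%C *: row a P) = 1.
      by have /(congr1 (@complex.Re R)) := kP a a; rewrite eqxx.
    by move=> e; rewrite e in H; rewrite -[c^-1]mul1r ler_pdivlMr // mulrC.
  apply: (@le_trans _ _ (\sum_(a < n) c^-1)); first exact: ler_sum.
  rewrite sumr_const card_ord -[c^-1 *+ n]mulr_natl; lra.
apply: (le_trans VK); rewrite ler_wpM2r ?sqr_ge0 //; lra.
Qed.

End Ellipticity.

(** * A criterion of complex differentiability *)

Section HolomorphyCriterion.
Variables (R : realType) (n : nat).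
Local Notation C := R[i].
Local Notation V := 'rV[C^o]_n.

Lemma coord_norm_le (u : V) a : `|u 0 a| <= `|u|.
Proof.
change (`|u 0 a| <= mx_norm u); rewrite mx_normE -[leLHS]nngE num_le.
exact: (le_bigmax _ (fun ij : 'I_1 * 'I_n => `|u ij.1 ij.2|%:nng) (0, a)).
Qed.

Lemma differentiable_flat (h : V -> C^o) (z0 : V) :
  (forall eps : C, 0 < eps -> \forall k \near (0 : V), `|h (k + z0) - h z0| <= eps * `|k|) ->
  differentiable h z0.
Proof.
move=> H.
have c0 : continuous (\0 : V -> C^o) by move=> z; exact: cst_continuous.
have E : h \o shift z0 = cst (h z0) + (\0 : V -> C^o) +o_ (0 : V) id.
  apply/eqaddoP => eps eps0; apply: filterS (H eps eps0) => k /=.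
  by rewrite !fctE /= addr0.
apply/diff_locallyP; rewrite (diff_unique (df := \0) c0 E); split => //.
Qed.

Lemma has_cderiv_at_line (F : V -> C) (z k : V) (s : R) l :
  has_cderiv (fun t => F (z + s%:C *: k + t%:C *: k)) 0 l ->
  has_cderiv (fun t => F (z + t%:C *: k)) s l.
Proof.
have shift_line (g : R -> R) d : is_derive (0 : R) 1 (fun t : R => g (s + t)) d ->
  is_derive s 1 g d.
  move=> H; have -> : s = s + 0 *: (1 : R) by rewrite scale0r addr0.
  apply/is_derive_line; move: H; congr (is_derive _ _ _ _).
  by apply/funext => t; rewrite [t *: 1]mulr1.
have E t : z + s%:C *: k + t%:C *: k = z + (s + t)%:C *: k.
  by rewrite rmorphD scalerDl addrA.
by case=> dr di; split; apply: shift_line; under eq_fun do rewrite -E.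
Qed.

(** The partial derivatives d_a enter through sum_a u_a d_a, which is complex
    linear in u: these are the Cauchy-Riemann equations. After subtracting the
    differential at z0, the mean value theorem along segments, applied to the
    real and imaginary parts, bounds the remainder by the variation of the
    d_a, which is small by continuity. *)
Lemma holo_differentiable (F : V -> C) (z0 : V) (d : 'I_n -> V -> C) :
  (\forall z \near z0, forall u : V,
    has_cderiv (fun t => F (z + t%:C *: u)) 0 (\sum_a u 0 a * d a z)) ->
  (forall a, {for z0, continuous (d a : V -> C^o)}) ->
  differentiable (F : V -> C^o) z0.
Proof.
move=> Fd dc.
pose g (z : V) : C^o := \sum_a (z 0 a *: (d a z0 : C^o)).
have gdiff : differentiable g z0.
  rewrite (_ : g = \sum_a (fun z : V => z 0 a *: (d a z0 : C^o))).
    apply: differentiable_sum => a; apply: differentiableZl.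
    exact: differentiable_coord.
  by apply/funext => z; rewrite /g fct_sumE.
pose h (z : V) : C^o := F z - g z.
suff hdiff : differentiable h z0.
  rewrite (_ : F = h + g); first exact: differentiableD.
  by apply/funext => z; rewrite !fctE /h subrK.
apply: differentiable_flat => eps eps0.
(* The real and the imaginary part are each bounded by n eta |k|. *)
pose eta : C := eps / (2 * n.+1%:R).
have eta0 : 0 < eta by rewrite divr_gt0 // mulr_gt0 // ltr0Sn.
have nd : \forall z \near z0, forall a, `|(d a z0 : C^o) - d a z| < eta.
  apply: (@filter_forall V 'I_n (fun a z => `|(d a z0 : C^o) - d a z| < eta) (nbhs z0) _) => a.
  exact: (cvgrPdist_lt _ _).1 (dc a) _ eta0.
have [e /= e0 eP] := (nbhs_ballP _ _).1 (filterI Fd nd).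
apply/nbhs_ballP; exists e => //= k.
rewrite -ball_normE /ball_ /= sub0r normrN => ke.
have inP s : 0 <= s <= 1 -> ball z0 e (z0 + s%:C *: k).
  move=> /andP[s0 s1]; rewrite -ball_normE /ball_ /= opprD addNKr normrN normrZ.
  apply: le_lt_trans ke; rewrite ler_piMl // ger0_norm ?ler0c //.
  by rewrite -(rmorph1 (real_complex R)) lecR.
pose h' (z : V) := \sum_a k 0 a * (d a z - d a z0).
have hd s : 0 <= s <= 1 -> has_cderiv (fun t => h (z0 + t%:C *: k)) s (h' (z0 + s%:C *: k)).
  move=> s01; apply: (@has_cderiv_at_line h).
  have [FP _] := eP _ (inP s s01).
  have gP : has_cderiv (fun t => g (z0 + s%:C *: k + t%:C *: k)) 0 (\sum_a k 0 a * d a z0).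
    have id' : has_cderiv (fun t : R => t%:C) 0 1 by split;
      [exact: is_derive_id|exact: is_derive_cst].
    have := has_cderivD (has_cderiv_cst (g (z0 + s%:C *: k)) 0)
       (has_cderiv_scale (\sum_a k 0 a * d a z0) id').
    rewrite add0r mulr1; apply: has_cderiv_ext => t.
    rewrite /g mulr_suml -big_split; apply: eq_bigr => a _ /=.
    by rewrite !mxE /GRing.scale /=; ring.
  have := has_cderivB (FP k) gP; congr (has_cderiv _ _ _).
  by rewrite /h' -sumrB; apply: eq_bigr => a _; rewrite mulrBr.
have h'le s : 0 <= s <= 1 -> `|h' (z0 + s%:C *: k)| <= eps / 2 * `|k|.
  move=> s01; have [_ dP] := eP _ (inP s s01).
  rewrite /h' (le_trans (ler_norm_sum _ _ _)) //.
  apply: (@le_trans _ _ (\sum_(a < n) (`|k| * eta))).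
    apply: ler_sum => a _; rewrite normrM ler_pM //; first exact: coord_norm_le.
    by rewrite distrC ltW // dP.
  have -> : \sum_(a < n) (`|k| * eta) = n%:R * eta * `|k|.
    by rewrite sumr_const card_ord -[RHS]mulrA mulr_natl mulrC.
  apply: ler_wpM2r => //.
  have -> : eps / 2 = n.+1%:R * eta.
    have N0 : n.+1%:R != 0 :> C by rewrite pnatr_eq0.
    by rewrite /eta; move: (n.+1%:R : C) N0 => N N0; field.
  by apply: ler_wpM2r; [exact: ltW|rewrite ler_nat].
have [||cr crP HR] := @mvt_closed R (fun t => complex.Re (h (z0 + t%:C *: k)))
   (fun t => complex.Re (h' (z0 + t%:C *: k))) 0 1.
- exact: ltr01.
- by move=> t t01; have [] := hd t t01.
have [||ci ciP HI] := @mvt_closed R (fun t => complex.Im (h (z0 + t%:C *: k)))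
   (fun t => complex.Im (h' (z0 + t%:C *: k))) 0 1.
- exact: ltr01.
- by move=> t t01; have [] := hd t t01.
have le01 (t : R) : 0 < t < 1 -> 0 <= t <= 1 by move=> /andP[t0 t1]; rewrite !ltW.
rewrite rmorph1 scale1r rmorph0 scale0r addr0 subr0 mulr1 in HR.
rewrite rmorph1 scale1r rmorph0 scale0r addr0 subr0 mulr1 in HI.
rewrite [k + z0]addrC (le_trans (normc_ReIm _)) //.
have -> : complex.Re (h (z0 + k) - h z0) = complex.Re (h' (z0 + cr%:C *: k)).
  by rewrite -HR; case: (h (z0 + k)); case: (h z0).
have -> : complex.Im (h (z0 + k) - h z0) = complex.Im (h' (z0 + ci%:C *: k)).
  by rewrite -HI; case: (h (z0 + k)); case: (h z0).
rewrite rmorphD.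
have -> : eps * `|k| = eps / 2 * `|k| + eps / 2 * `|k| by rewrite -mulrDl -splitr.
apply: lerD.
  by apply: (le_trans (Re_normc _)); exact: (h'le _ (le01 _ crP)).
by apply: (le_trans (Im_normc _)); exact: (h'le _ (le01 _ ciP)).
Qed.

End HolomorphyCriterion.

(** * Maximum points of the trace *)

Section MaximumPoints.
Variables (R : realType) (X : topologicalType) (n k r : nat).
Variables (M : complex_atlas R X n) (om : kahler_form M) (T : torus_action M k).
Variables (mu : X -> 'rV[R]_k) (mu_moment : moment_map om T mu).
Variables (v : 'rV[R]_k -> R) (v_weight : polytope_weight (moment_polytope mu) v).
Variables (E : hol_bundle M r) (L : torus_lift E T).
Local Notation C := R[i].
Variables (h0 h1 : tot E -> tot E -> C) (A0 A1 : conn_form E).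
Hypotheses (hh0 : hermitian_metric h0) (hh1 : hermitian_metric h1).
Hypotheses (hA0 : chern_connection h0 A0) (hA1 : chern_connection h1 A1).
Variables c0 c1 : R.
Hypothesis HE0 : forall i j x, cdom i x -> fdom j x ->
  ('i%C / (2 * pi)%:C) *: weighted_contraction L om mu v A0 i j x = (c0%:C)%:M.
Hypothesis HE1 : forall i j x, cdom i x -> fdom j x ->
  ('i%C / (2 * pi)%:C) *: weighted_contraction L om mu v A1 i j x = (c1%:C)%:M.

Let f := tr_ratio h0 h1.

Definition tr_gradient (i : cidx M) j u y : R :=
  2 * complex.Re (\tr (conn_diff A0 A1 i j u y *m comparison h0 h1 j y)).

Lemma tr_ratio_deriv (i : cidx M) j u y : cdom i y -> fdom j y ->
  is_derive (0 : R) 1 (fun t : R => f (chart_line i y u t)) (tr_gradient i j u y).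
Proof.
move=> iy jy; have [d _] := tr_comparison_has_deriv hh0 hh1 hA0 hA1 u iy jy.
apply: near_eq_is_derive d.
by apply: filterS (near_chart_line u iy (near_fdom jy)) => t [jt _];
  rewrite /f (tr_ratioE hh0 hh1 jt).
Qed.

Lemma near_dom (i : cidx M) (j : fidx E) x : cdom i x -> fdom j x -> nbhs x (cdom i `&` fdom j).
Proof. by move=> ix jx; apply: filterI; [exact: near_cdom|exact: near_fdom]. Qed.

Lemma at_maximum (i : cidx M) j x u : cdom i x -> fdom j x -> (forall y, f y <= f x) ->
  tr_gradient i j u x = 0 /\ tr_hessian h0 h1 A0 A1 i j x u u <= 0.
Proof.
move=> ix jx fmax.
have near1 : \forall y \near x,
    is_derive (0 : R) 1 (fun t : R => f (chart_line i y u t)) (tr_gradient i j u y).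
  by apply: filterS (near_dom ix jx) => y [iy jy]; exact: tr_ratio_deriv.
have d1 := is_derive_chart_line (u := u) ix near1.
have d2 := tr_comparison_has_hessian hh0 hh1 hA0 hA1 u u ix jx.
have [] := deriv_at_local_max d1 d2.
  by apply: filterS filterT => t _; rewrite chart_line0 //; exact: fmax.
by rewrite chart_line0.
Qed.

(** In [weighted_bochner] the second derivatives are nonpositive and the
    gradient vanishes. *)
Lemma bochner_at_maximum (i : cidx M) j x e : cdom i x -> fdom j x -> (forall y, f y <= f x) ->
  kframe (kform om i x) e ->
  4 * v (mu x) * \sum_a complex.Re (conn_energy h0 h1 j x (conn_diff A0 A1 i j (e a) x))
    <= 4 * pi * (c1 - c0) * f x.
Proof.
move=> ix jx fmax ke.
have B := weighted_bochner hA0 hA1 HE0 HE1 ix jx ke.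
have [g0 _] := at_maximum ('i%C *: vecfield T i (dweight v (mu x)) x) ix jx fmax.
have S0 : \sum_a (tr_hessian h0 h1 A0 A1 i j x (e a) (e a) +
    tr_hessian h0 h1 A0 A1 i j x ('i%C *: e a) ('i%C *: e a)) <= 0.
  apply: sumr_le0 => a _.
  have [_ H1] := at_maximum (e a) ix jx fmax; have [_ H2] := at_maximum ('i%C *: e a) ix jx fmax.
  by rewrite -[leRHS]addr0; exact: lerD H1 H2.
have vS : v (mu x) * \sum_a (tr_hessian h0 h1 A0 A1 i j x (e a) (e a) +
    tr_hessian h0 h1 A0 A1 i j x ('i%C *: e a) ('i%C *: e a)) <= 0.
  by rewrite pmulr_rle0 //; exact: (weight_gt0 v_weight).
have alg (a g w F : R) : a <= 0 -> a = g - F + w -> g = 0 -> w <= F.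
  by move=> *; lra.
by rewrite /f (tr_ratioE hh0 hh1 jx); exact: alg vS B g0.
Qed.

Lemma tr_ratio_gt0 x : (0 < r)%N -> 0 < f x.
Proof.
move=> r0; have := tr_comparison_gt0 hh0 hh1 r0 (frame_atP E x).
by rewrite ltcE => /andP[].
Qed.

Lemma energy_sum_ge0 (i : cidx M) j x (e : 'I_n -> 'rV[C]_n) : fdom j x ->
  0 <= \sum_a complex.Re (conn_energy h0 h1 j x (conn_diff A0 A1 i j (e a) x)).
Proof.
move=> jx; apply: sumr_ge0 => a _.
by have := conn_energy_ge0 hh0 hh1 (conn_diff A0 A1 i j (e a) x) jx; rewrite lecE => /andP[].
Qed.

(** The energy is nonnegative and f is positive. *)
Lemma HE_constant_le x : (0 < r)%N -> (forall y, f y <= f x) -> c0 <= c1.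
Proof.
move=> r0 fmax; have [i ix] := cdom_cover M x; have jx := frame_atP E x.
have [P _ ke] := kform_kframe om ix.
have := bochner_at_maximum ix jx fmax ke.
have := energy_sum_ge0 i (fun a => row a P) jx.
have vx := weight_gt0 v_weight x.
move=> S0 H; rewrite -subr_ge0 -(pmulr_lge0 _ (tr_ratio_gt0 x r0)).
have p0 : 0 < 4 * pi :> R by rewrite mulr_gt0 ?pi_gt0.
rewrite -(pmulr_rge0 _ p0) mulrA; apply: le_trans H.
by rewrite mulr_ge0 // mulr_ge0 // ltW.
Qed.

(** The energies of all the B(e_a) vanish; the e_a span, and B is complex
    linear. *)
Lemma conn_diff_at_maximum (i : cidx M) j x u : c0 = c1 -> cdom i x -> fdom j x ->
  (forall y, f y <= f x) -> conn_diff A0 A1 i j u x = 0.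
Proof.
move=> cc ix jx fmax; have [P Pu ke] := kform_kframe om ix.
have H := bochner_at_maximum ix jx fmax ke.
have vx := weight_gt0 v_weight x.
have lin z w w' : conn_diff A0 A1 i j (z *: w + w') x =
    z *: conn_diff A0 A1 i j w x + conn_diff A0 A1 i j w' x.
  by rewrite /conn_diff (chern_linC hA1) // (chern_linC hA0) // scalerBr opprD addrACA.
have e0 a : conn_diff A0 A1 i j (row a P) x = 0.
  apply: (conn_energy_eq0 hh0 hh1 jx).
  have E0 b := conn_energy_ge0 hh0 hh1 (conn_diff A0 A1 i j (row b P) x) jx.
  have Re0 b : 0 <= complex.Re (conn_energy h0 h1 j x (conn_diff A0 A1 i j (row b P) x)).
    by have := E0 b; rewrite lecE => /andP[].
  have S0 : \sum_b complex.Re (conn_energy h0 h1 j x (conn_diff A0 A1 i j (row b P) x)) <= 0.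
    rewrite -(pmulr_rle0 _ (mulr_gt0 (_ : 0 < 4) vx)) //; apply: (le_trans H).
    by rewrite cc subrr mulr0 mul0r.
  have : complex.Re (conn_energy h0 h1 j x (conn_diff A0 A1 i j (row a P) x)) = 0.
    apply/eqP; rewrite eq_le Re0 andbT; apply: le_trans S0.
    rewrite (bigD1 a) //= lerDl; apply: sumr_ge0 => b _; exact: Re0.
  have := E0 a; rewrite lecE => /andP[/eqP im0 _] re0.
  by rewrite [LHS]complexE re0 im0 !rmorph0 mulr0 addr0.
have lin0 : conn_diff A0 A1 i j 0 x = 0.
  by have := lin (-1) 0 0; rewrite scaler0 addr0 scaleN1r addNr.
have -> : u = (u *m invmx P) *m P by rewrite mulmxKV.
rewrite mulmx_sum_row; elim: (index_enum _) => [|a s IH]; first by rewrite big_nil.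
by rewrite big_cons lin e0 scaler0 add0r.
Qed.

Lemma maximum_set_open x : c0 = c1 -> (forall y, f y <= f x) ->
  \forall y \near x, f y = f x.
Proof.
move=> cc fmax; have [i ix] := cdom_cover M x; have jx := frame_atP E x.
set j := frame_at E x in jx.
have [K K0 nK] := kahler_elliptic mu_moment v_weight ix.
apply: (@strong_maximum R X n M i K f (tr_gradient i j)
   (fun u y => tr_hessian h0 h1 A0 A1 i j y u u) (f x) x) => //.
- by apply: filterS filterT => y _; exact: tr_ratio_continuous.
- by apply: filterS (near_dom ix jx) => y [iy jy] u; exact: tr_ratio_deriv.
- apply: filterS (near_dom ix jx) => y [iy jy] u.
  exact: (tr_comparison_has_hessian hh0 hh1 hA0 hA1 u u iy jy).
apply: filterS2 nK (near_dom ix jx) => y [P ke [Pz PP PV]] [iy jy].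
exists (fun a => row a P), ('i%C *: vecfield T i (dweight v (mu y)) y), (v (mu y)).
split => //; first exact: (weight_gt0 v_weight).
  by rewrite edotJ.
rewrite (weighted_bochner hA0 hA1 HE0 HE1 iy jy ke) /tr_gradient cc subrr.
rewrite mulr0 mul0r subr0 lerDl mulr_ge0 //; last exact: energy_sum_ge0.
by rewrite mulr_ge0 // ltW // (weight_gt0 v_weight).
Qed.

End MaximumPoints.

(** * The holomorphic endomorphism and the uniqueness theorem *)

Section Endomorphism.
Variables (R : realType) (X : topologicalType) (n r : nat).
Variables (M : complex_atlas R X n) (E : hol_bundle M r).
Local Notation C := R[i].
Variables (h0 h1 : tot E -> tot E -> C) (A0 A1 : conn_form E).
Hypotheses (hh0 : hermitian_metric h0) (hh1 : hermitian_metric h1).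
Hypotheses (hA0 : chern_connection h0 A0) (hA1 : chern_connection h1 A1).
Variable Z : set X.
Hypothesis Zopen : forall x, Z x -> nbhs x Z.
Hypothesis Zclosed : forall x, ~ Z x -> nbhs x (~` Z).
Hypothesis Zflat : forall (i : cidx M) (j : fidx E) x u, cdom i x -> fdom j x -> Z x ->
  conn_diff A0 A1 i j u x = 0.

(** Outside Z the (0,1) part of dK is unknown, so K is replaced there by zero; no
    discontinuity arises, Z being open and closed. *)
Definition cut_comparison j x : 'M[C]_r :=
  if `[< Z x >] then comparison h0 h1 j x else 0.

Definition comparison_endo (e : tot E) : tot E :=
  let x := bproj e in let j := frame_at E x in
  frame j x (triv j e *m cut_comparison j x).

(** The definition uses a chosen frame at each point; by [comparison_change]
    the same formula holds in all of them. *)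
Lemma triv_comparison_endo (j : fidx E) (e : tot E) : fdom j (bproj e) ->
  triv j (comparison_endo e) = triv j e *m cut_comparison j (bproj e).
Proof.
set x := bproj e => jx; rewrite /comparison_endo -/x.
have lx := frame_atP E x; set l := frame_at E x in lx *.
rewrite (triv_frame _ lx jx).
have eE : triv j e = triv l e *m trans_mx l j x.
  by rewrite -(triv_frame _ lx jx) /x (trivK lx).
rewrite eE -!mulmxA; congr (_ *m _); rewrite /cut_comparison.
case: asboolP => _; last by rewrite mul0mx mulmx0.
exact: (comparison_change hh0 hh1 lx jx).
Qed.

Lemma comparison_endo_fibmx (j : fidx E) x : fdom j x ->
  fibmx j j comparison_endo x = cut_comparison j x.
Proof.
move=> jx; apply/matrixP => a b; rewrite mxE triv_comparison_endo ?bproj_frame //.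
by rewrite frameK // -rowE mxE.
Qed.

(** Where B = 0 only the (1,0) part of dK remains. *)
Lemma comparison_deriv_flat (i : cidx M) j x u : cdom i x -> fdom j x -> Z x ->
  comparison_deriv h0 h1 A0 A1 i j x u =
  \sum_c u 0 c *: (A1 i j (delta_mx 0 c) x *m comparison h0 h1 j x
                   - comparison h0 h1 j x *m A0 i j (delta_mx 0 c) x).
Proof.
move=> ix jx Zx; rewrite /comparison_deriv (Zflat _ ix jx Zx).
rewrite (chern_sum hA1 u ix jx) (chern_sum hA0 u ix jx).
have -> : (0 : 'M[C]_r) ^t* = 0 by apply/matrixP => a b; rewrite !mxE rmorph0.
rewrite mulmx0 mul0mx addr0.
move: (comparison _ _ _ _) => K.
rewrite mulmx_suml mulmx_sumr -sumrB; apply: eq_bigr => c _.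
by rewrite -scalemxAl -scalemxAr scalerBr.
Qed.

(** Z is open and closed, so that near each point the endomorphism is either
    K, to which [holo_differentiable] applies because dK is complex linear on
    Z, or zero. *)
Lemma comparison_endo_holo : holo_endo comparison_endo.
Proof.
split.
- by move=> e; apply: bproj_frame; exact: frame_atP.
- move=> j x jx.
  have cutE c : triv j (comparison_endo (frame j x c)) = c *m cut_comparison j x.
    by rewrite triv_comparison_endo ?bproj_frame // frameK.
  move: (cut_comparison j x) cutE => K /funext-> a c d.
  by rewrite mulmxDl -scalemxAl.
move=> j a b i x ix jx.
have nW : nbhs x (cdom i `&` fdom j) by exact: near_dom.
case: (pselect (Z x)) => Zx; last first.
  apply: (@holo_differentiable R n _ _ (fun _ _ => 0)); last by move=> c; exact: cst_continuous.
  apply: filterS (near_param ix (filterI nW (Zclosed Zx))) => z [zim [[iy jy] Zy]] u.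
  rewrite big1 => [|c _]; last by rewrite mulr0.
  have [_ yz] := chart_image_paramK zim.
  apply: (@has_cderiv_near _ (fun=> 0)); last exact: has_cderiv_cst.
  apply: filterS (near_chart_line u iy (filterI (near_fdom jy) (Zclosed Zy))) => t [[jt Zt] _].
  rewrite /chart_line yz in jt Zt.
  rewrite (comparison_endo_fibmx jt) /cut_comparison.
  by case: asboolP => // _; rewrite mxE.
apply: (@holo_differentiable R n _ _ (fun c z =>
   (A1 i j (delta_mx 0 c) (param i z) *m comparison h0 h1 j (param i z)
     - comparison h0 h1 j (param i z) *m A0 i j (delta_mx 0 c) (param i z)) a b)).
  apply: filterS (near_param ix (filterI nW (Zopen Zx))) => z [zim [[iy jy] Zy]] u.
  have [_ yz] := chart_image_paramK zim.
  have := comparison_has_deriv hh0 hh1 hA0 hA1 u iy jy a b.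
  rewrite comparison_deriv_flat // summxE.
  under eq_bigr => c _ do rewrite mxE.
  apply: has_cderiv_near.
  apply: filterS (near_chart_line u iy (filterI (near_fdom jy) (Zopen Zy))) => t [[jt Zt] _].
  rewrite /chart_line yz in jt Zt *.
  rewrite (comparison_endo_fibmx jt) /cut_comparison.
  by case: asboolP.
move=> c; apply: (@continuous_comp 'rV[C^o]_n X C^o (param i) (fun y =>
   (A1 i j (delta_mx 0 c) y *m comparison h0 h1 j y
     - comparison h0 h1 j y *m A0 i j (delta_mx 0 c) y) a b)).
  exact: param_continuous.
rewrite chartK //.
pose P (g : X -> C) := {for x, continuous (g : X -> C^o)}.
have Pc d : P (fun=> d) by exact: cst_continuous.
have Pa f g : P f -> P g -> P (fun s => f s + g s) by move=> fc gc; exact: ncontinuousD fc gc.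
have Pm f g : P f -> P g -> P (fun s => f s * g s) by move=> fc gc; exact: ncontinuousM fc gc.
have PA A h (hA : chern_connection h A) p q : P (fun y => A i j (delta_mx 0 c) y p q).
  by have [] := chern_C1 hA (delta_mx 0 c) p q ix jx.
have PK p q : P (fun y => comparison h0 h1 j y p q) by exact: (comparison_continuous hh0 hh1 ix jx).
have P1 := fmulmx_closed Pc Pa Pm a b (PA _ _ hA1) PK.
have P0 := fmulmx_closed Pc Pa Pm a b PK (PA _ _ hA0).
have := Pa _ _ P1 (Pm _ _ (Pc (-1)) P0).
congr (P _); apply/funext => y; rewrite !mxE mulN1r //.
Qed.

End Endomorphism.

Theorem theorem1p3 (R : realType) (X : topologicalType) (n k r : nat)
    (M : complex_atlas R X n)
    (X_hausdorff : hausdorff_space X) (X_compact : compact [set: X]%classic)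
    (om : kahler_form M)
    (T : torus_action M k) (T_isometric : isometric_action om T)
    (mu : X -> 'rV[R]_k) (mu_moment : moment_map om T mu)
    (v : 'rV[R]_k -> R) (v_weight : polytope_weight (moment_polytope mu) v)
    (E : hol_bundle M r) (L : torus_lift E T) (E_simple : simple_bundle E)
    (h0 h1 : tot E -> tot E -> R[i])
    (h0_HE : weighted_hermite_einstein L om mu v h0)
    (h1_HE : weighted_hermite_einstein L om mu v h1) :
  exists c : R, 0 < c /\
    forall e e' : tot E, bproj e = bproj e' -> h1 e e' = c%:C * h0 e e'.
Proof.
case: h0_HE => hh0 _ [A0 hA0 [c0 HE0]]; case: h1_HE => hh1 _ [A1 hA1 [c1 HE1]].
have fibreE (e e' : tot E) : bproj e = bproj e' -> forall j, fdom j (bproj e) ->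
    forall h, hermitian_metric h ->
    h e e' = (triv j e *m gram h j (bproj e) *m (triv j e') ^t*) 0 0.
  move=> ee' j jx h hh; rewrite -(metric_gram hh _ _ jx) (trivK jx).
  by rewrite ee' in jx *; rewrite (trivK jx).
(* In rank zero the trace f vanishes identically, but so do both metrics. *)
case: (posnP r) => [r0|r0].
  exists 1; split => // e e' ee'.
  have jx := frame_atP E (bproj e).
  rewrite (fibreE e e' ee' _ jx _ hh1) (fibreE e e' ee' _ jx _ hh0).
  have z (c : 'cV[R[i]]_r) (d : 'rV[R[i]]_r) : (d *m c) 0 0 = 0.
    by rewrite mxE big1 // => a _; have := ltn_ord a; rewrite [X in (_ < X)%N]r0.
  by rewrite !z mulr0.
case: (pselect (exists x : X, True)) => [[x _]|noX]; last first.
  by exists 1; split => // e; case: noX; exists (bproj e).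
have has_max (h h' : tot E -> tot E -> R[i]) : hermitian_metric h -> hermitian_metric h' ->
    exists x0, forall y, tr_ratio h h' y <= tr_ratio h h' x0.
  move=> hh hh'.
  have fc : {within [set: X]%classic, continuous (tr_ratio h h')}.
    by apply: continuous_subspaceT; exact: tr_ratio_continuous.
  have [x0 _ fmax] := @compact_EVT_max X R (tr_ratio h h') setT (ex_intro _ x I) X_compact fc.
  by exists x0 => y; apply: fmax; rewrite inE.
(* At a maximum of tr K the constants satisfy c0 <= c1; at a maximum of tr K^-1,
   c1 <= c0. *)
have c01 : c0 = c1.
  have [y ymax] := has_max h0 h1 hh0 hh1; have [z zmax] := has_max h1 h0 hh1 hh0.
  apply/eqP; rewrite eq_le.
  by rewrite (HE_constant_le v_weight hh0 hh1 hA0 hA1 HE0 HE1 r0 ymax)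
             (HE_constant_le v_weight hh1 hh0 hA1 hA0 HE1 HE0 r0 zmax).
have [x0 fmax] := has_max h0 h1 hh0 hh1.
set f := tr_ratio h0 h1 in fmax.
pose Z := [set y | f y = f x0]%classic.
have Zmax y : Z y -> forall z, f z <= f y by move=> -> z; exact: fmax.
have Zopen y : Z y -> nbhs y Z.
  move=> Zy; rewrite /Z -Zy.
  exact: (maximum_set_open mu_moment v_weight hh0 hh1 hA0 hA1 HE0 HE1 c01 (Zmax y Zy)).
have Zclosed y : ~ Z y -> nbhs y (~` Z)%classic.
  move=> nZy; have fy : f y < f x0 by rewrite lt_neqAle fmax andbT; apply/eqP.
  have : \forall z \near y, f z < f x0.
    have fcy : {for y, continuous f} by exact: tr_ratio_continuous.
    exact: (cvgr_lt _ fcy _ fy).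
  by apply: filterS => z fz /= Zz; rewrite Zz ltxx in fz.
have Zflat (i : cidx M) (j : fidx E) y u : cdom i y -> fdom j y -> Z y ->
    conn_diff A0 A1 i j u y = 0.
  move=> iy jy Zy.
  exact: (conn_diff_at_maximum v_weight hh0 hh1 hA0 hA1 HE0 HE1 u c01 iy jy (Zmax y Zy)).
have [lam lamP] := E_simple _ (comparison_endo_holo hh0 hh1 hA0 hA1 Zopen Zclosed Zflat).
have cutE (j : fidx E) y : fdom j y -> cut_comparison h0 h1 Z j y = lam%:M.
  move=> jy; apply/row_matrixP => a; rewrite !rowE mul_mx_scalar.
  have bp : bproj (frame j y (delta_mx 0 a)) = y by exact: bproj_frame.
  have jb : fdom j (bproj (frame j y (delta_mx 0 a))) by rewrite bp.
  have := lamP j (frame j y (delta_mx 0 a)) jb.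
  by rewrite (triv_comparison_endo hh0 hh1 Z jb) bp (frameK _ jy).
have lam0 : 0 < lam.
  have jx := frame_atP E x0.
  have K0 : comparison h0 h1 (frame_at E x0) x0 = lam%:M.
    by rewrite -(cutE _ _ jx) /cut_comparison asboolT.
  have := tr_comparison_gt0 hh0 hh1 r0 jx; rewrite K0 mxtrace_scalar.
  by rewrite pmulrn_lgt0.
(* Outside Z the cut endomorphism would be zero, yet it is lam with lam > 0. *)
have KE (j : fidx E) y : fdom j y -> comparison h0 h1 j y = lam%:M.
  move=> jy; have := cutE j y jy; rewrite /cut_comparison; case: asboolP => // _.
  move=> /matrixP/(_ (Ordinal r0) (Ordinal r0)); rewrite !mxE eqxx mulr1n => l0.
  by rewrite -l0 ltxx in lam0.
have lamR : lam = (complex.Re lam)%:C.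
  by move: lam0; rewrite ltcE => /andP[/eqP im0 _]; rewrite [LHS]complexE im0 rmorph0 mulr0 addr0.
exists (complex.Re lam); split; first by move: lam0; rewrite ltcE => /andP[].
move=> e e' ee'; rewrite -lamR.
have jx := frame_atP E (bproj e).
rewrite (fibreE e e' ee' _ jx _ hh1) (fibreE e e' ee' _ jx _ hh0).
rewrite -(comparison_gram h1 hh0 jx) (KE _ _ jx) mul_scalar_mx.
by rewrite -scalemxAr -scalemxAl mxE.
Qed.
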